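(* Let $m,n\in\mathbb{N}_0$ with $n<m$, let $\sigma,\beta\in(0,1)$, $s=n+\sigma$, let $U\subset\mathbb{R}^N$ be an open set, and let $u\in C^{2s+\beta}(U)\cap W^{2n,1}_{loc}(\mathbb{R}^N)$ be such that $(-\Delta)^n u\in\mathcal{L}^1_\sigma$ and, for every $i\in\{0,\ldots,n-1\}$, $(-\Delta)^i u\in\mathcal{L}^1_{s-i-\frac12}$ and $|\nabla(-\Delta)^i u|\in\mathcal{L}^1_{s-i-1}$. Then $$L_{m,s}u=(-\Delta)^\sigma(-\Delta)^n u\qquad\text{in }U.$$ In particular, this identity holds in $U=\mathbb{R}^N$ for all $u\in\mathcal{C}^\infty_c(\mathbb{R}^N)$.
   Context: $N\in\mathbb{N}=\{1,2,\ldots\}$ is the dimension, $\mathbb{N}_0=\mathbb{N}\cup\{0\}$. Functions are real-valued on $\mathbb{R}^N$. For $m\in\mathbb{N}$, $\delta_m u(x,y):=\sum_{k=-m}^m(-1)^k\binom{2m}{m-k}u(x+ky)$. For $s\in(0,m)$, $$L_{m,s}u(x):=\frac{c_{N,m,s}}{2}\int_{\mathbb{R}^N}\frac{\delta_m u(x,y)}{|y|^{N+2s}}\,dy,$$ where, for $s\in(0,m)\setminus\mathbb{N}$ (which is the case here), $$c_{N,m,s}:=\frac{4^s\Gamma(\frac N2+s)}{\pi^{N/2}\Gamma(-s)}\Big(\sum_{k=1}^m(-1)^k\binom{2m}{m-k}k^{2s}\Big)^{-1}.$$ For $\sigma\in(0,1)$ the fractional Laplacian is $(-\Delta)^\sigma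 v(x):=L_{1,\sigma}v(x)=-\frac{4^\sigma\Gamma(\frac N2+\sigma)}{2\pi^{N/2}\Gamma(-\sigma)}\int_{\mathbb{R}^N}\frac{2v(x)-v(x+y)-v(x-y)}{|y|^{N+2\sigma}}\,dy$. For $n\in\mathbb{N}_0$, $(-\Delta)^n:=(-\sum_{i=1}^N\partial_{ii})^n$ (identity if $n=0$), with weak derivatives where $u$ is only Sobolev. $\mathcal{L}^1_t:=\{u\in L^1_{loc}(\mathbb{R}^N):\int_{\mathbb{R}^N}\frac{|u(x)|}{1+|x|^{N+2t}}dx<\infty\}$ for $t>0$. For $t=k+\tau$ with $k\in\mathbb{N}_0$, $\tau\in(0,1]$ and $U$ open, $C^t(U)$ is the space of functions that are $k$-times continuously differentiable in $U$ with derivatives of order $k$ locally $\tau$-Hölder continuous in $U$ (locally Lipschitz if $\tau=1$). $W^{k,1}_{loc}(\mathbb{R}^N)$ is the Sobolev space of $k$-times weakly differentiable functions that are, with their weak derivatives up to order $k$, locally integrable. $\mathcal{C}^\infty_c(\mathbb{R}^N)$ denotes smooth compactly supported functions. *)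

(* Defs.v *)
From HB Require Import structures.
From mathcomp Require Import all_boot all_order all_algebra.
From mathcomp Require Import all_classical all_reals all_analysis.
Set Implicit Arguments.
Unset Strict Implicit.
Unset Printing Implicit Defensive.
Import Order.TTheory GRing.Theory Num.Theory.
Import numFieldNormedType.Exports.
Local Open Scope classical_set_scope.
Local Open Scope ring_scope.

Definition measure_rV_display : measure_display.
Proof. exact: default_measure_display. Qed.

Section measurable_rV.
Context {R : realType}.
Variable n : nat.

Let coors : 'I_n -> 'rV[R]_n -> measurableTypeR R := fun i x => x ord0 i.

Let rV_set0 : g_sigma_preimage coors set0.
Proof. exact: sigma_algebra0. Qed.

Let rV_setC A : g_sigma_preimage coors A -> g_sigma_preimage coors (~` A).
Proof. exact: sigma_algebraC. Qed.

Let rV_bigcup (F : _^nat) : (forall i, g_sigma_preimage coors (F i)) ->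
  g_sigma_preimage coors (\bigcup_i (F i)).
Proof. exact: sigma_algebra_bigcup. Qed.

HB.instance Definition _ := @isMeasurable.Build measure_rV_display
  'rV[R]_n (g_sigma_preimage coors) rV_set0 rV_setC rV_bigcup.

End measurable_rV.

Section measurable_fun_rV.
Context {R : realType}.

Lemma measurable_rV_coord n (i : 'I_n) :
  measurable_fun setT (fun x : 'rV[R]_n => x ord0 i : measurableTypeR R).
Proof.
move=> _ Y mY; rewrite setTI; apply: sub_sigma_algebra => /=.
rewrite -bigcup_seq/=; exists i => /=; first by rewrite mem_index_enum.
by exists Y => //; rewrite setTI.
Qed.

Lemma measurable_fun_rVP d (T : measurableType d) n (f : T -> 'rV[R]_n) :
  (forall i, measurable_fun setT (fun x => f x ord0 i : measurableTypeR R)) ->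
  measurable_fun setT f.
Proof.
move=> mf _ A mA.
pose coors (i : 'I_n) (x : 'rV[R]_n) : measurableTypeR R := x ord0 i.
suff: g_sigma_preimage (fun i => coors i \o f) `<=` measurable.
  apply; rewrite g_sigma_preimage_comp.
  by exists A.
apply: smallest_sub; first exact: sigma_algebra_measurable.
rewrite -bigcup_seq; apply: bigcup_sub => i _.
by move=> B [C mC <-]; exact: mf.
Qed.

Definition cons_rV n (p : measurableTypeR R * 'rV[R]_n) : 'rV[R]_n.+1 :=
  row_mx (const_mx p.1 : 'rV[R]_1) p.2.

Definition uncons_rV n (v : 'rV[R]_n.+1) : measurableTypeR R * 'rV[R]_n :=
  (v ord0 ord0, rsubmx (v : 'rV[R]_(1 + n))).

Lemma uncons_rVK n : cancel (@uncons_rV n) (@cons_rV n).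
Proof.
move=> v; rewrite -[RHS](@hsubmxK _ 1 1 n) /cons_rV /uncons_rV /=.
rewrite (_ : const_mx _ = lsubmx (v : 'rV[R]_(1 + n)))//.
apply/rowP => i; rewrite !mxE ord1; congr (v _ _). rewrite ord1.
exact/val_inj.
Qed.

Lemma cons_rVK n : cancel (@cons_rV n) (@uncons_rV n).
Proof.
move=> [x v]; rewrite /cons_rV /uncons_rV row_mxKr /=; congr pair.
have -> : (ord0 : 'I_(1 + n)) = lshift n (ord0 : 'I_1) by exact/val_inj.
by rewrite [LHS](@row_mxEl _ 1 1 n) mxE.
Qed.

Lemma measurable_cons_rV n : measurable_fun setT (@cons_rV n).
Proof.
apply: measurable_fun_rVP => i; rewrite /cons_rV.
have [j|j] := @split_ordP 1 n i => ->.
  rewrite (_ : (fun _ => _) = fst); first exact: measurable_fst.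
  by apply/funext => p; rewrite [LHS](@row_mxEl _ 1 1 n) mxE.
rewrite (_ : (fun _ => _) = (fun v : 'rV[R]_n => v ord0 j) \o snd); last first.
  by apply/funext => p; rewrite [LHS](@row_mxEr _ 1 1 n).
exact: (measurableT_comp (measurable_rV_coord j) measurable_snd).
Qed.

Lemma measurable_uncons_rV n : measurable_fun setT (@uncons_rV n).
Proof.
apply: measurable_fun_pair => /=.
  exact: measurable_rV_coord.
apply: measurable_fun_rVP => i.
under eq_fun do rewrite mxE.
exact: measurable_rV_coord.
Qed.

End measurable_fun_rV.

Section lebesgue_rV_step.
Context {R : realType} {n : nat}.
Variable mu : {sigma_finite_measure set 'rV[R]_n -> \bar R}.

Definition lebesgue_rV_step : set 'rV[R]_n.+1 -> \bar R :=
  pushforward (lebesgue_measure \x mu)%E (@cons_rV R n).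

Let step0 : (lebesgue_rV_step set0 = 0)%E.
Proof. by rewrite /lebesgue_rV_step /pushforward preimage_set0 measure0. Qed.

Let step_ge0 A : (0 <= lebesgue_rV_step A)%E.
Proof.
exact: (measure_ge0 ((lebesgue_measure \x mu)%E : {measure set _ -> \bar R})).
Qed.

Let step_sigma_additive : semi_sigma_additive lebesgue_rV_step.
Proof.
pose m : {measure set _ -> \bar R} := (lebesgue_measure \x mu)%E.
move=> F mF tF mUF; rewrite /lebesgue_rV_step /pushforward preimage_bigcup.
have mcons A : measurable A -> measurable (@cons_rV R n @^-1` A).
  by move=> mA; rewrite -[X in measurable X]setTI; exact: measurable_cons_rV.
apply: (@measure_semi_sigma_additive _ _ _ m).
- by move=> k; exact: mcons.
- apply/trivIsetP => /= i j _ _ ij; rewrite -preimage_setI.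
  by move/trivIsetP : tF => /(_ _ _ _ _ ij) ->//; rewrite preimage_set0.
- by rewrite -preimage_bigcup; exact: mcons.
Qed.

HB.instance Definition _ := isMeasure.Build _ _ _
  lebesgue_rV_step step0 step_ge0 step_sigma_additive.

Let step_sigma_finite : sigma_finite setT lebesgue_rV_step.
Proof.
have /sigma_finiteP[F [TF ndF Foo]] := sigma_finiteT (@lebesgue_measure R).
have /sigma_finiteP[G [TG ndG Goo]] := sigma_finiteT mu.
exists (fun k => @uncons_rV R n @^-1` (F k `*` G k)).
  rewrite -preimage_bigcup (_ : \bigcup_k _ = setT) ?preimage_setT//.
  apply/seteqP; split=> // -[x y] _.
  have [k _ Fx] : (\bigcup_k F k) x by rewrite -TF.
  have [l _ Gy] : (\bigcup_k G k) y by rewrite -TG.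
  exists (maxn k l) => //; split.
  - by move: x Fx; exact/subsetPset/ndF/leq_maxl.
  - by move: y Gy; exact/subsetPset/ndG/leq_maxr.
move=> k; have [mF Fkoo] := Foo k; have [mG Gkoo] := Goo k; split.
  rewrite -[X in measurable X]setTI.
  by apply: measurable_uncons_rV => //; exact: measurableX.
rewrite /lebesgue_rV_step /pushforward -comp_preimage.
rewrite (_ : _ \o _ = id); last by apply/funext => p /=; rewrite cons_rVK.
by rewrite preimage_id product_measure1E// lte_mul_pinfty// ge0_fin_numE.
Qed.

HB.instance Definition _ := Measure_isSigmaFinite.Build _ _ _
  lebesgue_rV_step step_sigma_finite.

End lebesgue_rV_step.

(* The n-fold product of the Lebesgue measure of R, on Borel sets. *)
Fixpoint borel_lebesgue_rV (R : realType) (n : nat) :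
    {sigma_finite_measure set 'rV[R]_n -> \bar R} :=
  match n with
  | 0 => \d_(0 : 'rV[R]_0)
  | k.+1 => lebesgue_rV_step (borel_lebesgue_rV R k)
  end.


(* The completion makes its measurable sets the Lebesgue-measurable ones. *)
Definition lebesgue_rV {R : realType} {n : nat} :=
  @completed_measure_extension _ _ _ (borel_lebesgue_rV R n).
HB.instance Definition _ (R : realType) (n : nat) :=
  Measure.on (@lebesgue_rV R n).

(* The norm of the normed module ['rV[R]_n] is the maximum norm. *)
Definition enorm {R : realType} {n : nat} (x : 'rV[R]_n) : R :=
  Num.sqrt (\sum_i x ord0 i ^+ 2).

Section classical_derivatives.
Context {R : realType} {N : nat}.
Implicit Types (f : 'rV[R]_N -> R) (U : set 'rV[R]_N).

(* Multi-indices are represented by lists of coordinates: [:: i; j] stands for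
   d_i d_j. In [cont_diff], [locally_hoelder] and [hoelder_space], U is meant
   to be open. *)
Definition partials (s : seq 'I_N) f : 'rV[R]_N -> R :=
  foldr (fun i g => 'D_(delta_mx ord0 i) g) f s.

Definition neg_laplacian f : 'rV[R]_N -> R :=
  fun x => - \sum_i partials [:: i; i] f x.

Definition cont_diff (k : nat) U f : Prop :=
  forall s : seq 'I_N, (size s <= k)%N -> forall x, U x ->
    {for x, continuous (partials s f)} /\
    ((size s < k)%N -> forall i, derivable (partials s f) x (delta_mx ord0 i)).

Definition locally_hoelder (tau : R) U f : Prop :=
  forall x, U x -> exists C : R, exists2 V : set 'rV[R]_N, nbhs x V &
    forall y z, V y -> V z -> `|f y - f z| <= C * enorm (y - z) `^ tau.

Definition hoelder_space (t : R) U f : Prop :=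
  exists (k : nat) (tau : R),
    [/\ t = k%:R + tau, 0 < tau <= 1, cont_diff k U f &
        forall s : seq 'I_N, size s = k -> locally_hoelder tau U (partials s f)].

Definition test_function f : Prop :=
  (forall k, cont_diff k setT f) /\ compact (closure [set x | f x != 0]).

End classical_derivatives.

Section weak_derivatives.
Context {R : realType} {N : nat}.
Implicit Types f g u v w : 'rV[R]_N -> R.
Local Notation mu := (@lebesgue_rV R N).

Definition L1loc f : Prop :=
  forall K : set 'rV[R]_N, compact K -> mu.-integrable K (EFin \o f).

Definition L1weighted (t : R) f : Prop :=
  L1loc f /\
  (\int[mu]_x (`|f x| / (1 + enorm x `^ (N%:R + 2 * t)))%:E < +oo)%E.

Definition weak_partials (s : seq 'I_N) f g : Prop :=
  [/\ L1loc f, L1loc g &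
      forall phi, test_function phi ->
        \int[mu]_x (f x * partials s phi x) =
        (-1) ^+ size s * \int[mu]_x (g x * phi x)].

Definition sobolev_loc (k : nat) f : Prop :=
  forall s : seq 'I_N, (size s <= k)%N -> exists g, weak_partials s f g.

Definition weak_gradient f (g : 'rV[R]_N -> 'rV[R]_N) : Prop :=
  forall i, weak_partials [:: i] f (fun x => g x ord0 i).

Definition weak_neg_laplacian f g : Prop :=
  exists2 h : 'I_N -> 'rV[R]_N -> R,
    forall i, weak_partials [:: i; i] f (h i) &
    {ae mu, forall x, g x = - \sum_i h i x}.

Fixpoint weak_neg_laplacian_iter (k : nat) u v : Prop :=
  match k with
  | 0 => {ae mu, forall x, v x = u x}
  | k'.+1 => exists2 w, weak_neg_laplacian_iter k' u w & weak_neg_laplacian w v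
  end.

(* A weak (-Delta)^k u is determined only up to a null set; where u is smooth
   it has to be the classical one for its pointwise values to make sense. *)
Definition neg_laplacian_iter_in (U : set 'rV[R]_N) (k : nat) u v : Prop :=
  weak_neg_laplacian_iter k u v /\
  forall x, U x -> v x = iter k neg_laplacian u x.

End weak_derivatives.

Section gamma_function.
Context {R : realType}.

Definition euler_integral (x : R) : R :=
  \int[lebesgue_measure]_(t in `]0, +oo[) (t `^ (x - 1) * expR (- t)).

(* For x <= 0, continuation by Gamma (x) = Gamma (x + k) / (x ... (x + k - 1)),
   where k = - floor x and so 0 <= x + k < 1; the value at the poles
   x = 0, -1, -2, ... is junk. *)
Definition Gamma (x : R) : R :=
  if 0 < x then euler_integral x
  else let k := `|Num.floor x|%N in
    euler_integral (x + k%:R) / \prod_(i < k) (x + i%:R).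

End gamma_function.

Section fractional_laplacian.
Context {R : realType} {N : nat}.
Implicit Types (m : nat) (s : R) (u : 'rV[R]_N -> R) (x y : 'rV[R]_N).

(* The index j stands for k + m. *)
Definition finite_difference m u x y : R :=
  \sum_(j < (2 * m)%N.+1) let k := j%:Z - m%:Z in
    (-1) ^ k * 'C((2 * m)%N, `|m%:Z - k|%N)%:R * u (x + k%:~R *: y).

Definition normalization (n m : nat) s : R :=
  4 `^ s * Gamma (n%:R / 2 + s) / (pi `^ (n%:R / 2) * Gamma (- s)) *
  (\sum_(1 <= k < m.+1) (-1) ^+ k * 'C((2 * m)%N, m - k)%:R * k%:R `^ (2 * s))^-1.

Definition hypersingular_integrand m s u x y : R :=
  finite_difference m u x y / enorm y `^ (N%:R + 2 * s).

Definition hypersingular m s u x : R :=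
  normalization N m s / 2 *
  \int[@lebesgue_rV R N]_y hypersingular_integrand m s u x y.

Definition frac_laplacian (sigma : R) u x : R := hypersingular 1 sigma u x.

(* The library integral is total; this says that the one in [hypersingular]
   converges absolutely. *)
Definition hypersingular_defined m s u x : Prop :=
  (@lebesgue_rV R N).-integrable setT (EFin \o hypersingular_integrand m s u x).

End fractional_laplacian.

(* Main.v *)
Require Import Defs.
From mathcomp Require Import all_boot all_order all_algebra.
From mathcomp Require Import all_classical all_reals all_analysis.
From mathcomp Require Import measurable_realfun.
From mathcomp Require Import ring lra zify.
Import Order.TTheory GRing.Theory Num.Theory.
Import numFieldNormedType.Exports.
Local Open Scope classical_set_scope.
Local Open Scope ring_scope.
Set Implicit Arguments.
Unset Strict Implicit.
Unset Printing Implicit Defensive.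


(** Write a_k = (-1)^k C(2m, m-k) for |k| <= m, v_j for the iterate (-Delta)^j u,
    t_j = s - j, and

      F_j(y) = sum_k a_k k^(2j) v_j(x + k y),
      I_j = integral of F_j(y) |y|^(-N - 2 t_j) dy,      0 <= j <= n.

    Up to the normalizing constant, I_0 is L_(m,s) u(x); the proof passes from
    I_0 to I_n, and from I_n to the integral in (-Delta)^sigma v_n(x).

    The first passage is the recurrence 2 t_j (N + 2 t_j - 2) I_j = - I_(j+1)
    ([parts_against_power]).  As a function of y, Delta (v_j(x + k y)) is
    - k^2 v_(j+1)(x + k y), so that Delta F_j = - F_(j+1), whereas the Laplacian
    of |y|^(-N-2t+2) is 2 t (N + 2 t - 2) |y|^(-N-2t): the recurrence is Green's
    formula for F_j and a power of |y|.  To avoid boundary terms, and to use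
    nothing of v_j but its distributional Laplacian, the power is multiplied
    by a smooth cut-off to an annulus that exhausts the space.  With the cut-off
    chosen in [annular], the Laplacian of the product is |y|^(-N-2t) times
    a bounded function that converges pointwise to a constant
    ([radial_laplacianE], [laplacian_profile_cvg]), and dominated convergence
    concludes, because F_j |y|^(-N - 2 t_j) is integrable
    ([rintegrable_difference_quotient]).  At infinity this is the weighted
    integrability of v_j.  Near 0 it holds because sum_k a_k k^p = 0 for p < 2m
    ([fd_moment]), so that F_j is as small as the remainder of a Taylor
    expansion of v_j at x ([difference_at]).

    The second passage is the scaling of the terms of I_n ([integral_even_difference]).
    Since sum_k a_k k^(2n) = 0 and the weights are even in k, F_n(y) is
    - 1/2 sum_k a_k k^(2n) d(k y), where d(y) = 2 v_n(x) - v_n(x+y) - v_n(x-y).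
    Substituting k y for y in each term gives
    I_n = - S * (integral of d(y) |y|^(-N-2 sigma) dy), where S is the sum
    of a_k k^(2s) over 1 <= k <= m.

    The constants then agree: by Gamma(z+1) = z Gamma(z), the product of the
    factors 2 t_j (N + 2 t_j - 2) is what separates the normalizing constants of
    orders s and sigma ([gamma_ratioS]), and S cancels against the sum in
    c_(N,m,s).  It may be cancelled as S <> 0 ([fd_constant_neq0]): as
    a function of s it is an exponential sum with m terms which vanishes at
    1, ..., m-1, and it would be zero identically if it had one zero more.

    For u in C_c^infinity the functions v_j = (-Delta)^j u satisfy
    the assumptions of the common core [hypersingular_iter] directly. *)

(** * Integrals under maps that scale a measure *)

Section scaling_map.
Context d (T : measurableType d) (R : realType).
Variables (mu : {measure set T -> \bar R}) (phi : T -> T) (c : {nonneg R}).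
Hypothesis mphi : measurable_fun [set: T] phi.
Hypothesis muphi :
  forall A, measurable A -> mu (phi @^-1` A) = (c%:num%:E * mu A)%E.

Lemma ge0_integral_scaling_map (f : T -> \bar R) :
  measurable_fun [set: T] f -> (forall x, 0 <= f x)%E ->
  (\int[mu]_x f (phi x) = c%:num%:E * \int[mu]_x f x)%E.
Proof.
move=> mf f0; rewrite -ge0_integral_mscale//.
have -> : (\int[mu]_x f (phi x) = \int[pushforward mu phi]_x f x)%E.
  by rewrite ge0_integral_pushforward.
by apply: eq_measure_integral => //= A mA _; exact: muphi.
Qed.

Lemma integrable_scaling_map (f : T -> \bar R) :
  mu.-integrable setT f -> mu.-integrable setT (f \o phi).
Proof.
move=> /integrableP[mf foo]; apply/integrableP; split.
  exact: measurableT_comp.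
rewrite (ge0_integral_scaling_map (f := fun x => `|f x|%E))//; last exact: measurableT_comp.
by rewrite lte_mul_pinfty// ltry.
Qed.

Lemma Rintegral_scaling_map (f : T -> R) : mu.-integrable setT (EFin \o f) ->
  \int[mu]_x f (phi x) = c%:num * \int[mu]_x f x.
Proof.
move=> fi; have mf : measurable_fun [set: T] f by exact/measurable_EFinP/(measurable_int mu).
have fineD (g : T -> R) : mu.-integrable setT (EFin \o g) ->
    \int[mu]_x g x = fine (\int[mu]_x (EFin \o g)^\+ x)%E
                     - fine (\int[mu]_x (EFin \o g)^\- x)%E.
  move=> gi; rewrite /Rintegral integralE -fineB//.
    exact: integrable_pos_fin_num.
  exact: integrable_neg_fin_num.
rewrite (fineD (f \o phi)) ?(fineD f)//; last exact: (integrable_scaling_map fi).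
have p1 := integrable_pos_fin_num measurableT fi.
have p2 := integrable_neg_fin_num measurableT fi.
have -> : EFin \o (f \o phi) = (EFin \o f) \o phi by [].
rewrite mulrBr; congr (_ - _).
  under eq_integral do rewrite funepos_comp/=.
  rewrite (ge0_integral_scaling_map (f := ((EFin \o f)^\+)%E))//; last first.
    exact/measurable_funepos/measurable_EFinP.
  by rewrite fineM.
under eq_integral do rewrite funeneg_comp/=.
rewrite (ge0_integral_scaling_map (f := ((EFin \o f)^\-)%E))//; last first.
  exact/measurable_funeneg/measurable_EFinP.
by rewrite fineM.
Qed.

End scaling_map.

Section affine_R.
Context {R : realType}.
Local Notation lam := (@lebesgue_measure R).

Lemma measurable_affineR (a k : R) :
  measurable_fun setT (fun y : measurableTypeR R => (a + k * y : measurableTypeR R)).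
Proof.
by apply: measurable_funD => //; apply: measurable_funM => //; exact: measurable_id.
Qed.

(** By uniqueness of the Lebesgue measure: |k| times the image measure gives
    half-open intervals their length.  The sign of k decides which endpoint of
    the preimage is open. *)
Lemma lebesgue_measure_affine (a k : R) (A : set (measurableTypeR R)) :
  k != 0 -> measurable A ->
  lam ((fun y : measurableTypeR R => (a + k * y : measurableTypeR R)) @^-1` A)
  = (`|k|^-1%:E * lam A)%E.
Proof.
move=> k0 mA.
pose phi := fun y : measurableTypeR R => (a + k * y : measurableTypeR R).
have mphi : measurable_fun setT phi by exact: measurable_affineR.
have kp : 0 < `|k| by rewrite normr_gt0.
pose c : {nonneg R} := NngNum (normr_ge0 k).
have -> : lam A = mscale c (measure_function_pushforward__canonical__measure_function_Measure lam mphi) A.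
  apply: lebesgue_measure_unique => // _ [[p q] _ <-] /=.
  rewrite /mscale/= /pushforward.
  have : k < 0 \/ 0 < k by case: (ltgtP k 0) k0 => //; [left|right].
  case=> [kn|kn].
    have -> : phi @^-1` `]p, q] = `[(q - a) / k, (p - a) / k[%classic.
      apply/seteqP; split => y; rewrite /phi /= !in_itv/=.
        by move=> /andP[h1 h2]; apply/andP; split;
          [rewrite ler_ndivrMr//; lra | rewrite ltr_ndivlMr//; lra].
      by rewrite ler_ndivrMr// ltr_ndivlMr// => /andP[h1 h2]; apply/andP; split; lra.
    rewrite !lebesgue_measure_itv/= !lte_fin ltr_ndivlMr// divfK//.
    rewrite ltrD2r; case: ifP => _; last by rewrite mule0.
    by rewrite -!EFinD -EFinM; congr EFin; rewrite ltr0_norm//; field.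
  have -> : phi @^-1` `]p, q] = `](p - a) / k, (q - a) / k]%classic.
    apply/seteqP; split => y; rewrite /phi /= !in_itv/=.
      by move=> /andP[h1 h2]; apply/andP; split;
          [rewrite ltr_pdivrMr//; lra | rewrite ler_pdivlMr//; lra].
    by rewrite ltr_pdivrMr// ler_pdivlMr// => /andP[h1 h2]; apply/andP; split; lra.
  rewrite !lebesgue_measure_itv/= !lte_fin ltr_pdivlMr// divfK//.
  rewrite ltrD2r; case: ifP => _; last by rewrite mule0.
  by rewrite -!EFinD -EFinM; congr EFin; rewrite gtr0_norm//; field.
by rewrite /mscale/= /pushforward muleA -EFinM mulVf ?gt_eqF// mul1e.
Qed.

End affine_R.

(** * Affine changes of variables *)

Section affine_rV.
Context {R : realType}.

Definition affine n (x : 'rV[R]_n) (k : R) : 'rV[R]_n -> 'rV[R]_n :=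
  fun y => x + k *: y.

Lemma affineK n (x : 'rV[R]_n) k : k != 0 ->
  cancel (affine x k) (affine (- (k^-1 *: x)) k^-1).
Proof.
move=> k0 y; rewrite /affine scalerDr scalerA mulVf// scale1r addrA addNr.
by rewrite add0r.
Qed.

Lemma affineVK n (x : 'rV[R]_n) k : k != 0 ->
  cancel (affine (- (k^-1 *: x)) k^-1) (affine x k).
Proof.
move=> k0 y; rewrite /affine scalerDr scalerN !scalerA mulfV// !scale1r.
by rewrite addrA subrr add0r.
Qed.

Lemma measurable_affine n (x : 'rV[R]_n) k : measurable_fun setT (affine x k).
Proof.
apply: measurable_fun_rVP => i; rewrite /affine.
under eq_fun do rewrite !mxE.
exact: (measurableT_comp (measurable_affineR (x ord0 i) k) (measurable_rV_coord i)).
Qed.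

Lemma uncons_affine n (x v : 'rV[R]_n.+1) k :
  uncons_rV (affine x k v) = ((uncons_rV x).1 + k * (uncons_rV v).1,
                              affine (uncons_rV x).2 k (uncons_rV v).2).
Proof.
rewrite /uncons_rV /affine /=; congr pair; first by rewrite !mxE.
by apply/rowP => i; rewrite !mxE.
Qed.

Lemma xsection_cons_affine n (x : 'rV[R]_n.+1) k (A : set 'rV[R]_n.+1) t :
  xsection (@cons_rV R n @^-1` (affine x k @^-1` A)) t =
  affine (uncons_rV x).2 k @^-1`
    xsection (@cons_rV R n @^-1` A) ((uncons_rV x).1 + k * t).
Proof.
apply/seteqP; split => y; rewrite /xsection /= !inE /=;
  by rewrite -[affine x k _]uncons_rVK uncons_affine cons_rVK.
Qed.

(** By induction on the dimension, computing the product measure by sections: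
    the section of the preimage at t is the preimage of a section at x_0 + k t, so
    that one factor |k|^-1 comes from the induction and one from the line. *)
Lemma borel_lebesgue_rV_affine n (x : 'rV[R]_n) k (A : set 'rV[R]_n) :
  k != 0 -> measurable A ->
  borel_lebesgue_rV R n (affine x k @^-1` A)
  = ((`|k|^-1 ^+ n)%:E * borel_lebesgue_rV R n A)%E.
Proof.
move=> k0; elim: n x A => [|n IH] x A mA.
  rewrite expr0 mul1e /= !diracE /affine; congr (_%:R%:E); congr nat_of_bool.
  by apply/idP/idP; rewrite !inE /= (thinmx0 (x + _)).
rewrite /= /lebesgue_rV_step /pushforward /product_measure1.
set S := xsection (@cons_rV R n @^-1` A).
have mc : measurable (@cons_rV R n @^-1` A).
  by rewrite -[X in measurable X]setTI; exact: measurable_cons_rV.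
have mS t : measurable (S t) by exact: measurable_xsection.
have mf : measurable_fun [set: measurableTypeR R] (borel_lebesgue_rV R n \o S).
  exact: measurable_fun_xsection.
transitivity (\int[lebesgue_measure]_t ((`|k|^-1 ^+ n)%:E *
    (borel_lebesgue_rV R n \o S) ((uncons_rV x).1 + k * t)%R))%E.
  apply: eq_integral => t _ /=.
  by rewrite xsection_cons_affine IH.
have nn (m : nat) : 0 <= `|k|^-1 ^+ m by rewrite exprn_ge0// invr_ge0.
rewrite ge0_integralZl//; last exact: measurableT_comp (measurable_affineR _ _).
have /= -> := (@ge0_integral_scaling_map _ _ _ lebesgue_measure
  (fun y : measurableTypeR R => ((uncons_rV x).1 + k * y : measurableTypeR R))
  (NngNum (nn 1%N)) _ _ (borel_lebesgue_rV R n \o S) mf).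
- by rewrite muleA -EFinM -exprSr.
- exact: measurable_affineR.
- by move=> B mB; exact: lebesgue_measure_affine.
- by move=> y.
Qed.

End affine_rV.

(** The measure [lebesgue_rV] lives on the type of row vectors equipped with
    the Caratheodory-measurable sets of the outer measure. *)
Notation lebesgue_type R N :=
  (caratheodory_type ((borel_lebesgue_rV R N)^*)%mu).

Section lebesgue_rV_affine.
Context {R : realType} {N : nat}.
Local Notation mu := (@lebesgue_rV R N).
Local Notation V := (lebesgue_type R N).
Local Notation bmu := (borel_lebesgue_rV R N).
Implicit Types (x : 'rV[R]_N) (k : R).

Let bmu_ext_affine_le x k (A : set 'rV[R]_N) : k != 0 ->
  (mu (affine x k @^-1` A) <= (`|k|^-1 ^+ N)%:E * mu A)%E.
Proof.
move=> k0; have kp : 0 < `|k|^-1 ^+ N by rewrite exprn_gt0// invr_gt0 normr_gt0.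
rewrite -lee_pdivrMl//; apply: le_ereal_inf_tmp => _ [F [mF AF] <-].
rewrite lee_pdivrMl//.
have -> : ((`|k|^-1 ^+ N)%:E * \sum_(i <oo) bmu (F i) =
           \sum_(i <oo) bmu (affine x k @^-1` F i))%E.
  rewrite -nneseriesZl//.
  by apply: eq_eseriesr => i _; rewrite borel_lebesgue_rV_affine.
apply: ereal_inf_lbound; exists (fun i => affine x k @^-1` F i) => //; split.
  move=> i; rewrite -[X in measurable X]setTI; exact: measurable_affine.
by rewrite -preimage_bigcup; exact: preimage_subset.
Qed.

(** Stated for the outer measure, hence for all sets: coverings by Borel sets
    are mapped to such coverings, and the affine maps are invertible. *)
Lemma lebesgue_rV_preimage_affine x k (A : set 'rV[R]_N) : k != 0 ->
  mu (affine x k @^-1` A) = ((`|k|^-1 ^+ N)%:E * mu A)%E.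
Proof.
move=> k0; apply/eqP; rewrite eq_le bmu_ext_affine_le//=.
have kp : 0 < `|k|^-1 ^+ N by rewrite exprn_gt0// invr_gt0 normr_gt0.
rewrite -lee_pdivlMl//.
have := @bmu_ext_affine_le (- (k^-1 *: x)) k^-1 (affine x k @^-1` A) (invr_neq0 k0).
by rewrite normfV invrK -exprVn invrK -comp_preimage (_ : _ \o _ = id) ?preimage_id//;
  apply/funext => y /=; rewrite affineVK.
Qed.

(** The Caratheodory condition for the preimage, tested on X, is the one for A,
    tested on the image of X, with all terms multiplied by the same factor. *)
Lemma measurable_lebesgue_affine x k : k != 0 ->
  measurable_fun [set: V] (affine x k : V -> V).
Proof.
move=> k0 _ A mA; rewrite setTI.
have cA : (mu : set V -> \bar R).-caratheodory A by [].
suff : (mu : set V -> \bar R).-caratheodory (affine x k @^-1` A) by [].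
move=> X.
have -> : X = affine x k @^-1` (affine (- (k^-1 *: x)) k^-1 @^-1` X).
  by apply/seteqP; split => y /=; rewrite affineK.
set Y := (_ @^-1` X).
rewrite preimage_setC -!preimage_setI.
rewrite (lebesgue_rV_preimage_affine x Y)// (lebesgue_rV_preimage_affine x (Y `&` A))//.
rewrite (lebesgue_rV_preimage_affine x (Y `&` ~` A))//.
rewrite -ge0_muleDr//; congr (_ * _)%E; exact: cA.
Qed.

Lemma measurable_fun_borel d (T : measurableType d) (f : 'rV[R]_N -> T) :
  measurable_fun setT f -> measurable_fun [set: V] (f : V -> T).
Proof.
move=> mf _ Y mY; rewrite setTI; apply: caratheodory_measurable_mu_ext.
by rewrite -[X in measurable X]setTI; exact: mf.
Qed.

Lemma ge0_integral_affine x k (f : V -> \bar R) : k != 0 ->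
  measurable_fun [set: V] f -> (forall y, 0 <= f y)%E ->
  (\int[mu]_y f (affine x k y) = (`|k|^-1 ^+ N)%:E * \int[mu]_y f y)%E.
Proof.
move=> k0 mf f0.
have c0 : 0 <= `|k|^-1 ^+ N by rewrite exprn_ge0// invr_ge0.
have H : forall A : set V, measurable A -> mu ((affine x k : V -> V) @^-1` A) =
    ((NngNum c0)%:num%:E * mu A)%E.
  by move=> A mA; exact: lebesgue_rV_preimage_affine.
exact: (@ge0_integral_scaling_map _ _ _ mu _ _ (measurable_lebesgue_affine x k0) H f).
Qed.

Lemma integrable_affine x k (f : V -> \bar R) : k != 0 ->
  mu.-integrable setT f -> mu.-integrable setT (fun y => f (affine x k y)).
Proof.
move=> k0.
have c0 : 0 <= `|k|^-1 ^+ N by rewrite exprn_ge0// invr_ge0.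
have H : forall A : set V, measurable A -> mu ((affine x k : V -> V) @^-1` A) =
    ((NngNum c0)%:num%:E * mu A)%E.
  by move=> A mA; exact: lebesgue_rV_preimage_affine.
exact: (@integrable_scaling_map _ _ _ mu _ _ (measurable_lebesgue_affine x k0) H f).
Qed.

Lemma Rintegral_affine x k (f : V -> R) : k != 0 ->
  mu.-integrable setT (EFin \o f) ->
  \int[mu]_y f (affine x k y) = `|k|^-1 ^+ N * \int[mu]_y f y.
Proof.
move=> k0.
have c0 : 0 <= `|k|^-1 ^+ N by rewrite exprn_ge0// invr_ge0.
have H : forall A : set V, measurable A -> mu ((affine x k : V -> V) @^-1` A) =
    ((NngNum c0)%:num%:E * mu A)%E.
  by move=> A mA; exact: lebesgue_rV_preimage_affine.
exact: (@Rintegral_scaling_map _ _ _ mu _ _ (measurable_lebesgue_affine x k0) H f).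
Qed.

End lebesgue_rV_affine.

Section borel.
Context {R : realType}.

Lemma measurable_rV_box N (a b : 'rV[R]_N) :
  measurable [set y : 'rV[R]_N | forall i, a ord0 i < y ord0 i < b ord0 i].
Proof.
rewrite (_ : [set _ | _] = \big[setI/setT]_(i < N)
    ((fun y : 'rV[R]_N => y ord0 i : measurableTypeR R) @^-1`
       `]a ord0 i, b ord0 i[%classic)).
  apply: bigsetI_measurable => i _.
  by rewrite -[X in measurable X]setTI; exact: measurable_rV_coord.
rewrite -bigcap_seq; apply/seteqP; split => y /=.
  by move=> h i _ /=; rewrite in_itv/=.
by move=> h i; have := h i (mem_index_enum i); rewrite /= in_itv.
Qed.

(** An open set is the union of the boxes with rational centre and radius
    1/(k+1) that it contains. *)
Lemma open_measurable_rV N (U : set 'rV[R]_N) : open U -> measurable U.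
Proof.
move=> oU.
pose box (q : 'rV[rat]_N * nat) : set 'rV[R]_N := [set y : 'rV[R]_N | forall i,
  (\row_j (ratr (q.1 ord0 j) - q.2.+1%:R^-1) : 'rV[R]_N) ord0 i < y ord0 i <
  (\row_j (ratr (q.1 ord0 j) + q.2.+1%:R^-1) : 'rV[R]_N) ord0 i].
have -> : U = \bigcup_(q in [set q | box q `<=` U]) box q.
  apply/seteqP; split => [y Uy|y [q qU qy]]; last exact: qU.
  move: oU; rewrite openE => /(_ y Uy) /nbhs_ballP[e /= e0 yU].
  have [k ke] : exists k : nat, 2 * k.+1%:R^-1 < e.
    have := @cvg_harmonic R; move=> /cvgrPdist_lt /(_ (e / 2)).
    rewrite divr_gt0// => /(_ isT)[k _ /(_ k (leqnn _))] /=.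
    rewrite sub0r normrN gtr0_norm ?invr_gt0 ?ltr0n// => h.
    by exists k; rewrite mulrC -ltr_pdivlMr.
  have k0 : 0 < k.+1%:R^-1 :> R by rewrite invr_gt0.
  have /choice[q hq] : forall i, exists q : rat,
      y ord0 i - k.+1%:R^-1 < ratr q < y ord0 i + k.+1%:R^-1.
    move=> i; have : y ord0 i - k.+1%:R^-1 < y ord0 i + k.+1%:R^-1.
      by rewrite ltrD2l (lt_trans _ k0)// oppr_lt0.
    by move=> /rat_in_itvoo[q]; rewrite in_itv/= => qi; exists q.
  exists (\row_i q i, k).
    move=> z /= hz; apply: yU; rewrite /ball /= /mx_ball; split=> // i j.
    rewrite ord1; move: (hz j); rewrite /= !mxE => hzj; have := hq j.
    rewrite /ball /=; move: hzj ke; set r := k.+1%:R^-1; set s := ratr _.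
    by move=> /andP[h1 h2] h3 /andP[h4 h5]; rewrite ltr_norml; apply/andP; split; lra.
  move=> i; rewrite /= !mxE; have := hq i; move=> /andP[h1 h2].
  by apply/andP; split; [rewrite ltrBlDr|rewrite -ltrBlDr].
rewrite bigcup_mkcond; apply: countable_bigcupT_measurable => [|q].
  exact: countableP.
by case: ifP => _; [exact: measurable_rV_box|exact: measurable0].
Qed.

Lemma continuous_measurable_rV N (f : 'rV[R]_N -> R) :
  continuous f -> measurable_fun setT f.
Proof.
move=> /continuousP cf.
apply: (measurability _ (RGenOpens.measurableE R)) => _ [_ [a [b ->]] <-].
rewrite setTI; apply: open_measurable_rV; exact/cf/interval_open.
Qed.

(** Besides the scaling under dilations, all that the integrability of powers of
    the norm requires of the measure. *)
Lemma borel_lebesgue_rV_cube n (r : R) :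
  (borel_lebesgue_rV R n [set y | forall i, (- r < y ord0 i < r)%R] < +oo)%E.
Proof.
elim: n => [|n IH]; first by rewrite /= diracE ltry.
rewrite /= /lebesgue_rV_step /pushforward.
rewrite (_ : _ @^-1` _ = `]-r, r[%classic `*`
     [set y : 'rV[R]_n | forall i, (- r < y ord0 i < r)]).
  have m1 : measurable [set y : 'rV[R]_n | forall i, (- r < y ord0 i < r)].
    have := measurable_rV_box (const_mx (- r)) (const_mx r : 'rV[R]_n).
    by under eq_set do under eq_forall do rewrite !mxE.
  rewrite [X in (X < _)%E]product_measure1E//.
  apply: lte_mul_pinfty => //.
  by rewrite /= lebesgue_measure_itv/= lte_fin; case: ifP.
apply/seteqP; split => -[t y] /=.
  have El : cons_rV (t, y) ord0 ord0 = t.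
    by rewrite -[LHS]/((uncons_rV (cons_rV (t, y))).1) cons_rVK.
  have Er i : cons_rV (t, y) ord0 (rshift 1 i) = y ord0 i.
    by rewrite /cons_rV [LHS](@row_mxEr _ 1 1 n).
  move=> h; split; first by have := h ord0; rewrite El in_itv.
  by move=> i; have := h (rshift 1 i); rewrite Er.
move=> [h1 h2] i; have [j|j] := @split_ordP 1 n i => ->.
  rewrite (_ : cons_rV _ _ _ = t); first by move: h1; rewrite in_itv.
  by rewrite /cons_rV [LHS](@row_mxEl _ 1 1 n) mxE.
rewrite (_ : cons_rV _ _ _ = y ord0 j) ?h2//.
by rewrite /cons_rV [LHS](@row_mxEr _ 1 1 n).
Qed.

End borel.

(** * The Euclidean norm and the integrability of its powers *)

Section euclidean_norm.
Context {R : realType} {N : nat}.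
Local Notation mu := (@lebesgue_rV R N).
Local Notation V := (lebesgue_type R N).
Implicit Types (x y : 'rV[R]_N).

Definition sqnorm y : R := \sum_i y ord0 i ^+ 2.

Lemma sqnorm_ge0 y : 0 <= sqnorm y.
Proof. by apply: sumr_ge0 => i _; exact: sqr_ge0. Qed.

Lemma enorm_ge0 y : 0 <= enorm y. Proof. exact: sqrtr_ge0. Qed.

Lemma sqr_enorm y : enorm y ^+ 2 = sqnorm y.
Proof. by rewrite sqr_sqrtr ?sqnorm_ge0. Qed.

Lemma enormZ (k : R) y : enorm (k *: y) = `|k| * enorm y.
Proof.
rewrite /enorm -sqrtr_sqr -sqrtrM ?sqr_ge0//; congr Num.sqrt.
by rewrite mulr_sumr; apply: eq_bigr => i _; rewrite mxE exprMn.
Qed.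

Lemma enorm0 : enorm (0 : 'rV[R]_N) = 0.
Proof. by rewrite -(scale0r (0 : 'rV[R]_N)) enormZ normr0 mul0r. Qed.

Lemma coord_le_enorm y i : `|y ord0 i| <= enorm y.
Proof.
rewrite -sqrtr_sqr ler_sqrt ?sqnorm_ge0// (bigD1 i)//= lerDl.
by apply: sumr_ge0 => j _; exact: sqr_ge0.
Qed.

Lemma coord_le_mx_norm y i : `|y ord0 i| <= `|y|.
Proof.
by rewrite [leRHS]mx_normrE; apply/bigmax_geP; right; exists (ord0, i).
Qed.

Lemma mx_norm_le_enorm y : `|y| <= enorm y.
Proof.
rewrite [leLHS]mx_normrE; apply/bigmax_leP; split; first exact: enorm_ge0.
by move=> [i j] _ /=; rewrite ord1; exact: coord_le_enorm.
Qed.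

Lemma enorm_eq0 y : (enorm y == 0) = (y == 0).
Proof.
apply/eqP/eqP => [y0|->]; last exact: enorm0.
apply/eqP; rewrite -normr_eq0 eq_le normr_ge0 andbT.
by rewrite -y0 mx_norm_le_enorm.
Qed.

Lemma enorm_le_mx_norm y : enorm y <= N%:R * `|y|.
Proof.
rewrite -[leRHS]ger0_norm ?mulr_ge0// -sqrtr_sqr ler_sqrt ?sqr_ge0//.
apply: (@le_trans _ _ (\sum_(i < N) `|y| ^+ 2)).
  apply: ler_sum => i _; rewrite -[leLHS]real_normK ?num_real//.
  by rewrite lerXn2r ?nnegrE//; exact: coord_le_mx_norm.
rewrite sumr_const card_ord exprMn -[leLHS]mulr_natl ler_wpM2r ?sqr_ge0//.
by rewrite -natrX ler_nat -mulnn; case: (N) => // k; rewrite leq_pmulr.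
Qed.

Lemma measurable_sqnorm : measurable_fun setT sqnorm.
Proof.
apply: measurable_sum => i.
by apply: measurable_funX; exact: measurable_rV_coord.
Qed.

Lemma measurable_enorm : measurable_fun setT (@enorm R N).
Proof.
have ms : measurable_fun [set: R] (@Num.sqrt R).
  by apply: continuous_measurable_fun; exact: sqrt_continuous.
exact: (measurableT_comp ms measurable_sqnorm).
Qed.

Lemma ge0_le_integral_rV (f g : V -> \bar R) :
  (forall y, 0 <= f y)%E -> measurable_fun [set: V] f ->
  measurable_fun [set: V] g -> (forall y, f y <= g y)%E ->
  (\int[mu]_y f y <= \int[mu]_y g y)%E.
Proof.
by move=> f0 mf mg fg; exact: (ge0_le_integral mu measurableT (fun y _ => f0 y) mf mg (fun y _ => fg y)).
Qed.

Lemma ge0_integralZl_rV (r : R) (f : V -> \bar R) : 0 <= r ->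
  measurable_fun [set: V] f -> (forall y, 0 <= f y)%E ->
  (\int[mu]_y (r%:E * f y) = r%:E * \int[mu]_y f y)%E.
Proof.
move=> r0 mf f0.
by apply: (ge0_integralZl mu measurableT mf (fun y _ => f0 y)); rewrite lee_fin.
Qed.

Let D : set 'rV[R]_N := [set y | 1 <= enorm y < 2].

Let mD : measurable D.
Proof.
rewrite (_ : D = (fun y : 'rV[R]_N => enorm y : measurableTypeR R) @^-1` `[1, 2[%classic).
  by rewrite -[X in measurable X]setTI; exact: measurable_enorm.
by apply/seteqP; split => y; rewrite /= in_itv.
Qed.

Lemma lebesgue_rV_enorm_lt (r : R) : (mu [set y : 'rV[R]_N | (enorm y < r)%R] < +oo)%E.
Proof.
pose C := [set y : 'rV[R]_N | forall i, - r < y ord0 i < r].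
have mC : measurable C.
  have := measurable_rV_box (const_mx (- r)) (const_mx r : 'rV[R]_N).
  by under eq_set do under eq_forall do rewrite !mxE.
apply: (@le_lt_trans _ _ (mu C)).
  apply: le_outer_measure => y /= yr i; rewrite -ltr_norml.
  exact: le_lt_trans (coord_le_enorm _ _) yr.
rewrite /lebesgue_rV /completed_measure_extension measurable_mu_extE//.
exact: borel_lebesgue_rV_cube.
Qed.

Let shell (q l : R) (k : nat) y : R := \1_D (l ^- k *: y) * enorm y `^ q.

Let measurable_enorm_powR q : measurable_fun setT (fun y : 'rV[R]_N => enorm y `^ q).
Proof.
exact: (measurableT_comp (measurable_powR q) measurable_enorm).
Qed.

Let measurable_shell q l (k : nat) : measurable_fun setT (shell q l k).
Proof.
apply: measurable_funM; last exact: measurable_enorm_powR.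
rewrite (_ : (fun y => _) = \1_D \o affine 0 (l ^- k)); last first.
  by apply/funext => y; rewrite /affine /= add0r.
exact: (measurableT_comp (measurable_indic mD) (measurable_affine _ _)).
Qed.

Let shell0_lty q l : (\int[mu]_y (shell q l 0 y)%:E < +oo)%E.
Proof.
have h : (\int[mu]_y (shell q l 0 y)%:E <=
          \int[mu]_y (cst (2 `^ `|q|)%:E \_ D) y)%E.
  apply: ge0_le_integral_rV.
  - by move=> y; rewrite lee_fin mulr_ge0// powR_ge0.
  - exact/measurable_fun_borel/measurable_EFinP.
  - apply: measurable_fun_borel; apply/(measurable_restrictT _ mD).
    exact: measurable_cst.
  move=> y; rewrite /shell expr0 invr1 scale1r indicE /patch.
  case: ifPn => [|_]; last by rewrite mul0r.
  rewrite inE => -[/andP[y1 y2]]; rewrite mul1r lee_fin.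
  have [q0|q0] := leP 0 q.
    rewrite ger0_norm// ge0_ler_powR// ?nnegrE ?enorm_ge0//; exact: ltW.
  apply: (@le_trans _ _ 1); last first.
    by rewrite -[leLHS](powRr0 2) ler_powR// ler1n.
  by rewrite -[leRHS](powRr0 (enorm y)) ler_powR// ltW.
apply: le_lt_trans h _.
rewrite -integral_mkcond integral_cst//; last exact: caratheodory_measurable_mu_ext.
apply: lte_mul_pinfty => //.
apply: le_lt_trans (lebesgue_rV_enorm_lt 2).
by apply: le_outer_measure => y /= /andP[].
Qed.

Let shell_scale q l (k : nat) : 0 < l ->
  (\int[mu]_y (shell q l k y)%:E =
   ((l `^ q * l ^+ N) ^+ k)%:E * \int[mu]_y (shell q l 0 y)%:E)%E.
Proof.
move=> l0; have lk0 : 0 < l ^- k by rewrite invr_gt0 exprn_gt0.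
have -> : (fun y => (shell q l k y)%:E) = fun y =>
    (fun z => ((l `^ q) ^+ k)%:E * (shell q l 0 z)%:E)%E (affine 0 (l ^- k) y).
  apply/funext => y; rewrite /affine add0r /shell -EFinM; congr EFin.
  rewrite expr0 invr1 scale1r mulrCA; congr (_ * _).
  rewrite enormZ gtr0_norm// powRM ?enorm_ge0 ?(ltW lk0)// mulrA.
  rewrite -powR_mulrn ?powR_ge0// -!powRrM.
  rewrite -[l ^- k]powR_invn ?(ltW l0)// -powRrM mulNr (mulrC k%:R) powRN.
  by rewrite mulfV ?mul1r// gt_eqF// powR_gt0.
have ms : measurable_fun [set: V] (fun z => (shell q l 0 z)%:E).
  exact/measurable_fun_borel/measurable_EFinP.
have s0 z : (0 <= (shell q l 0 z)%:E)%E by rewrite lee_fin mulr_ge0// powR_ge0.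
have lq0 : 0 <= (l `^ q) ^+ k by rewrite exprn_ge0// powR_ge0.
have ms' := measurable_funeM ((l `^ q) ^+ k)%:E ms.
have s0' z : (0 <= ((l `^ q) ^+ k)%:E * (shell q l 0 z)%:E)%E by rewrite mule_ge0.
rewrite (ge0_integral_affine 0 (lt0r_neq0 lk0) ms' s0') (ge0_integralZl_rV lq0 ms s0).
rewrite muleA -EFinM; congr (_ %:E * _)%E.
by rewrite gtr0_norm// invrK -exprM mulnC exprM -exprMn mulrC.
Qed.

(** The shells l^k <= |y| < 2 l^k cover A.  By scaling, the integral of |y|^q on
    the k-th one is (l^(q+N))^k times the integral for k = 0, which is finite because
    |y|^q is bounded there; the geometric series converges. *)
Lemma dyadic_shells_lty (q l : R) (A : set 'rV[R]_N) :
  0 < l -> l `^ q * l ^+ N < 1 -> measurable A ->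
  (forall y, A y -> exists k : nat, 1 <= enorm (l ^- k *: y) < 2) ->
  (\int[mu]_y (\1_A y * enorm y `^ q)%:E < +oo)%E.
Proof.
move=> l0 lN mA Ashell.
have h : (\int[mu]_y (\1_A y * enorm y `^ q)%:E <=
          \int[mu]_y (\sum_(k <oo) (shell q l k y)%:E))%E.
  apply: ge0_le_integral_rV.
  - by move=> y; rewrite lee_fin mulr_ge0// powR_ge0.
  - apply/measurable_fun_borel/measurable_EFinP/measurable_funM => //.
  - apply: ge0_emeasurable_sum => [k y _ _|k _].
      by rewrite lee_fin mulr_ge0// powR_ge0.
    exact/measurable_fun_borel/measurable_EFinP.
  move=> y; rewrite indicE; case: (boolP (y \in A)) => [|_]; last first.
    by rewrite mul0r; apply: nneseries_ge0 => k _ _; rewrite lee_fin mulr_ge0// powR_ge0.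
  rewrite inE => /Ashell[k yk].
  apply: (@le_trans _ _ (\sum_(0 <= n < k.+1) (shell q l n y)%:E)%E); last first.
    by apply: nneseries_lim_ge => n _ _; rewrite lee_fin mulr_ge0// powR_ge0.
  rewrite big_nat_recr//= {2}/shell [in leRHS]indicE (mem_set (A := D))//.
  by rewrite leeDr// sume_ge0// => n _; rewrite lee_fin mulr_ge0// powR_ge0.
apply: le_lt_trans h _.
have ms k : measurable_fun [set: V] (fun y => (shell q l k y)%:E).
  exact/measurable_fun_borel/measurable_EFinP.
have s0 k (y : V) : (0 <= (shell q l k y)%:E)%E.
  by rewrite lee_fin mulr_ge0// powR_ge0.
rewrite (integral_nneseries mu measurableT ms (fun k y _ => s0 k y)).
under eq_eseriesr do rewrite shell_scale//.
have I0 : (0 <= \int[mu]_y (shell q l 0 y)%:E)%E.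
  by apply: integral_ge0 => y _; rewrite lee_fin mulr_ge0// powR_ge0.
have := shell0_lty q l; move: I0; case: (\int[mu]_y _)%E => // r r0 _.
set c := l `^ q * l ^+ N in lN *.
have c0 : 0 <= c by rewrite mulr_ge0// ?powR_ge0// exprn_ge0// ltW.
have cv : (\sum_(0 <= k < n) ((c ^+ k)%:E * r%:E)%E) @[n --> \oo] -->
    (r * (1 - c)^-1)%:E.
  rewrite (_ : (fun n => _) = EFin \o series (geometric r c)).
    by apply: cvg_EFin; [exact: nearW|apply: cvg_geometric_series; rewrite ger0_norm].
  apply/funext => n /=; rewrite -sumEFin; apply: eq_bigr => k _.
  by rewrite -EFinM mulrC.
by rewrite (cvg_lim _ cv)// ltry.
Qed.

Lemma measurable_enorm_itv (i : interval R) :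
  measurable [set y : 'rV[R]_N | enorm y \in i].
Proof.
rewrite (_ : [set _ | _] =
  (fun y : 'rV[R]_N => enorm y : measurableTypeR R) @^-1` [set` i])//.
by rewrite -[X in measurable X]setTI; exact: measurable_enorm.
Qed.

Let dyadic_down (r : R) : 0 < r -> r < 2 -> exists k : nat, 1 <= 2 ^+ k * r < 2.
Proof.
move=> r0 r2; have ex : exists k : nat, 1 <= 2 ^+ k * r.
  exists (Num.bound r^-1).
  rewrite -ler_pdivrMr// div1r; apply/ltW/(lt_trans (archi_boundP _)).
    by rewrite invr_ge0 ltW.
  by rewrite -natrX ltr_nat ltn_expl.
case: (ex_minnP ex) => -[|k] hk mink.
  by exists 0%N; rewrite hk expr0 mul1r.
exists k.+1; rewrite hk/= exprS -mulrA gtr_pMr// ltNge.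
by apply/negP => /mink; rewrite ltnn.
Qed.

Let dyadic_up (r : R) : 1 <= r -> exists k : nat, 1 <= 2 ^- k * r < 2.
Proof.
move=> r1; have r0 : 0 < r by exact: lt_le_trans r1.
have ex : exists k : nat, 2 ^- k * r < 2.
  exists (Num.bound r).
  rewrite mulrC ltr_pdivrMr ?exprn_gt0//.
  apply: lt_trans (archi_boundP (ltW r0)) _.
  by rewrite -exprS -natrX ltr_nat ltnW// ltn_expl.
case: (ex_minnP ex) => -[|k] hk mink.
  by exists 0%N; rewrite hk expr0 invr1 mul1r r1.
exists k.+1; rewrite hk andbT leNgt; apply/negP => h.
suff /mink : 2 ^- k * r < 2 by rewrite ltnn.
by move: h; rewrite exprS invfM -mulrA mulrC ltr_pdivrMr// mul1r.
Qed.

(** The shells of ratio l = 1/2 cover the punctured ball. *)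
Lemma integrable_enorm_near (q : R) : 0 < N%:R + q ->
  (\int[mu]_y (\1_[set y : 'rV[R]_N | enorm y \in `]0, 2[] y * enorm y `^ q)%:E < +oo)%E.
Proof.
move=> Nq; apply: (@dyadic_shells_lty q 2^-1); first by rewrite invr_gt0.
- rewrite -powR_mulrn ?invr_ge0// -powRD; last by rewrite invr_eq0 pnatr_eq0 implybT.
  rewrite /powR invr_eq0 pnatr_eq0/= -[ltRHS]expR0 ltr_expR lnV ?posrE//.
  by rewrite mulrN oppr_lt0 mulr_gt0 ?ln_gt0 ?ltr1n// addrC.
- exact: measurable_enorm_itv.
move=> y /=; rewrite in_itv/= => /andP[y0 y2].
have [k hk] := dyadic_down y0 y2; exists k.
by rewrite exprVn invrK enormZ ger0_norm// exprn_ge0.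
Qed.

(** The shells of ratio l = 2 cover the complement of the unit ball. *)
Lemma integrable_enorm_far (q : R) : N%:R + q < 0 ->
  (\int[mu]_y (\1_[set y : 'rV[R]_N | enorm y \in `[1, +oo[] y * enorm y `^ q)%:E < +oo)%E.
Proof.
move=> Nq; apply: (@dyadic_shells_lty q 2) => //.
- rewrite -powR_mulrn// -powRD; last by rewrite pnatr_eq0 implybT.
  rewrite /powR pnatr_eq0/= -[ltRHS]expR0 ltr_expR.
  by rewrite pmulr_llt0 ?ln_gt0 ?ltr1n// addrC.
- exact: measurable_enorm_itv.
move=> y /=; rewrite in_itv/= andbT => y1.
have [k hk] := dyadic_up y1; exists k.
by rewrite enormZ ger0_norm// invr_ge0 exprn_ge0.
Qed.

End euclidean_norm.

(** * Moments of the centered difference *)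

Section binomial_moments.
Context {R : realType}.

Lemma alternating_binomial_sumS n (f : nat -> R) :
  \sum_(j < n.+2) (-1) ^+ j * 'C(n.+1, j)%:R * f j =
  \sum_(j < n.+1) (-1) ^+ j * 'C(n, j)%:R * (f j - f j.+1).
Proof.
under [RHS]eq_bigr do rewrite mulrBr.
rewrite sumrB big_ord_recl /=; under eq_bigr do rewrite /bump/= add1n binS natrD.
under eq_bigr do rewrite mulrDr mulrDl.
rewrite big_split /= addrA; congr (_ + _).
  rewrite big_ord_recr /= (@bin_small n n.+1)// mulr0 mul0r addr0 [in RHS]big_ord_recl /=.
  by rewrite !bin0; congr (_ + _); apply: eq_bigr => j _; rewrite /bump/= add1n.
by rewrite -sumrN; apply: eq_bigr => j _; rewrite exprS mulN1r !mulNr.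
Qed.

(** An n-th difference annihilates the polynomials of degree less than n: one
    difference lowers the degree of (c + j)^q by one. *)
Lemma alternating_binomial_exprn n q (c : R) : (q < n)%N ->
  \sum_(j < n.+1) (-1) ^+ j * 'C(n, j)%:R * (c + j%:R) ^+ q = 0.
Proof.
elim: n q => // n IH q; rewrite ltnS => qn.
rewrite (alternating_binomial_sumS n (fun j => (c + j%:R) ^+ q)).
have E (j : nat) : (c + j%:R) ^+ q - (c + j.+1%:R) ^+ q =
    - \sum_(i < q) 'C(q, i)%:R * (c + j%:R) ^+ i.
  rewrite -natr1 addrA [c + _ + 1]addrC [(1 + _) ^+ q]exprDn big_ord_recr/=.
  rewrite subnn expr0 mul1r binn mulr1n opprD addrCA subrr addr0.
  by congr (- _); apply: eq_bigr => i _; rewrite expr1n mul1r mulr_natl.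
under eq_bigr do rewrite E mulrN mulr_sumr.
rewrite sumrN exchange_big/= big1 ?oppr0// => i _.
under eq_bigr do rewrite mulrCA.
by rewrite -mulr_sumr IH ?mulr0// (leq_trans (ltn_ord i)).
Qed.

(** The index j stands for k = j - m, as in [finite_difference]. *)
Definition fd_weight m (j : 'I_(2 * m).+1) : R :=
  let k := j%:Z - m%:Z in (-1) ^ k * 'C((2 * m)%N, `|m%:Z - k|%N)%:R.

Definition fd_node m (j : 'I_(2 * m).+1) : R := (j%:Z - m%:Z)%:~R.

Lemma fd_weightE m (j : 'I_(2 * m).+1) :
  fd_weight j = (-1) ^+ m * ((-1) ^+ j * 'C(2 * m, j)%:R).
Proof.
rewrite /fd_weight mulrA; congr (_ * _).
  rewrite expfzDr ?oppr_eq0 ?oner_eq0// mulrC; congr (_ * _).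
  by rewrite -exprnN -exprVn invrN1.
congr (_%:R); have jm : (j <= 2 * m)%N by rewrite -ltnS ltn_ord.
by rewrite -[RHS]bin_sub//; congr ('C(_, _)); lia.
Qed.

Lemma fd_nodeE m (j : 'I_(2 * m).+1) : fd_node j = - m%:R + j%:R.
Proof. by rewrite /fd_node intrD addrC mulrNz. Qed.

Lemma fd_node_rev m (j : 'I_(2 * m).+1) : fd_node (rev_ord j) = - fd_node j.
Proof.
have jm : (j <= 2 * m)%N by rewrite -ltnS ltn_ord.
by rewrite !fd_nodeE/= subSS natrB// natrM; ring.
Qed.

Lemma fd_weight_rev m (j : 'I_(2 * m).+1) : fd_weight (rev_ord j) = fd_weight j.
Proof.
have jm : (j <= 2 * m)%N by rewrite -ltnS ltn_ord.
rewrite !fd_weightE /= subSS bin_sub//; congr (_ * (_ * _)).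
by rewrite -signr_odd oddB// oddM/= signr_odd.
Qed.

Lemma fd_moment m q : (q < 2 * m)%N ->
  \sum_(j < (2 * m).+1) fd_weight j * fd_node j ^+ q = 0.
Proof.
move=> qm; under eq_bigr do rewrite fd_weightE fd_nodeE -mulrA.
by rewrite -mulr_sumr alternating_binomial_exprn ?mulr0.
Qed.

(** The sum in the normalizing constant of order s, that is half of the moment
    of order 2s of the difference ([fd_weight_powR]). *)
Definition fd_constant m (s : R) : R :=
  \sum_(1 <= k < m.+1) (-1) ^+ k * 'C((2 * m)%N, m - k)%:R * k%:R `^ (2 * s).

Lemma fd_weight_powR m s : s != 0 ->
  \sum_(j < (2 * m).+1) fd_weight j * `|fd_node j| `^ (2 * s) = 2 * fd_constant m s.
Proof.
move=> s0.
pose F (j : nat) : R := (-1) ^+ m * ((-1) ^+ j * 'C(2 * m, j)%:R) * `|- m%:R + j%:R| `^ (2 * s).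
transitivity (\sum_(0 <= j < (2 * m).+1) F j).
  by rewrite big_mkord; apply: eq_bigr => j _; rewrite fd_weightE fd_nodeE.
rewrite (@big_cat_nat _ _ _ m)/=; [|by []|by lia].
rewrite (@big_ltn _ _ _ m) ?ltnS ?leq_pmull//.
have -> : F m = 0 by rewrite /F addNr normr0 powR0 ?mulr0// mulf_neq0// pnatr_eq0.
rewrite add0r mulr_natl mulr2n; congr (_ + _); rewrite /fd_constant.
  rewrite big_add1 /= big_nat_rev /= add0n; apply: eq_big_nat => k km.
  rewrite /F; congr (_ * _); last first.
    rewrite natrB; last by lia.
    by rewrite addrA addNr; congr (_ `^ _); rewrite sub0r normrN ger0_norm.
  rewrite mulrA -exprD -signr_odd -[in RHS]signr_odd; congr ((-1) ^+ nat_of_bool _ * _%:R).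
    by rewrite oddD oddB/=; [case: (odd m); case: (odd k)|lia].
rewrite -{1}[m.+1]addn1 addnC big_addn /= (_ : ((2 * m).+1 - m = m.+1)%N); last by lia.
apply: eq_big_nat => k km; rewrite /F; congr (_ * _); last first.
  by rewrite natrD addrCA addNr addr0 ger0_norm.
rewrite mulrA -exprD -signr_odd -[in RHS]signr_odd; congr ((-1) ^+ nat_of_bool _ * _%:R).
  by rewrite !oddD; case: (odd m); case: (odd k).
by rewrite -[RHS]bin_sub; [congr ('C(_, _)); lia|lia].
Qed.

End binomial_moments.

(** * The sum in the normalizing constant is not zero *)

Section exponential_sums.
Context {R : realType}.
Implicit Types (f df : R -> R).

Lemma Rolle_path f df x (s : seq R) : (forall y : R, is_derive y 1 f (df y)) ->
  path <%R x s -> f x = 0 -> all (fun y => f y == 0) s ->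
  exists s', [/\ size s' = size s, path <%R x s' & all (fun y => df y == 0) s'].
Proof.
move=> fdf; elim: s x => [|y s IH] x /=; first by exists [::].
move=> /andP[xy ys] fx /andP[/eqP fy fs].
have [s' [s's ys' dfs']] := IH _ ys fy fs.
have cf : {within `[x, y], continuous f}.
  apply: derivable_within_continuous => z _; exact: (@ex_derive _ _ _ _ _ _ _ (fdf z)).
have [c + dc] := Rolle xy (fun z _ => @ex_derive _ _ _ _ _ _ _ (fdf z)) cf (etrans fx (esym fy)).
rewrite in_itv/= => /andP[xc cy].
exists (c :: s'); split => /=; first by rewrite s's.
  rewrite xc/=; case: s' ys' {dfs' s's} => //= z s' /andP[yz ->].
  by rewrite (lt_trans cy yz).
apply/andP; split => //.
have := @derive_val _ _ _ _ _ _ _ (fdf c); have := @derive_val _ _ _ _ _ _ _ dc.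
by move=> -> <-.
Qed.

(** A nonzero combination of n exponentials with distinct exponents has fewer
    than n zeros.  Divide by one exponential and differentiate: this removes
    one term, and by Rolle's theorem at most one zero. *)
Lemma exponential_sum_eq0 n (c l : 'I_n -> R) (z : seq R) : injective l ->
  sorted <%R z -> size z = n ->
  all (fun t => \sum_i c i * expR (l i * t) == 0) z -> forall i, c i = 0.
Proof.
elim: n c l z => [|n IH] c l z linj zs zn z0; first by case.
case: z zs zn z0 => // x s /= xs [sn] /andP[/eqP x0 s0].
pose c' (i : 'I_n) := c (lift ord0 i) * (l (lift ord0 i) - l ord0).
pose l' (i : 'I_n) := l (lift ord0 i) - l ord0.
pose f t := expR (- (l ord0 * t)) * \sum_i c i * expR (l i * t).
pose df t := \sum_i c' i * expR (l' i * t).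
have fE t : f t = c ord0 + \sum_i c (lift ord0 i) * expR (l' i * t).
  rewrite /f big_ord_recl mulrDr mulrCA -expRD addNr expR0 mulr1; congr (_ + _).
  rewrite mulr_sumr; apply: eq_bigr => i _.
  by rewrite mulrCA -expRD /l'; congr (_ * expR _); ring.
have fdf (t : R) : is_derive t 1 f (df t).
  rewrite (_ : f = cst (c ord0) + \sum_i (fun t => c (lift ord0 i) * expR (l' i * t))).
    rewrite -[df t]add0r; apply: is_deriveD; apply: is_derive_sum => i.
    have h1 : is_derive t 1 ( *%R (l' i)) (l' i).
      by apply: is_derive_eq; rewrite scaler1.
    have h2 := is_deriveZ (c (lift ord0 i)) (is_derive1_comp (is_derive_expR (l' i * t)) h1).
    by apply: (is_derive_eq h2); rewrite /c' -/(l' i) /GRing.scale/=; ring.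
  by apply/funext => u; rewrite fE fct_sumE.
have fx : f x = 0 by rewrite /f x0 mulr0.
have fs : all (fun y => f y == 0) s.
  by apply: sub_all s0 => y /eqP y0; rewrite /f y0 mulr0.
have [s' [s's xs' ds']] := Rolle_path fdf xs fx fs.
have c'0 : forall i, c' i = 0.
  apply: (IH c' l' s') => //.
  - by move=> i j /addIr/linj/lift_inj.
  - exact: path_sorted xs'.
  - by rewrite s's.
have c0 i : c (lift ord0 i) = 0.
  have /eqP := c'0 i; rewrite mulf_eq0 subr_eq0 => /orP[/eqP//|/eqP/linj].
  by move/(congr1 val).
move=> i; have [j ->|->] := unliftP ord0 i; first exact: c0.
move: fx; rewrite fE big1 ?addr0// => j _; by rewrite c0 mul0r.
Qed.

(** As a function of s, the sum is a combination of the m exponentials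
    k^(2s), 1 <= k <= m.  It vanishes at s = 1, ..., m-1, where it is half of a moment
    of even order less than 2m.  With s = n + sigma as an m-th zero, all
    coefficients would vanish, but the last one is a sign. *)
Lemma fd_constant_neq0 m n (sigma : R) : (n < m)%N -> 0 < sigma < 1 ->
  fd_constant m (n%:R + sigma) != 0.
Proof.
move=> nm /andP[s0 s1]; apply/eqP => S0.
pose c (i : 'I_m) : R := (-1) ^+ i.+1 * 'C((2 * m)%N, m - i.+1)%:R.
pose l (i : 'I_m) : R := 2 * ln (i.+1%:R).
have E t : fd_constant m t = \sum_i c i * expR (l i * t).
  rewrite /fd_constant big_add1/= big_mkord; apply: eq_bigr => i _.
  rewrite /c; congr (_ * _); rewrite /powR pnatr_eq0/=; congr expR.
  by rewrite /l; ring.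
have int0 (k : nat) : (0 < k < m)%N -> fd_constant m (k%:R : R) = 0.
  move=> /andP[k0 km].
  have k0' : k%:R != 0 :> R by rewrite pnatr_eq0 -lt0n.
  have := fd_weight_powR m k0'.
  have -> : \sum_(j < (2 * m).+1) fd_weight j * `|fd_node j| `^ (2 * k%:R) =
    \sum_(j < (2 * m).+1) fd_weight j * (fd_node j ^+ (2 * k) : R).
    apply: eq_bigr => j _; congr (_ * _).
    by rewrite -natrM powR_mulrn// -normrX ger0_norm// exprn_even_ge0// oddM.
  rewrite fd_moment; last by rewrite ltn_pmul2l.
  move=> h; apply: (@mulfI R 2); first by rewrite pnatr_eq0.
  by rewrite mulr0 -h.
(* the m zeros: the integers 1, ..., m-1 and n + sigma *)
pose z := sort <=%R ((n%:R + sigma) :: [seq k%:R | k <- iota 1 m.-1]) : seq R.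
have nint (k : nat) : n%:R + sigma != k%:R :> R.
  apply/eqP => h.
  have h1 : n%:R < k%:R :> R by rewrite -h ltrDl.
  have h2 : k%:R < n.+1%:R :> R by rewrite -h -natr1 ltrD2l.
  by move: h1 h2; rewrite !ltr_nat; lia.
have m0 : (0 < m)%N by exact: leq_ltn_trans nm.
have natinj : injective (fun k : nat => k%:R : R) by move=> i j /eqP; rewrite eqr_nat => /eqP.
have cmax : c (Ordinal (n:=m) (m:=m.-1) ltac:(by rewrite prednK)) = 0.
  apply: (@exponential_sum_eq0 m c l z).
  - have two0 : 2 != 0 :> R by rewrite pnatr_eq0.
    move=> i j; rewrite /l => /(mulfI two0)/ln_inj; rewrite !posrE !ltr0n.
    by move=> /(_ isT isT)/natinj[/val_inj].
  - rewrite /z sort_lt_sorted /= map_inj_uniq// iota_uniq andbT.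
    by apply/mapP => -[k _ /eqP]; rewrite (negbTE (nint k)).
  - by rewrite /z size_sort/= size_map size_iota prednK.
  - rewrite /z all_sort /= -E S0 eqxx/=; apply/allP => _ /mapP[k + ->].
    by rewrite mem_iota add1n prednK// -E => km; rewrite int0.
move: cmax; rewrite /c /= prednK// subnn bin0 mulr1 => /eqP.
by rewrite signr_eq0.
Qed.

End exponential_sums.

(** * The functional equation of Gamma and the normalizing constants *)

Section gamma_recurrence.
Context {R : realType}.
Local Notation lam := (@lebesgue_measure R).

(** exp t = (exp (t/k))^k >= (t/k)^k. *)
Lemma exprn_le_expR k (t : R) : 0 <= t -> t ^+ k <= k%:R ^+ k * expR t.
Proof.
move=> t0; case: k => [|k]; first by rewrite !expr0 mul1r (le_trans _ (expR_ge1Dx t))// lerDl.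
have k0 : 0 < k.+1%:R :> R by rewrite ltr0n.
have -> : expR t = expR (t / k.+1%:R) ^+ k.+1 by rewrite -expRM_natr divfK// gt_eqF.
rewrite -exprMn lerXn2r ?nnegrE ?mulr_ge0 ?expR_ge0//.
rewrite -ler_pdivrMl// mulrC (le_trans _ (expR_ge1Dx _))// lerDr//.
Qed.

Lemma powR_expRN_le (x t : R) : 0 <= x -> 1 <= t ->
  t `^ x * expR (- t) <= (Num.bound x).+1%:R ^+ (Num.bound x).+1 / t.
Proof.
move=> x0 t1; have t0 : 0 < t by exact: lt_le_trans t1.
rewrite ler_pdivlMr// expRN mulrAC ler_pdivrMr ?expR_gt0//.
apply: le_trans (exprn_le_expR _ (ltW t0)).
rewrite exprSr ler_wpM2r ?(ltW t0)// -powR_mulrn ?(ltW t0)// ler_powR//.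
exact/ltW/archi_boundP.
Qed.

Let F (x t : R) := t `^ x * expR (- t).

Let F_cvg0 x : 0 < x -> F x n.+1%:R^-1 @[n --> \oo] --> 0.
Proof.
move=> x0; apply: (@squeeze_cvgr _ _ _ _ (cst 0) (fun n => n.+1%:R^-1 `^ x)).
- near=> n; rewrite /F mulr_ge0 ?powR_ge0 ?expR_ge0//=.
  by apply: ler_piMr; rewrite ?powR_ge0// expR_le1 oppr_le0 invr_ge0.
- exact: cvg_cst.
- have /cvg_at_rightP := powR_cvg0 x0; apply.
  by split; [move=> n; rewrite invr_gt0|exact: cvg_harmonic].
Unshelve. all: by end_near. Qed.

Let F_cvgy x : 0 < x -> F x n.+1%:R @[n --> \oo] --> 0.
Proof.
move=> x0; set C := (Num.bound x).+1%:R ^+ (Num.bound x).+1 : R.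
apply: (@squeeze_cvgr _ _ _ _ (cst 0) (fun n => C * n.+1%:R^-1)).
- near=> n; rewrite mulr_ge0 ?powR_ge0 ?expR_ge0//=.
  by apply: powR_expRN_le; [exact: ltW|rewrite ler1n].
- exact: cvg_cst.
- rewrite -(mulr0 C); apply: cvgMr; exact: cvg_harmonic.
Unshelve. all: by end_near. Qed.

Let D (n : nat) : set R := `[n.+1%:R^-1, n.+1%:R]%classic.

Let bigcupD : \bigcup_n D n = `]0, +oo[%classic.
Proof.
apply/seteqP; split => [t [n _]|t]; rewrite /D /= !in_itv/= ?andbT.
  by move=> /andP[+ _]; apply: lt_le_trans; rewrite invr_gt0.
move=> t0; exists (maxn (Num.bound t) (Num.bound t^-1)) => //.
rewrite /D /= in_itv/=; apply/andP; split.
  rewrite -[leRHS]invrK lef_pV2 ?posrE ?invr_gt0//.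
  rewrite ltW// (lt_le_trans (archi_boundP _)) ?invr_ge0 ?(ltW t0)// ler_nat.
  by rewrite leqW// leq_maxr.
rewrite ltW// (lt_le_trans (archi_boundP _)) ?(ltW t0)// ler_nat.
by rewrite leqW// leq_maxl.
Qed.

Let ndD : nondecreasing_seq D.
Proof.
move=> i j ij; apply/subsetPset => t; rewrite /D /= !in_itv/= => /andP[h1 h2].
apply/andP; split.
  by apply: le_trans h1; rewrite lef_pV2 ?posrE ?ltr0n// ler_nat ltnS.
by apply: (le_trans h2); rewrite ler_nat ltnS.
Qed.

Let continuous_powR (p t : R) : 0 < t -> {for t, continuous (fun t : R => t `^ p)}.
Proof.
move=> t0; apply: (@differentiable_continuous _ R R); apply/derivable1_diffP.
by apply: derivable_powR; rewrite in_itv/= andbT.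
Qed.

Let continuous_expRN : continuous (fun t : R => expR (- t)).
Proof.
by move=> t; apply: continuous_comp; [exact: opp_continuous|exact: continuous_expR].
Qed.

Let within_D (f : R -> R) n : (forall t, 0 < t -> {for t, continuous f}) ->
  {within D n, continuous f}.
Proof.
move=> cf; apply: continuous_in_subspaceT => t.
by rewrite inE /D /= in_itv/= => /andP[h _]; apply: cf; apply: lt_le_trans h; rewrite invr_gt0.
Qed.

Let measurable_F x : measurable_fun [set: R] (F x).
Proof.
apply: measurable_funM; first exact: measurable_powR.
by apply: measurableT_comp => //; exact: measurable_expR.
Qed.

Let cvg_F x : (\int[lam]_(t in D n) (F x t)%:E @[n --> \oo] -->
  \int[lam]_(t in `]0%R, +oo[) (F x t)%:E)%E.
Proof.
rewrite -bigcupD; apply: ge0_nondecreasing_set_cvg_integral => //.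
- by move=> i; exact: measurable_itv.
- by move=> i; apply/measurable_EFinP/measurable_funTS; exact: measurable_F.
- by move=> i t _; rewrite lee_fin mulr_ge0 ?powR_ge0 ?expR_ge0.
Qed.

(** Integration by parts on [1/(n+1), n+1], then n -> oo.  The limit is taken for
    extended real integrals and monotone convergence, so that no convergence of
    the Gamma integral has to be proved: if one side is infinite, so is the other. *)
Lemma euler_integralS (x : R) : 0 < x -> euler_integral (x + 1) = x * euler_integral x.
Proof.
move=> x0; rewrite /euler_integral /Rintegral addrK.
set A := (\int[lam]_(t in _) (F (x - 1) t)%:E)%E.
set B := (\int[lam]_(t in _) (F x t)%:E)%E.
suff -> : B = (x%:E * A)%E.
  have : (0 <= A)%E.
    by apply: integral_ge0 => t _; rewrite lee_fin mulr_ge0 ?powR_ge0 ?expR_ge0.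
  (* if A is infinite, both finite parts are zero *)
  case: A => //= _; first by rewrite gt0_muley ?lte_fin//= mulr0.
have parts n : ((\int[lam]_(t in D n) (F x t)%:E) =
    (F x n.+1%:R^-1 - F x n.+1%:R)%:E + x%:E * \int[lam]_(t in D n) (F (x - 1) t)%:E)%E.
  case: n => [|n].
    by rewrite /D /= invr1 set_itv1 !integral_set1// subrr add0e mule0.
  have ab : n.+2%:R^-1 < n.+2%:R :> R.
    by rewrite (@lt_trans _ _ 1)// ?ltr1n// invf_lt1// ltr1n.
  have a0 : 0 < n.+2%:R^-1 :> R by rewrite invr_gt0.
  have itv0 t : t \in `]n.+2%:R^-1, n.+2%:R[ -> 0 < t.
    by rewrite in_itv/= => /andP[+ _]; exact: lt_trans.
  have dG (t : R) : is_derive t 1 (fun t => - expR (- t)) (expR (- t)).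
    have h := is_deriveN (is_derive1_comp (is_derive_expR (- t)) (is_deriveN (is_derive_id t 1))).
    by apply: (is_derive_eq h); rewrite mulrN1 opprK.
  have := @integration_by_parts R (fun t => t `^ x) (fun t => - expR (- t))
    (fun t => x * t `^ (x - 1)) (fun t => expR (- t)) _ _ ab.
  move=> -> //.
  - rewrite /F !mulrN opprK; congr (_ + _)%E; first by rewrite addrC.
    rewrite -ge0_integralZl//; last 4 first.
    + exact: measurable_itv.
    + by apply/measurable_EFinP/measurable_funTS; exact: measurable_F.
    + by move=> t _; rewrite lee_fin mulr_ge0 ?powR_ge0 ?expR_ge0.
    + by rewrite lee_fin ltW.
    under [in LHS]eq_integral do rewrite mulrN EFinN -mulrA.
    rewrite integral_ge0N ?oppeK// => t _.
    by rewrite lee_fin !mulr_ge0 ?powR_ge0 ?expR_ge0// ltW.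
  - apply: (@within_D _ n.+1) => t t0.
    by apply: cvgM; [exact: cvg_cst|exact: continuous_powR].
  - split.
    + by move=> t /itv0 t0; apply: derivable_powR; rewrite in_itv/= andbT.
    + by apply: cvg_at_right_filter; exact: continuous_powR.
    + by apply: cvg_at_left_filter; apply: continuous_powR; exact: lt_trans ab.
  - move=> t /itv0 t0; rewrite derive1E.
    exact: (@derive_val _ _ _ _ _ _ _ (is_derive1_powR x t0)).
  - by apply: (@within_D _ n.+1) => t t0; exact: continuous_expRN.
  - split.
    + by move=> t _; exact: ex_derive.
    + by apply: cvg_at_right_filter; apply: cvgN; exact: continuous_expRN.
    + by apply: cvg_at_left_filter; apply: cvgN; exact: continuous_expRN.
  - by move=> t _; rewrite derive1E derive_val.
suff c2 : (\int[lam]_(t in D n) (F x t)%:E @[n --> \oo] --> x%:E * A)%E.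
  by have c1 := @cvg_F x; rewrite -(cvg_lim _ c2)// (cvg_lim _ c1).
under eq_fun do rewrite parts.
rewrite -[(x%:E * A)%E]add0e; apply: cvgeD.
- by rewrite fin_num_adde_defr.
- apply: cvg_EFin; first exact: nearW.
  rewrite -[0](subr0 0); apply: cvgB; [exact: F_cvg0|exact: F_cvgy].
- by apply: cvgeZl => //; exact: cvg_F.
Qed.

End gamma_recurrence.

Section normalization_recurrence.
Context {R : realType}.
Implicit Types (sigma s : R).

Lemma GammaS (x : R) : 0 < x -> Gamma (x + 1) = x * Gamma x.
Proof.
by move=> x0; rewrite /Gamma x0 (lt_trans x0) ?ltrDl// euler_integralS.
Qed.

(** The floor of - (n + sigma) is - (n + 1), so that the continuation reduces
    to the argument 1 - sigma. *)
Lemma Gamma_oppE n sigma : 0 < sigma < 1 ->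
  Gamma (- (n%:R + sigma)) =
  euler_integral (1 - sigma) / \prod_(i < n.+1) (- (n%:R + sigma) + i%:R).
Proof.
move=> /andP[s0 s1]; rewrite /Gamma.
have -> : 0 < - (n%:R + sigma) = false.
  by apply/negbTE; rewrite -leNgt oppr_le0 addr_ge0// ltW.
have -> : Num.floor (- (n%:R + sigma)) = - n.+1%:Z.
  apply: floor_def; rewrite mulrzDr mulrNz -[n.+1%:~R]/(n.+1%:R) -natr1.
  by apply/andP; split; lra.
have E : - (n%:R + sigma) + n.+1%:R = 1 - sigma by rewrite -natr1; ring.
by rewrite abszN absz_nat E.
Qed.

(** The part of the normalizing constant that involves Gamma. *)
Definition gamma_ratio N s : R :=
  4 `^ s * Gamma (N%:R / 2 + s) / (pi `^ (N%:R / 2) * Gamma (- s)).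

(** The factor relating t - 1 and t is 4 (N/2 + t - 1) from the numerator and
    - t from Gamma(-t), and it is minus the one in [parts_against_power]. *)
Lemma gamma_ratioS N n sigma : 0 < sigma < 1 ->
  let t := n.+1%:R + sigma in (0 < N)%N ->
  gamma_ratio N t = - (2 * t * (N%:R + 2 * t - 2)) * gamma_ratio N (n%:R + sigma).
Proof.
move=> hs t N0; have /andP[s0 s1] := hs.
have tE : t = n%:R + sigma + 1 by rewrite /t -natr1; ring.
rewrite /gamma_ratio; have -> : Gamma (- t) = Gamma (- (n%:R + sigma)) / - t.
  rewrite !Gamma_oppE// big_ord_recl /= addr0 -/t invfM.
  under eq_bigr do rewrite /bump /= add1n -natr1 /t -natr1.
  rewrite mulrCA mulrC; congr (_ / _ / _); apply: eq_bigr => i _; ring.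
rewrite tE addrA GammaS; last first.
  by rewrite addr_gt0 ?divr_gt0 ?ltr0n ?ltr_wpDl.
rewrite powRD ?pnatr_eq0 ?implybT// powRr1// -tE.
have -> : t = n%:R + sigma + 1 by [].
set e := N%:R / 2; have -> : N%:R = 2 * e by rewrite mulrC divfK.
rewrite !invfM !invrK.
move: (Gamma _) (Gamma _)^-1 (pi `^ _)^-1 (4 `^ _) => a b c d.
ring.
Qed.

Lemma normalizationE N m s : normalization N m s = gamma_ratio N s / fd_constant m s.
Proof. by []. Qed.

Lemma fd_constant1 s : fd_constant 1 s = -1.
Proof.
by rewrite /fd_constant big_nat1 subnn bin0 expr1 powR1 !mulr1.
Qed.

End normalization_recurrence.

(** * Powers smoothly cut off to an annulus *)

Section flat_functions.
Context {R : realType}.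

(** The functions x^-l exp(-1/x), extended by 0 to x <= 0.  They are smooth, and
    derivation only changes the index l ([is_derive_flat]). *)
Definition flat (l : nat) (x : R) : R :=
  if 0 < x then x ^- l * expR (- x^-1) else 0.

Lemma flat_gt0E l x : 0 < x -> flat l x = x ^- l * expR (- x^-1).
Proof. by rewrite /flat => ->. Qed.

Lemma flat_le0E l x : x <= 0 -> flat l x = 0.
Proof. by rewrite /flat leNgt => /negbTE ->. Qed.

Lemma flat_ge0 l x : 0 <= flat l x.
Proof.
by rewrite /flat; case: ifP => // x0; rewrite mulr_ge0 ?expR_ge0// invr_ge0 exprn_ge0// ltW.
Qed.

Lemma flatS l x : flat l x = x * flat l.+1 x.
Proof.
rewrite /flat; case: ifPn => x0; last by rewrite mulr0.
by rewrite exprS invfM !mulrA mulfV ?mul1r// gt_eqF.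
Qed.

Lemma flat_le l x : flat l x <= l%:R ^+ l.
Proof.
have [x0|x0] := leP x 0; first by rewrite flat_le0E// exprn_ge0.
rewrite flat_gt0E// expRN ler_pdivrMr ?expR_gt0// -exprVn.
by apply: exprn_le_expR; rewrite invr_ge0 ltW.
Qed.

Lemma flatS_le l x : 0 < x -> flat l.+1 x <= l%:R ^+ l / x.
Proof.
by move=> x0; rewrite ler_pdivlMr// mulrC -flatS flat_le.
Qed.

(** At 0 the difference quotient of flat l is flat (l+1), by [flatS]; it tends to 0
    because flat (l+1) x = x * flat (l+2) x with a bounded second factor. *)
Lemma is_derive_flat l (x : R) :
  is_derive x 1 (flat l) (flat l.+2 x - l%:R * flat l.+1 x).
Proof.
have [x0|x0|->] := ltgtP x 0.
- rewrite !flat_le0E ?ltW// mulr0 subr0.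
  apply: (@near_eq_is_derive R R R (cst 0)).
  near=> y; rewrite flat_le0E// ltW//; near: y; exact: lt_nbhsl.
- apply: (@near_eq_is_derive R R R (fun y => y ^- l * expR (- y^-1))).
    near=> y; rewrite flat_gt0E//; near: y; exact: lt_nbhsr.
  have xn0 : x != 0 by rewrite gt_eqF.
  have dV := is_deriveV xn0 (is_derive_id x 1).
  have dX := is_deriveX l dV.
  have dE := @is_derive1_comp R expR (- (fun y : R => y^-1)) x _ _ (is_derive_expR _) (is_deriveN dV).
  have -> : (fun y => y ^- l * expR (- y^-1)) =
      ((fun y : R => y^-1) ^+ l) * (expR \o (- (fun y : R => y^-1))).
    by apply/funext => y; rewrite -exprVn [RHS]/(_ * _) exprfctE.
  apply: (is_derive_eq (is_deriveM dX dE)).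
  rewrite !flat_gt0E//.
  rewrite /GRing.scale /= exprfctE [(- _ : R -> R) x]/(- x^-1).
  case: (l) => [|k] /=.
    by rewrite !expr0; field.
  by rewrite -!exprVn; set y := x^-1; rewrite !exprS !mulr1; ring.
- rewrite !(flat_le0E _ (lexx 0)) mulr0 subr0.
  apply/is_derive1_caratheodory; exists (flat l.+1); split.
  + by move=> z; rewrite subr0 (flat_le0E _ (lexx 0)) subr0 mulrC -flatS.
  + rewrite /prop_for /continuous_at (flat_le0E _ (lexx 0)).
    apply/cvgr0Pnorm_le => /= e e0; near=> y.
    rewrite ger0_norm ?flat_ge0// flatS.
    have [y0|y0] := leP y 0; first by rewrite (flat_le0E _ y0) mulr0 ltW.
    apply: (@le_trans _ _ (y * (l.+2%:R ^+ l.+2))).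
      by rewrite ler_wpM2l ?flat_le// ltW.
    rewrite -ler_pdivlMr ?exprn_gt0//.
    near: y; apply: nbhs0_ltW.
    by rewrite divr_gt0// exprn_gt0.
  + by rewrite flat_le0E.
Unshelve. all: by end_near. Qed.

Lemma continuous_flat l : continuous (flat l).
Proof.
move=> x; have [d _] := is_derive_flat l x.
by apply: (@differentiable_continuous _ R R); exact/derivable1_diffP.
Qed.

(** The power rho^p, smoothly cut off to a * rho > 1 and b * rho < 1.  The indices l
    and r make the family stable under derivation up to linear combinations. *)
Definition annular (a b p : R) (l r : nat) (rho : R) : R :=
  rho `^ p * flat l (a * rho - 1) * flat r (1 - b * rho).

Lemma annular_eq0 a b p l r rho : 0 < a -> rho < a^-1 -> annular a b p l r rho = 0.
Proof.
move=> a0 ra; rewrite /annular [flat l _]flat_le0E ?mulr0 ?mul0r//.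
by rewrite subr_le0 -ler_pdivlMl// mulr1 ltW.
Qed.

Lemma annular_big_eq0 a b p l r rho : 0 < b -> b^-1 < rho -> annular a b p l r rho = 0.
Proof.
move=> b0 rb; rewrite /annular [flat r _]flat_le0E ?mulr0//.
by rewrite subr_le0 -ler_pdivrMl// mulr1 ltW.
Qed.

Definition annular' (a b p : R) (l r : nat) (rho : R) : R :=
  p * annular a b (p - 1) l r rho +
  a * (annular a b p l.+2 r rho - l%:R * annular a b p l.+1 r rho) -
  b * (annular a b p l r.+2 rho - r%:R * annular a b p l r.+1 rho).

Lemma is_derive_annular a b p l r (rho : R) : 0 < a ->
  is_derive rho 1 (annular a b p l r) (annular' a b p l r rho).
Proof.
move=> a0; have [r0|r0] := ltP rho a^-1.
  have -> : annular' a b p l r rho = 0.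
    by rewrite /annular' !annular_eq0// !mulr0 subr0 mulr0 addr0 mulr0 subr0.
  apply: (@near_eq_is_derive R R R (cst 0)).
  by near=> y; rewrite annular_eq0//; near: y; exact: lt_nbhsl.
have rho0 : 0 < rho by apply: lt_le_trans r0; rewrite invr_gt0.
have d1 := is_derive1_powR p rho0.
have da : is_derive rho 1 (fun y => a * y - 1) a.
  have h := is_deriveB (is_deriveZ a (is_derive_id rho 1)) (is_derive_cst (1 : R) rho 1).
  by apply: (is_derive_eq h); rewrite /GRing.scale/= mulr1 subr0.
have db : is_derive rho 1 (fun y => 1 - b * y) (- b).
  have h := is_deriveB (is_derive_cst (1 : R) rho 1) (is_deriveZ b (is_derive_id rho 1)).
  by apply: (is_derive_eq h); rewrite /GRing.scale/= mulr1 sub0r.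
have d2 := @is_derive1_comp R (flat l) _ rho _ _ (is_derive_flat l (a * rho - 1)) da.
have d3 := @is_derive1_comp R (flat r) _ rho _ _ (is_derive_flat r (1 - b * rho)) db.
apply: (is_derive_eq (is_deriveM (is_deriveM d1 d2) d3)).
rewrite /annular' /annular mulrfctE /GRing.scale /=.
move: (flat l _) (flat r _) (flat l.+1 _) (flat l.+2 _) (flat r.+1 _) (flat r.+2 _).
move=> f0 g0 f1 f2 g1 g2; ring.
Unshelve. all: by end_near. Qed.

End flat_functions.

Section radial_laplacian.
Context {R : realType}.

Definition annular'' (a b p : R) (l r : nat) (rho : R) : R :=
  p * annular' a b (p - 1) l r rho +
  a * (annular' a b p l.+2 r rho - l%:R * annular' a b p l.+1 r rho) -
  b * (annular' a b p l r.+2 rho - r%:R * annular' a b p l r.+1 rho).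

Lemma is_derive_annular' (a b p : R) l r (rho : R) : 0 < a ->
  is_derive rho 1 (annular' a b p l r) (annular'' a b p l r rho).
Proof.
move=> a0; have d p' l' r' := is_derive_annular b p' l' r' rho a0.
exact: (is_deriveB (is_deriveD (is_deriveZ p (d (p - 1) l r))
  (is_deriveZ a (is_deriveB (d p l.+2 r) (is_deriveZ l%:R (d p l.+1 r)))))
  (is_deriveZ b (is_deriveB (d p l r.+2) (is_deriveZ r%:R (d p l r.+1))))).
Qed.

(** The Laplacian of G(|y|^2) is 4 rho G''(rho) + 2 N G'(rho) at rho = |y|^2; here
    G = annular a b p 0 0. *)
Definition radial_laplacian (N : nat) (a b p rho : R) : R :=
  4 * rho * annular'' a b p 0 0 rho + 2 * N%:R * annular' a b p 0 0 rho.

(** The quotient of [radial_laplacian] by rho^(p-1), as a function of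
    x = a rho - 1 and y = 1 - b rho.  It is bounded in x and y, uniformly in
    the cut-off, because a rho = 1 + x and b rho = 1 - y only multiply functions flat l
    with l > 0, which absorb one factor x or y. *)
Definition laplacian_profile (N : nat) (p x y : R) : R :=
  2 * p * (N%:R + 2 * p - 2) * (flat 0 x * flat 0 y) +
  (8 * p + 2 * N%:R) * ((flat 1 x + flat 2 x) * flat 0 y
                        - flat 0 x * (flat 2 y - flat 1 y)) +
  4 * ((flat 4 x - 3 * flat 2 x - 2 * flat 1 x) * flat 0 y
       - 2 * ((flat 1 x + flat 2 x) * (flat 2 y - flat 1 y))
       + flat 0 x * (flat 4 y - 4 * flat 3 y + 5 * flat 2 y - 2 * flat 1 y)).

Lemma radial_laplacianE N (a b p rho : R) : 0 < rho ->
  radial_laplacian N a b p rho =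
  rho `^ (p - 1) * laplacian_profile N p (a * rho - 1) (1 - b * rho).
Proof.
move=> r0; have n0 : (rho == 0) = false by rewrite gt_eqF.
have P q : rho `^ q = rho * rho `^ (q - 1).
  have -> : rho `^ q = rho `^ (1 + (q - 1)) by rewrite addrC subrK.
  have := @powRD R rho 1 (q - 1); rewrite n0 implybT => /(_ isT) ->.
  by rewrite powRr1// ltW.
have P1 := P p; have P2 := P (p - 1).
rewrite /radial_laplacian /annular'' /annular' /annular.
rewrite /laplacian_profile P1 P2.
set x := a * rho - 1; set y := 1 - b * rho.
(* flat 1, 2, 3 are expressed through flat 4, and flat 0 is kept: the rest is
   an identity of polynomials *)
rewrite !(flatS 1 x) !(flatS 2 x) !(flatS 3 x) !(flatS 1 y) !(flatS 2 y) !(flatS 3 y).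
rewrite /x /y -/x -/y.
move: (rho `^ _) (flat 0 x) (flat 4 x) (flat 0 y) (flat 4 y) => c f0 f4 g0 g4.
rewrite /x /y; ring.
Qed.

Let bnd (h : R -> R -> R) := exists K, forall x y, `|h x y| <= K.

Let bndD f g : bnd f -> bnd g -> bnd (fun x y => f x y + g x y).
Proof.
by move=> [K hK] [L hL]; exists (K + L) => x y; rewrite (le_trans (ler_normD _ _))// lerD.
Qed.

Let bndN f : bnd f -> bnd (fun x y => - f x y).
Proof. by move=> [K hK]; exists K => x y; rewrite normrN. Qed.

Let bndM f g : bnd f -> bnd g -> bnd (fun x y => f x y * g x y).
Proof.
by move=> [K hK] [L hL]; exists (K * L) => x y; rewrite normrM ler_pM.
Qed.

Let bnd_cst c : bnd (fun x y => c). Proof. by exists `|c|. Qed.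

Let bnd_flatl l : bnd (fun x y => flat l x).
Proof. by exists (l%:R ^+ l) => x y; rewrite ger0_norm ?flat_ge0// flat_le. Qed.

Let bnd_flatr l : bnd (fun x y => flat l y).
Proof. by exists (l%:R ^+ l) => x y; rewrite ger0_norm ?flat_ge0// flat_le. Qed.

Lemma laplacian_profile_bounded N p :
  exists K, forall x y, `|laplacian_profile N p x y| <= K.
Proof.
by repeat (first [exact: bnd_flatl|exact: bnd_flatr|exact: bnd_cst|apply: bndN|
  apply: bndD|apply: bndM]).
Qed.

Lemma flat_cvgy l (x : R ^nat) : x @ \oo --> +oo ->
  flat l (x i) @[i --> \oo] --> ((l == 0%N)%:R : R).
Proof.
move=> xoo; have x0 : \forall i \near \oo, 0 < x i by exact: (cvgryPgt x).1 xoo 0.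
have xV : (x i)^-1 @[i --> \oo] --> (0 : R) by exact/(gtr0_cvgV0 x0).
case: l => [|l] /=.
  apply: (@squeeze_cvgr _ _ _ _ (fun i => 1 - (x i)^-1) (cst 1)).
  - near=> i; have xi0 : 0 < x i by near: i.
    rewrite flat_gt0E// expr0 invr1 mul1r expR_le1 oppr_le0 invr_ge0 (ltW xi0) andbT.
    exact: expR_ge1Dx.
  - by rewrite -[1%:R](subr0 (1 : R)); apply: cvgB => //; exact: cvg_cst.
  - exact: cvg_cst.
apply: (@squeeze_cvgr _ _ _ _ (cst 0) (fun i => l%:R ^+ l * (x i)^-1)).
- near=> i; have xi0 : 0 < x i by near: i.
  by rewrite flat_ge0 flatS_le.
- exact: cvg_cst.
- by rewrite -[0%:R](mulr0 (l%:R ^+ l : R)); apply: cvgMr.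
Unshelve. all: by end_near. Qed.

(** As x tends to infinity, flat 0 x tends to 1 and flat l x to 0 for l > 0; as y
    tends to 1, all flat l y tend to exp(-1), and the combinations of
    derivatives in y cancel. *)
Lemma laplacian_profile_cvg N p (x y : R ^nat) :
  x @ \oo --> +oo -> y @ \oo --> (1 : R) ->
  laplacian_profile N p (x i) (y i) @[i --> \oo] -->
    2 * p * (N%:R + 2 * p - 2) * expR (- 1).
Proof.
move=> xoo y1.
have fx l := @flat_cvgy l x xoo.
have fy l : flat l (y i) @[i --> \oo] --> expR (- 1 : R).
  have -> : expR (- 1 : R) = flat l 1 by rewrite flat_gt0E// expr1n invr1 mul1r.
  by apply: continuous_cvg => //; exact: continuous_flat.
have -> : 2 * p * (N%:R + 2 * p - 2) * expR (- 1) =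
  2 * p * (N%:R + 2 * p - 2) * ((0 == 0)%N%:R * expR (- 1)) +
  (8 * p + 2 * N%:R) * (((1 == 0)%N%:R + (2 == 0)%N%:R) * expR (- 1)
                        - (0 == 0)%N%:R * (expR (- 1) - expR (- 1))) +
  4 * (((4 == 0)%N%:R - 3 * (2 == 0)%N%:R - 2 * (1 == 0)%N%:R) * expR (- 1)
       - 2 * (((1 == 0)%N%:R + (2 == 0)%N%:R) * (expR (- 1) - expR (- 1)))
       + (0 == 0)%N%:R * (expR (- 1) - 4 * expR (- 1) + 5 * expR (- 1) - 2 * expR (- 1))).
  by rewrite /=; ring.
rewrite /laplacian_profile.
have k (c l : R) (f : R ^nat) : f @ \oo --> l -> c * f i @[i --> \oo] --> c * l.
  by move=> fl; apply: cvgMr.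
have D (f g : R ^nat) (l m : R) : f @ \oo --> l -> g @ \oo --> m ->
    f i + g i @[i --> \oo] --> l + m by move=> fl gm; exact: cvgD.
have S (f g : R ^nat) (l m : R) : f @ \oo --> l -> g @ \oo --> m ->
    f i - g i @[i --> \oo] --> l - m by move=> fl gm; exact: cvgB.
have M (f g : R ^nat) (l m : R) : f @ \oo --> l -> g @ \oo --> m ->
    f i * g i @[i --> \oo] --> l * m by move=> fl gm; exact: cvgM.
apply: (D).
  apply: (D); first by apply/k; apply: (M); [exact: fx|exact: fy].
  apply/k; apply: (S); apply: (M); [|exact: fy|exact: fx|].
    by apply: (D); exact: fx.
  by apply: (S); exact: fy.
apply/k; apply: (D).
  apply: (S).
    apply: (M _ _ _ _ _ (fy 0%N)); apply: (S); last by apply/k; exact: fx.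
    by apply: (S); [exact: fx|apply/k; exact: fx].
  by apply/k; apply: (M); [apply: (D); exact: fx|apply: (S); exact: fy].
apply: (M); first exact: fx.
apply: (S); last by apply/k; exact: fy.
apply: (D); last by apply/k; exact: fy.
by apply: (S); [exact: fy|apply/k; exact: fy].
Qed.

End radial_laplacian.

(** * Derivatives along lines and smooth functions *)

Section directional_calculus.
Context {R : realType} {N : nat}.
Implicit Types (f g q : 'rV[R]_N -> R) (z v : 'rV[R]_N).

(** Makes the one-variable calculus available for directional derivatives. *)
Lemma is_derive_line f z v (d : R) :
  is_derive z v f d <-> is_derive (0 : R) 1 (fun h : R => f (h *: v + z)) d.
Proof.
have E : (fun h : R => h^-1 *: ((f \o shift z) (h *: v) - f z)) =
  (fun h : R => h^-1 *: (((fun h : R => f (h *: v + z)) \o shift 0) (h *: (1 : R))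
     - f ((0 : R) *: v + z))).
  by apply/funext => h /=; rewrite addr0 scale0r add0r [_%:A]mulr1.
split => -[d1 d2]; constructor.
- by rewrite /derivable -E.
- by rewrite -d2 /derive -E.
- by rewrite /derivable E.
- by rewrite -d2 /derive E.
Qed.

Lemma is_derive_line_at f z v (t d : R) : is_derive (t *: v + z) v f d ->
  is_derive t 1 (fun h : R => f (h *: v + z)) d.
Proof.
move=> /is_derive_line h.
have -> : (fun h : R => f (h *: v + z)) =
   (fun h : R => f (h *: v + (t *: v + z))) \o (fun h => h - t).
  by apply/funext => r /=; rewrite addrA -scalerDl subrK.
rewrite -[d]mulr1; apply: is_derive1_comp.
  by rewrite subrr.
have k := is_deriveB (is_derive_id t (1 : R)) (is_derive_cst t t (1 : R)).
by apply: (is_derive_eq k); rewrite subr0.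
Qed.

Lemma is_derive_comp_line (G : R -> R) q z v (dG dq : R) :
  is_derive (q z) 1 G dG -> is_derive z v q dq ->
  is_derive z v (G \o q) (dG * dq).
Proof.
move=> hG /is_derive_line hq; apply/is_derive_line.
by apply: (@is_derive1_comp R G) => //; rewrite scale0r add0r.
Qed.

Lemma is_derive_coord z (v : 'rV[R]_N) j :
  is_derive z v (fun y : 'rV[R]_N => y ord0 j) (v ord0 j).
Proof.
apply/is_derive_line.
have -> : (fun h : R => (h *: v + z) ord0 j) = (fun h => h * v ord0 j + z ord0 j).
  by apply/funext => h; rewrite !mxE.
have k := is_deriveD (is_deriveM (is_derive_id (0 : R) 1) (is_derive_cst (v ord0 j) (0 : R) (1 : R)))
  (is_derive_cst (z ord0 j) (0 : R) (1 : R)).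
by apply: (is_derive_eq k); rewrite /GRing.scale/= mul0r mulr1 add0r addr0.
Qed.

Notation "'e_ i" := (delta_mx ord0 i : 'rV[R]_N) (at level 8, i at level 2).

Definition smooth f := forall k, cont_diff k setT f.

Lemma partials_cat s t f : partials (s ++ t) f = partials s (partials t f).
Proof. by rewrite /partials foldr_cat. Qed.

Lemma smoothP f : smooth f <-> forall s : seq 'I_N,
  continuous (partials s f) /\ forall i x, derivable (partials s f) x 'e_i.
Proof.
split => [sf s|h k s sk x _]; last first.
  have [h1 h2] := h s; split; first exact: h1.
  by move=> _ i; exact: h2.
split=> [x|i x]; first exact: (sf _ s (leqnn _) x I).1.
exact: ((sf (size s).+1 s (leqnSn _) x I).2 (ltnSn _)).
Qed.

Lemma smooth_partials s f : smooth f -> smooth (partials s f).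
Proof. by move=> /smoothP sf; apply/smoothP => t; rewrite -partials_cat. Qed.

Lemma smooth_continuous f : smooth f -> continuous f.
Proof. by move=> /smoothP /(_ [::])[]. Qed.

Lemma smooth_derivable f i x : smooth f -> is_derive x 'e_i f (partials [:: i] f x).
Proof. by move=> /smoothP /(_ [::])[_ h]; apply: derivableP. Qed.

(** Smoothness is proved by exhibiting a class of functions which is stable under
    partial derivatives, instead of by computing iterated derivatives. *)
Lemma smooth_class (C : ('rV[R]_N -> R) -> Prop) :
  (forall f, C f -> continuous f /\
     forall i, exists2 g, C g & forall z, is_derive z 'e_i f (g z)) ->
  forall f, C f -> smooth f.
Proof.
move=> hC f Cf; apply/smoothP => s.
suff : C (partials s f).
  move=> /hC[cs ds]; split=> // i x; have [g _ dg] := ds i.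
  exact: (@ex_derive _ _ _ _ _ _ _ (dg x)).
elim: s => //= i s /hC[_ /(_ i)[g Cg dg]].
rewrite (_ : 'D_'e_i _ = g)//; apply/funext => z.
exact: (@derive_val _ _ _ _ _ _ _ (dg z)).
Qed.

Lemma continuous_coord j : continuous (fun y : 'rV[R]_N => y ord0 j).
Proof. exact: coord_continuous. Qed.

Lemma continuousD_rV f g : continuous f -> continuous g -> continuous (fun y => f y + g y).
Proof. by move=> cf cg y; exact: (cvgD (cf y) (cg y)). Qed.

Lemma continuousM_rV f g : continuous f -> continuous g -> continuous (fun y => f y * g y).
Proof. by move=> cf cg y; exact: (cvgM (cf y) (cg y)). Qed.

Lemma continuous_cst_rV (c : R) : continuous (fun _ : 'rV[R]_N => c).
Proof. exact: cst_continuous. Qed.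

Lemma smooth_affine_coord (c d : R) j : smooth (fun y => c * y ord0 j + d).
Proof.
apply: (@smooth_class (fun f => exists c d j, f = fun y => c * y ord0 j + d)); last first.
  by exists c, d, j.
move=> _ [c' [d' [j' ->]]]; split=> [|i].
  apply: continuousD_rV; last exact: continuous_cst_rV.
  by apply: continuousM_rV; [exact: continuous_cst_rV|exact: continuous_coord].
exists (fun y : 'rV[R]_N => 0 * y ord0 j' + c' * ((delta_mx ord0 i : 'rV[R]_N) ord0 j')); first by exists 0, (c' * ((delta_mx ord0 i : 'rV[R]_N) ord0 j')), j'.
move=> z; have k := is_deriveD (is_deriveZ c' (is_derive_coord z 'e_i j'))
  (is_derive_cst d' z 'e_i).
by apply: (is_derive_eq k); rewrite mul0r add0r addr0.
Qed.

Lemma smooth_cst (c : R) : smooth (fun=> c).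
Proof.
apply: (@smooth_class (fun f => exists c, f = fun=> c)); last by exists c.
move=> _ [d ->]; split=> [|i]; first exact: continuous_cst_rV.
by exists (fun=> 0) => [|z]; [exists 0|exact: is_derive_cst].
Qed.

(** The square of |k (z - x)|.  For k = 1/kappa it takes at z = x + kappa y the value
    |y|^2, which is how a radial function of y becomes a test function of z. *)
Definition sqdist (x : 'rV[R]_N) (k : R) z : R := sqnorm (k *: (z - x)).

Lemma sqdistE x k z : sqdist x k z = k ^+ 2 * \sum_i (z ord0 i - x ord0 i) ^+ 2.
Proof.
by rewrite /sqdist /sqnorm mulr_sumr; apply: eq_bigr => i _; rewrite !mxE exprMn.
Qed.

Lemma is_derive_sqdist x (k : R) z i :
  is_derive z 'e_i (sqdist x k) (2 * k ^+ 2 * (z ord0 i - x ord0 i)).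
Proof.
apply/is_derive_line; set c := 2 * _ * _.
have -> : (fun h : R => sqdist x k (h *: 'e_i + z)) =
  (fun h => sqdist x k z + (c * h + k ^+ 2 * h ^+ 2)).
  apply/funext => h; rewrite !sqdistE.
  rewrite (bigD1 i)//= [in RHS](bigD1 i)//= !mxE !eqxx/= mulr1.
  rewrite (eq_bigr (fun j => (z ord0 j - x ord0 j) ^+ 2)); last first.
    by move=> j ji; rewrite !mxE (negbTE ji) andbF mulr0 add0r.
  by rewrite /c; ring.
have k1 := is_deriveD (is_deriveZ c (is_derive_id (0 : R) 1))
   (is_deriveZ (k ^+ 2) (is_deriveX 2 (is_derive_id (0 : R) 1))).
have k2 := is_deriveD (is_derive_cst (sqdist x k z) (0 : R) (1 : R)) k1.
by apply: (is_derive_eq k2); rewrite /GRing.scale/= expr1 mulr0 mul0r mulr0 addr0 add0r mulr1.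
Qed.

Lemma continuous_sqdist x k : continuous (sqdist x k).
Proof.
rewrite (_ : sqdist x k = (fun z => k ^+ 2 * \sum_i (z ord0 i - x ord0 i) ^+ 2)).
  apply: continuousM_rV; first exact: continuous_cst_rV.
  apply: (@continuous_big R _ +%R 0 xpredT _ _ _ (fun i z => (z ord0 i - x ord0 i) ^+ 2)).
    exact: add_continuous.
  move=> i _; apply: continuousM_rV; apply: continuousD_rV;
    by [exact: continuous_coord|exact: continuous_cst_rV].
by apply/funext => y; exact: sqdistE.
Qed.

End directional_calculus.

(** * Test functions *)

Section test_functions.
Context {R : realType} {N : nat}.
Implicit Types (f g phi : 'rV[R]_N -> R) (x z : 'rV[R]_N).
Notation "'e_ i" := (delta_mx ord0 i : 'rV[R]_N) (at level 8, i at level 2).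

(** The algebra generated by the smooth functions and the cut-off powers of
    |k (z - x)|^2; by the product rule it is stable under partial derivatives. *)
Inductive radial_class x (k a b : R) : ('rV[R]_N -> R) -> Prop :=
| RadialSmooth f of smooth f : radial_class x k a b f
| RadialAnnular p l r :
    radial_class x k a b (fun z => annular a b p l r (sqdist x k z))
| RadialAdd f g of radial_class x k a b f & radial_class x k a b g :
    radial_class x k a b (fun z => f z + g z)
| RadialMul f g of radial_class x k a b f & radial_class x k a b g :
    radial_class x k a b (fun z => f z * g z).

Lemma continuous_annular (a b p : R) l r : 0 < a -> continuous (annular a b p l r).
Proof.
move=> a0 t; have [d _] := is_derive_annular b p l r t a0.
by apply: (@differentiable_continuous _ R R); exact/derivable1_diffP.
Qed.

Lemma is_derive_annular_sqdist x (k a b p : R) l r z i : 0 < a ->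
  is_derive z 'e_i (fun z => annular a b p l r (sqdist x k z))
    (annular' a b p l r (sqdist x k z) * (2 * k ^+ 2 * (z ord0 i - x ord0 i))).
Proof.
move=> a0; apply: (is_derive_comp_line (q := sqdist x k)).
  exact: is_derive_annular.
exact: is_derive_sqdist.
Qed.

Lemma radial_class_smooth x (k a b : R) : 0 < a ->
  forall f, radial_class x k a b f -> smooth f.
Proof.
move=> a0; apply: smooth_class => f; elim=> {f}.
- move=> f sf; split; first exact: smooth_continuous.
  move=> i; exists (partials [:: i] f); first exact/RadialSmooth/smooth_partials.
  by move=> z; exact: smooth_derivable.
- move=> p l r; split.
    move=> z; apply: continuous_comp; first exact: continuous_sqdist.
    exact: continuous_annular.
  move=> i; exists (fun z => annular' a b p l r (sqdist x k z) *
      (2 * k ^+ 2 * (z ord0 i - x ord0 i))); last first.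
    by move=> z; exact: is_derive_annular_sqdist.
  have C c : radial_class x k a b (fun=> c) by exact/RadialSmooth/smooth_cst.
  have A := @RadialAnnular x k a b.
  have Z c f : radial_class x k a b f -> radial_class x k a b (fun z => c * f z).
    by move=> hf; apply: RadialMul.
  have B f g : radial_class x k a b f -> radial_class x k a b g ->
      radial_class x k a b (fun z => f z - g z).
    move=> hf hg; have -> : (fun z => f z - g z) = (fun z => f z + (-1) * g z).
      by apply/funext => z; rewrite mulN1r.
    by apply: RadialAdd => //; exact: (Z).
  apply: RadialMul.
    apply: (B); last by apply: (Z); apply: (B); last apply: (Z).
    apply: RadialAdd; first exact: (Z).
    by apply: (Z); apply: (B); last apply: (Z).
  have -> : (fun z => 2 * k ^+ 2 * (z ord0 i - x ord0 i)) =
     (fun z => 2 * k ^+ 2 * z ord0 i + (- (2 * k ^+ 2 * x ord0 i))).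
    by apply/funext => z; ring.
  exact/RadialSmooth/smooth_affine_coord.
- move=> f g _ [cf df] _ [cg dg]; split; first exact: continuousD_rV.
  move=> i; have [f' Cf' hf'] := df i; have [g' Cg' hg'] := dg i.
  exists (fun z => f' z + g' z); first exact: RadialAdd.
  by move=> z; exact: is_deriveD.
- move=> f g Cf [cf df] Cg [cg dg]; split; first exact: continuousM_rV.
  move=> i; have [f' Cf' hf'] := df i; have [g' Cg' hg'] := dg i.
  exists (fun z => f z * g' z + g z * f' z).
    by apply: RadialAdd; apply: RadialMul.
  by move=> z; exact: is_deriveM.
Qed.

Let smooth_alg f : radial_class 0 0 1 1 f -> smooth f.
Proof. exact: radial_class_smooth. Qed.

Lemma smoothD f g : smooth f -> smooth g -> smooth (fun z => f z + g z).
Proof. by move=> sf sg; apply: smooth_alg; apply: RadialAdd; exact: RadialSmooth. Qed.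

Lemma smoothM f g : smooth f -> smooth g -> smooth (fun z => f z * g z).
Proof. by move=> sf sg; apply: smooth_alg; apply: RadialMul; exact: RadialSmooth. Qed.

Lemma smooth_sum n (f : 'I_n -> 'rV[R]_N -> R) :
  (forall i, smooth (f i)) -> smooth (fun z => \sum_i f i z).
Proof.
move=> sf; rewrite (_ : (fun z => _) = \sum_i f i); last first.
  by apply/funext => z; rewrite fct_sumE.
elim/big_ind: _ => [|g h sg sh|i _]; [exact: smooth_cst|exact: smoothD|exact: sf].
Qed.

Lemma smooth_neg_laplacian f : smooth f -> smooth (neg_laplacian f).
Proof.
move=> sf; rewrite (_ : neg_laplacian f =
    fun z => (-1) * \sum_i partials [:: i; i] f z); last first.
  by apply/funext => z; rewrite mulN1r.
apply: smoothM; first exact: smooth_cst.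
exact: (smooth_sum (f := fun i => partials [:: i; i] f) (fun i => smooth_partials [:: i; i] sf)).
Qed.

Lemma annular_sqdist_smooth x (k a b p : R) l r : 0 < a ->
  smooth (fun z => annular a b p l r (sqdist x k z)).
Proof. by move=> a0; apply: radial_class_smooth a0 _ (RadialAnnular _ _ _ _ _ _ _). Qed.

(** The second derivatives of G(k^2 |z - x|^2) sum up to
    k^2 (4 rho G''(rho) + 2 N G'(rho)) with rho = k^2 |z - x|^2. *)
Lemma neg_laplacian_annular x (k a b p : R) z : 0 < a ->
  neg_laplacian (fun z => annular a b p 0 0 (sqdist x k z)) z =
  - (k ^+ 2 * radial_laplacian N a b p (sqdist x k z)).
Proof.
move=> a0; rewrite /neg_laplacian; congr (- _).
have E i : partials [:: i; i] (fun z => annular a b p 0 0 (sqdist x k z)) z =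
    annular'' a b p 0 0 (sqdist x k z) * (4 * k ^+ 4 * (z ord0 i - x ord0 i) ^+ 2)
    + annular' a b p 0 0 (sqdist x k z) * (2 * k ^+ 2).
  rewrite /partials /=.
  rewrite (_ : 'D_'e_i _ = fun z => annular' a b p 0 0 (sqdist x k z) *
      (2 * k ^+ 2 * (z ord0 i - x ord0 i))); last first.
    apply/funext => y.
    exact: (@derive_val _ _ _ _ _ _ _ (is_derive_annular_sqdist x k b p 0 0 y i a0)).
  have d1 := is_derive_comp_line (is_derive_annular' b p 0 0 (sqdist x k z) a0)
     (is_derive_sqdist x k z i).
  have d2 : is_derive z 'e_i (fun z : 'rV[R]_N => 2 * k ^+ 2 * (z ord0 i - x ord0 i)) (2 * k ^+ 2).
    have d := is_deriveZ (2 * k ^+ 2)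
      (is_deriveB (is_derive_coord z 'e_i i) (is_derive_cst (x ord0 i) z 'e_i)).
    by apply: (is_derive_eq d); rewrite /GRing.scale /= mxE !eqxx subr0 mulr1.
  have -> := @derive_val _ _ _ _ _ _ _ (is_deriveM d1 d2).
  by rewrite /GRing.scale /=; ring.
rewrite (eq_bigr _ (fun i _ => E i)) big_split/= -!mulr_sumr sumr_const card_ord.
rewrite /radial_laplacian {3}sqdistE -mulr_natr.
by move: (annular'' _ _ _ _ _ _) (annular' _ _ _ _ _ _) (\sum_i _) => A B C; ring.
Qed.

Definition bounded_support f := exists r : R, forall z, r < `|z| -> f z = 0.

Lemma closed_closed_ball_rV (r : R) : closed [set z : 'rV[R]_N | `|z| <= r].
Proof.
apply: (@preimage_closed _ _ (fun z : 'rV[R]_N => `|z|) [set t | t <= r]); first by move=> y _; exact: norm_continuous.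
exact: closed_le.
Qed.

Lemma compact_closed_ball_rV (r : R) : compact [set z : 'rV[R]_N | `|z| <= r].
Proof.
apply: bounded_closed_compact.
  exists r; split; first exact: num_real.
  by move=> s rs z /= zr; exact: le_trans (ltW rs).
exact: closed_closed_ball_rV.
Qed.

Lemma test_functionP f : test_function f <-> smooth f /\ bounded_support f.
Proof.
split => -[sf cf]; split => //.
  have [M [_ hM]] := compact_bounded cf.
  exists (M + 1) => z Mz; apply/eqP/negPn/negP => fz.
  have Mlt : M < M + 1 by rewrite ltrDl.
  have := hM (M + 1) Mlt z (@subset_closure _ [set y | f y != 0] z fz).
  by rewrite /= leNgt Mz.
have [r hr] := cf.
apply: (@subclosed_compact _ _ [set z : 'rV[R]_N | `|z| <= r]).
- exact: closed_closure.
- exact: compact_closed_ball_rV.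
rewrite [X in _ `<=` X]((closure_id _).1 (@closed_closed_ball_rV r)).
apply: closure_subset => z /= /eqP fz; rewrite leNgt; apply/negP => /hr.
by move=> /fz.
Qed.

Lemma test_function_smooth f : test_function f -> smooth f.
Proof. by case. Qed.

Lemma test_function_partials s f : test_function f -> test_function (partials s f).
Proof.
move=> /test_functionP[sf [r hr]]; apply/test_functionP; split.
  exact: smooth_partials.
exists r; elim: s => //= i s IH z rz.
rewrite (@near_eq_derive _ _ _ _ (fun=> 0)) ?derive_cst//.
have : open [set y : 'rV[R]_N | r < `|y|].
  rewrite (_ : [set _ | _] = ~` [set y : 'rV[R]_N | `|y| <= r]).
    exact/closed_openC/closed_closed_ball_rV.
  by apply/seteqP; split => y /=; rewrite ltNge => /negP.
by rewrite openE => /(_ z rz); apply: filterS => y /IH.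
Qed.

Lemma test_function_neg_laplacian f : test_function f -> test_function (neg_laplacian f).
Proof.
move=> tf; apply/test_functionP; split.
  exact/smooth_neg_laplacian/test_function_smooth.
have h i : bounded_support (partials [:: i; i] f).
  by have /test_functionP[] := test_function_partials [:: i; i] tf.
have /choice[r hr] := h.
exists (\big[Num.max/0]_i r i) => z rz.
rewrite /neg_laplacian big1 ?oppr0// => i _; apply: hr; apply: le_lt_trans rz.
by apply/bigmax_geP; right; exists i.
Qed.

Lemma test_functionM f g : test_function f -> smooth g -> test_function (fun z => f z * g z).
Proof.
move=> /test_functionP[sf [r hr]] sg; apply/test_functionP; split; first exact: smoothM.
by exists r => z /hr ->; rewrite mul0r.
Qed.

(** The support is bounded since the cut-off vanishes for |k (z - x)|^2 > 1/b; as
    1 + 1/b is at least the square root of 1/b, it is a convenient bound for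
    |k (z - x)|. *)
Lemma annular_sqdist_test x (k a b p : R) : 0 < a -> 0 < b -> k != 0 ->
  test_function (fun z => annular a b p 0 0 (sqdist x k z)).
Proof.
move=> a0 b0 k0; apply/test_functionP; split; first exact: annular_sqdist_smooth.
have k0' : 0 < `|k| by rewrite normr_gt0.
exists (`|x| + (1 + b^-1) / `|k|) => z hz; apply: annular_big_eq0 => //.
have bi : 0 < b^-1 by rewrite invr_gt0.
have h : 1 + b^-1 < enorm (k *: (z - x)).
  apply: lt_le_trans (mx_norm_le_enorm _).
  rewrite mx_normZ mulrC -ltr_pdivrMr//.
  by rewrite -(ltrD2l `|x|) (lt_le_trans hz)// -{1}(subrK x z) addrC ler_normD.
rewrite /sqdist -sqr_enorm.
have h' : 1 < enorm (k *: (z - x)) by apply: lt_trans h; rewrite ltrDl.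
rewrite expr2; apply: lt_trans (_ : 1 * enorm (k *: (z - x)) < _); last first.
  by rewrite ltr_pM2r// (lt_trans _ h').
by rewrite mul1r (lt_trans _ h)// ltrDr.
Qed.

End test_functions.

(** * Real-valued integrals over the whole space *)

Section real_integrals.
Context d (T : measurableType d) (R : realType) (mu : {measure set T -> \bar R}).
Implicit Types (f g : T -> R).

Definition rintegrable f := mu.-integrable [set: T] (EFin \o f).

Lemma rintegrable_measurable f : rintegrable f -> measurable_fun [set: T] f.
Proof. by move=> /measurable_int/measurable_EFinP. Qed.

Lemma rintegrableD f g : rintegrable f -> rintegrable g -> rintegrable (fun x => f x + g x).
Proof. by move=> hf hg; exact: (integrableD measurableT hf hg). Qed.

Lemma rintegrableZ c f : rintegrable f -> rintegrable (fun x => c * f x).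
Proof. by move=> hf; exact: (integrableZl measurableT c hf). Qed.

Lemma rintegrableB f g : rintegrable f -> rintegrable g -> rintegrable (fun x => f x - g x).
Proof. by move=> hf hg; exact: (integrableB measurableT hf hg). Qed.

Lemma rintegrable0 : rintegrable (fun=> 0).
Proof. exact: integrable0. Qed.

Lemma rintegrable_sum n (f : 'I_n -> T -> R) :
  (forall i, rintegrable (f i)) -> rintegrable (fun x => \sum_i f i x).
Proof.
move=> hf; have := @integrable_sum _ _ _ mu setT measurableT _ (index_enum 'I_n) xpredT
  (fun i => EFin \o f i) (fun i _ => hf i).
by apply: eq_integrable => //= x _; rewrite sumEFin.
Qed.

Lemma rintegrable_le f g : measurable_fun [set: T] f -> (forall x, `|f x| <= g x) ->
  rintegrable g -> rintegrable f.
Proof.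
move=> mf fg; apply: (le_integrable measurableT); first exact/measurable_EFinP.
by move=> x _ /=; rewrite lee_fin (le_trans (fg x))// ler_norm.
Qed.

Lemma ge0_rintegrable f : measurable_fun [set: T] f -> (forall x, 0 <= f x) ->
  (\int[mu]_x (f x)%:E < +oo)%E -> rintegrable f.
Proof.
move=> mf f0 foo; apply/integrableP; split; first exact/measurable_EFinP.
by under eq_integral do rewrite /= ger0_norm//.
Qed.

Lemma RintegralD_T f g : rintegrable f -> rintegrable g ->
  \int[mu]_x (f x + g x) = \int[mu]_x f x + \int[mu]_x g x.
Proof. by move=> hf hg; exact: (RintegralD measurableT hf hg). Qed.

Lemma RintegralB_T f g : rintegrable f -> rintegrable g ->
  \int[mu]_x (f x - g x) = \int[mu]_x f x - \int[mu]_x g x.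
Proof. by move=> hf hg; exact: (RintegralB measurableT hf hg). Qed.

Lemma RintegralZ_T c f : rintegrable f -> \int[mu]_x (c * f x) = c * \int[mu]_x f x.
Proof. by move=> hf; exact: (RintegralZl c measurableT hf). Qed.

Lemma Rintegral_sum_T n (f : 'I_n -> T -> R) : (forall i, rintegrable (f i)) ->
  \int[mu]_x (\sum_i f i x) = \sum_i \int[mu]_x f i x.
Proof.
elim: n f => [|n IH] f hf.
  rewrite big_ord0 /Rintegral; under eq_integral do rewrite big_ord0.
  by rewrite integral0.
rewrite big_ord_recl -IH// -RintegralD_T//; last exact: rintegrable_sum.
by apply: eq_Rintegral => x _; rewrite big_ord_recl.
Qed.

Lemma ae_weaken (P Q : T -> Prop) : (forall x, P x -> Q x) ->
  {ae mu, forall x, P x} -> {ae mu, forall x, Q x}.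
Proof. by move=> PQ; apply: filterS. Qed.

Lemma ae_rintegrable f g : measurable_fun [set: T] g ->
  {ae mu, forall x, g x = f x} -> rintegrable f -> rintegrable g.
Proof.
move=> mg fg hf; have mf := rintegrable_measurable hf.
apply/integrableP; split; first exact/measurable_EFinP.
have /integrableP[_] := hf; congr (_ < _)%E.
apply: ae_eq_integral => //.
- by apply: measurableT_comp => //; exact/measurable_EFinP.
- by apply: measurableT_comp => //; exact/measurable_EFinP.
by apply: filterS fg => x /= -> _.
Qed.

Lemma ae_Rintegral f g : measurable_fun [set: T] f -> measurable_fun [set: T] g ->
  {ae mu, forall x, g x = f x} -> \int[mu]_x g x = \int[mu]_x f x.
Proof.
move=> mf mg fg; congr fine; apply: ae_eq_integral => //.
- exact/measurable_EFinP.
- exact/measurable_EFinP.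
by apply: filterS fg => x /= -> _.
Qed.

(** Measurability and integrability of the limit follow from the pointwise
    convergence and the bound. *)
Lemma dominated_cvg_Rintegral (F : nat -> T -> R) f g :
  (forall n, measurable_fun [set: T] (F n)) ->
  (forall x, F n x @[n --> \oo] --> f x) ->
  (forall n x, `|F n x| <= g x) -> rintegrable g ->
  \int[mu]_x F n x @[n --> \oo] --> \int[mu]_x f x.
Proof.
move=> mF Ff Fg hg.
have mf : measurable_fun [set: T] f.
  by apply: (measurable_fun_cvg (h := F)) => // x _; exact: Ff.
have fg x : `|f x| <= g x.
  have h : `|F n x| @[n --> \oo] --> `|f x| by apply: cvg_norm; exact: Ff.
  rewrite -(cvg_lim _ h)//; apply: limr_le; first by apply/cvg_ex; exists `|f x|.
  by near=> n; exact: Fg.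
have hf := rintegrable_le mf fg hg.
apply: fine_cvg; rewrite fineK; last exact: integrable_fin_num.
apply: (@dominated_cvg _ _ _ mu setT measurableT (fun n => EFin \o F n) (EFin \o f) (EFin \o g)) => //.
- by move=> n; exact/measurable_EFinP.
- by move=> x _; apply: cvg_EFin; [exact: nearW|exact: Ff].
- by move=> n x _; rewrite lee_fin.
Unshelve. all: by end_near. Qed.

End real_integrals.

(** * Integration by parts against test functions *)

Section test_integrals.
Context {R : realType} {N : nat}.
Local Notation mu := (@lebesgue_rV R N).
Local Notation V := (lebesgue_type R N).
Implicit Types (f g w phi : 'rV[R]_N -> R) (z : 'rV[R]_N).
Notation "'e_ i" := (delta_mx ord0 i : 'rV[R]_N) (at level 8, i at level 2).

Let B (r : R) : set 'rV[R]_N := [set z | `|z| <= r].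

Lemma measurable_closed_rV (K : set 'rV[R]_N) : closed K -> measurable (K : set V).
Proof.
move=> cK; apply: caratheodory_measurable_mu_ext.
have oK : open (~` K) by exact: closed_openC.
by rewrite -[X in measurable X]setCK; apply: measurableC; exact: open_measurable_rV.
Qed.

Let measurableB r : measurable (B r : set V).
Proof. by apply: measurable_closed_rV; exact: closed_closed_ball_rV. Qed.

Let lty_B r : (mu (B r) < +oo)%E.
Proof.
apply: le_lt_trans (lebesgue_rV_enorm_lt (N%:R * r + 1)).
apply: le_outer_measure => y /= yr; rewrite (le_lt_trans (enorm_le_mx_norm y))//.
by rewrite ltr_pwDr// ler_wpM2l.
Qed.

(** Local integrability includes measurability on compact sets, and balls exhaust
    the space. *)
Lemma L1loc_measurable f : L1loc f -> measurable_fun [set: V] (f : V -> R).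
Proof.
move=> lf; have -> : [set: V] = \bigcup_n B n%:R.
  apply/seteqP; split => // z _; exists (Num.bound `|z|) => //.
  by rewrite /B /= ltW// archi_boundP.
apply/measurable_fun_bigcup => n; first exact: measurableB.
have := lf (B n%:R) (@compact_closed_ball_rV _ _ _).
by move=> /measurable_int/measurable_EFinP.
Qed.

Lemma continuous_measurable_V f : continuous f -> measurable_fun [set: V] (f : V -> R).
Proof. by move=> cf; apply: measurable_fun_borel; exact: continuous_measurable_rV. Qed.

Lemma L1loc_patch f r : L1loc f -> rintegrable mu (fun z : V => `|f z| * \1_(B r) z).
Proof.
move=> lf; have := lf (B r) (@compact_closed_ball_rV _ _ _).
move=> /(integrable_mkcond (EFin \o (f : V -> R)) (measurableB r)) h.
have := integrable_abse h; apply: eq_integrable => //= z _.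
by rewrite /patch indicE; case: ifPn => _ /=; rewrite ?mulr1 ?mulr0// normr0.
Qed.

Lemma rintegrable_L1loc_mul f g (M r : R) : L1loc f -> measurable_fun [set: V] (g : V -> R) ->
  (forall z, `|g z| <= M) -> (forall z, r < `|z| -> g z = 0) ->
  rintegrable mu (fun z : V => f z * g z).
Proof.
move=> lf mg gM gr; apply: (rintegrable_le _ _ (rintegrableZ M (L1loc_patch r lf))).
  exact: (measurable_funM (L1loc_measurable lf) mg).
move=> z; rewrite normrM; have [zr|zr] := leP `|z| r.
  by rewrite indicE mem_set// mulr1 mulrC ler_wpM2r.
by rewrite gr// normr0 mulr0 mulr_ge0// ?mulr_ge0// (le_trans _ (gM z)).
Qed.

Lemma continuous_bounded_ball g r : continuous g ->
  exists M, forall z, `|z| <= r -> `|g z| <= M.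
Proof.
move=> cg; have cB : compact (g @` B r).
  apply: continuous_compact; last exact: compact_closed_ball_rV.
  exact: continuous_subspaceT.
have [M [_ hM]] := compact_bounded cB.
exists (M + 1) => z zr; apply: (hM (M + 1)); first by rewrite ltrDl.
by exists z.
Qed.

Lemma test_function_bounded phi : test_function phi ->
  exists M, forall z, `|phi z| <= M.
Proof.
move=> /test_functionP[/smooth_continuous cphi [r hr]].
have [M hM] := continuous_bounded_ball r cphi.
exists (Num.max M 0) => z; have [zr|zr] := leP `|z| r.
  by rewrite le_max hM.
by rewrite hr// normr0 le_max lexx orbT.
Qed.

Lemma rintegrable_test f phi : L1loc f -> test_function phi ->
  rintegrable mu (fun z : V => f z * phi z).
Proof.
move=> lf tphi; have [M hM] := test_function_bounded tphi.
have /test_functionP[sphi [r hr]] := tphi.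
apply: (rintegrable_L1loc_mul lf _ hM hr).
exact/continuous_measurable_V/smooth_continuous.
Qed.

Lemma L1loc_continuous f : continuous f -> L1loc f.
Proof.
move=> cf K cK.
have clK : closed K by apply: compact_closed => //; exact: norm_hausdorff.
have [M [_ hM]] := compact_bounded cK.
have KB : K `<=` B (M + 1) by move=> z /(hM (M + 1)); apply; rewrite ltrDl.
have [L hL] := continuous_bounded_ball (M + 1) cf.
apply: measurable_bounded_integrable.
- exact: measurable_closed_rV.
- by apply: le_lt_trans (lty_B (M + 1)); exact: le_outer_measure.
- exact/measurable_funTS/continuous_measurable_V.
exists L; split; first exact: num_real.
by move=> s Ls z Kz; apply: le_trans (ltW Ls); apply/hL/KB.
Qed.

Lemma rintegrable_test_function phi : test_function phi -> rintegrable mu phi.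
Proof.
move=> tphi; have := rintegrable_test (L1loc_continuous (@continuous_cst_rV _ _ 1)) tphi.
by apply: eq_integrable => //= z _; rewrite mul1r.
Qed.

Lemma Rintegral_shift f z : rintegrable mu f -> \int[mu]_y f (y + z) = \int[mu]_y f y.
Proof.
move=> hf; have h1 : (1 : R) != 0 by rewrite oner_eq0.
have := Rintegral_affine z h1 hf; rewrite normr1 invr1 expr1n mul1r => <-.
by apply: eq_Rintegral => y _; rewrite /affine scale1r addrC.
Qed.

Lemma norm_shift_basis z (r t : R) i : r + 1 < `|z| -> 0 <= t <= 1 ->
  r < `|z + t *: 'e_i|.
Proof.
move=> zr /andP[t0 t1].
pose e : 'rV[R]_N := 'e_i.
have e1 : `|t *: e| <= 1.
  rewrite normrZ ger0_norm// -[leRHS]mul1r ler_pM//.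
  rewrite [leLHS]mx_normrE; apply/bigmax_leP; split=> // -[j k] _ /=.
  by rewrite mxE; case: (_ && _); rewrite ?normr1 ?normr0.
have := ler_normB (z + t *: 'e_i) (t *: 'e_i); rewrite addrK => h.
by rewrite -(ltrD2r 1) (lt_le_trans zr)// (le_trans h)// lerD2l.
Qed.

(** The difference quotients (phi(z + h e_i) - phi(z)) / h have integral 0, by
    translation invariance.  They converge to the derivative and are dominated,
    by the mean value theorem, by a multiple of the indicator of a ball. *)
Lemma Rintegral_partial_eq0 phi i : test_function phi ->
  \int[mu]_z partials [:: i] phi z = 0.
Proof.
move=> tphi; have tdphi := test_function_partials [:: i] tphi.
have sphi := rintegrable_test_function tphi.
have /test_functionP[smphi [r hr]] := tphi.
have [M hM] := test_function_bounded tdphi.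
have M0 : 0 <= M by apply: le_trans (hM 0).
pose h (n : nat) : R := n.+1%:R^-1.
have h0 n : 0 < h n by rewrite invr_gt0.
have h1 n : h n <= 1 by rewrite invf_le1// ler1n.
pose F n (z : V) : R := (h n)^-1 * (phi (z + h n *: 'e_i) - phi z).
have sF n : rintegrable mu (fun z : V => phi (z + h n *: 'e_i)).
  have := integrable_affine (h n *: 'e_i) (oner_neq0 R) sphi.
  by apply: eq_integrable => //= y _; rewrite /affine scale1r addrC.
have F0 n : \int[mu]_z F n z = 0.
  rewrite /F (RintegralZ_T _ (rintegrableB (sF n) sphi)).
  by rewrite (RintegralB_T (sF n) sphi) Rintegral_shift// subrr mulr0.
have cv : \int[mu]_z F n z @[n --> \oo] --> \int[mu]_z partials [:: i] phi z.
  apply: (@dominated_cvg_Rintegral _ _ _ mu F _ (fun z : V => M * (`|1| * \1_(B (r + 1)) z))).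
  - by move=> n; exact: (rintegrable_measurable (rintegrableZ _ (rintegrableB (sF n) sphi))).
  - move=> z.
    have [dphi _] := smooth_derivable i z smphi.
    have /cvgr_dnbhsP/(_ h) : (fun h : R => h^-1 *: ((phi \o shift z) (h *: 'e_i) - phi z)) @ 0^'
      --> partials [:: i] phi z by exact: dphi.
    have hh : (forall n, h n != 0) /\ h @ \oo --> 0.
      by split=> [n|]; [rewrite gt_eqF|exact: cvg_harmonic].
    move=> /(_ hh) lim_h; have -> : (fun n => F n z) = (fun n =>
        (h n)^-1 *: ((phi \o shift z) (h n *: 'e_i) - phi z)); last exact: lim_h.
    by apply/funext => n; rewrite /F /= (addrC z).
  - move=> n z; rewrite normr1 mul1r.
    have [zr|zr] := leP `|z| (r + 1); last first.
      have z1 : r < `|z| by apply: lt_trans zr; rewrite ltrDl.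
      have z2 : r < `|z + h n *: 'e_i|.
        by apply: norm_shift_basis zr _; rewrite (ltW (h0 n)) h1.
      by rewrite /F !hr// subrr mulr0 normr0 mulr_ge0.
    rewrite indicE mem_set// mulr1 normrM gtr0_norm ?invr_gt0// ler_pdivrMl//.
    have d (t : R) : is_derive t 1 (fun s : R => phi (s *: 'e_i + z)) (partials [:: i] phi (t *: 'e_i + z)).
      by apply: is_derive_line_at; exact: smooth_derivable.
    have cont : {within `[0, h n], continuous (fun s : R => phi (s *: 'e_i + z))}.
      by apply: derivable_within_continuous => t _; exact: (@ex_derive _ _ _ _ _ _ _ (d t)).
    have [c _] := MVT_segment (ltW (h0 n)) (fun t _ => d t) cont.
    rewrite scale0r add0r subr0 (addrC z) => ->.
    by rewrite normrM (gtr0_norm (h0 n)) mulrC ler_pM2l.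
  - apply: rintegrableZ; apply: (@L1loc_patch (fun=> 1)).
    exact: L1loc_continuous (@continuous_cst_rV _ _ 1).
rewrite -(cvg_lim _ cv)//.
by under eq_fun do rewrite F0; exact: lim_cst.
Qed.

Lemma partial_mul f g i z : smooth f -> smooth g ->
  partials [:: i] (fun z => f z * g z) z =
  f z * partials [:: i] g z + g z * partials [:: i] f z.
Proof.
move=> sf sg.
exact: (@derive_val _ _ _ _ _ _ _ (is_deriveM (smooth_derivable i z sf) (smooth_derivable i z sg))).
Qed.

Lemma Rintegral_by_parts f phi i : smooth f -> test_function phi ->
  \int[mu]_z (f z * partials [:: i] phi z) = - \int[mu]_z (partials [:: i] f z * phi z).
Proof.
move=> sf tphi; have sphi := test_function_smooth tphi.
have := Rintegral_partial_eq0 i (test_functionM tphi sf).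
have h1 := rintegrable_test (L1loc_continuous (smooth_continuous sf))
  (test_function_partials [:: i] tphi).
have h2 := rintegrable_test
  (L1loc_continuous (smooth_continuous (smooth_partials [:: i] sf))) tphi.
rewrite (_ : \int[mu]_z partials [:: i] _ z =
    \int[mu]_z (partials [:: i] f z * phi z + f z * partials [:: i] phi z)); last first.
  by apply: eq_Rintegral => z _; rewrite partial_mul//; congr (_ + _); exact: mulrC.
by rewrite (RintegralD_T h2 h1) => /eqP; rewrite addrC addr_eq0 => /eqP.
Qed.

Lemma Rintegral_neg_laplacian_sym f phi : smooth f -> test_function phi ->
  \int[mu]_z (f z * neg_laplacian phi z) = \int[mu]_z (neg_laplacian f z * phi z).
Proof.
move=> sf tphi.
have h1 i := rintegrable_test (L1loc_continuous (smooth_continuous sf))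
  (test_function_partials [:: i; i] tphi).
have h2 i := rintegrable_test
  (L1loc_continuous (smooth_continuous (smooth_partials [:: i; i] sf))) tphi.
transitivity (\int[mu]_z (-1 * \sum_i (f z * partials [:: i; i] phi z))).
  by apply: eq_Rintegral => z _; rewrite mulN1r -mulr_sumr mulrN.
transitivity (\int[mu]_z (-1 * \sum_i (partials [:: i; i] f z * phi z))); last first.
  by apply: eq_Rintegral => z _; rewrite mulN1r -mulr_suml mulNr.
rewrite (RintegralZ_T _ (rintegrable_sum h1)) (RintegralZ_T _ (rintegrable_sum h2)).
rewrite (Rintegral_sum_T h1) (Rintegral_sum_T h2); congr (_ * _).
apply: eq_bigr => i _.
rewrite (Rintegral_by_parts i sf (test_function_partials [:: i] tphi)).
by rewrite (Rintegral_by_parts i (smooth_partials [:: i] sf) tphi) opprK.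
Qed.

(** The definition of the weak Laplacian, summed over the coordinates; the local
    integrability of g serves only to have both integrands measurable. *)
Lemma weak_neg_laplacianE w g phi : (0 < N)%N -> weak_neg_laplacian w g -> L1loc g ->
  test_function phi ->
  \int[mu]_z (w z * neg_laplacian phi z) = \int[mu]_z (g z * phi z).
Proof.
move=> N0 [h hw gh] lg tphi.
have lw : L1loc w by have [] := hw (Ordinal N0).
have lh i : L1loc (h i) by have [] := hw i.
have h1 i := rintegrable_test lw (test_function_partials [:: i; i] tphi).
have h2 i := rintegrable_test (lh i) tphi.
transitivity (\int[mu]_z (-1 * \sum_i (w z * partials [:: i; i] phi z))).
  by apply: eq_Rintegral => z _; rewrite mulN1r -mulr_sumr mulrN.
transitivity (\int[mu]_z (-1 * \sum_i (h i z * phi z))); last first.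
  apply: ae_Rintegral.
  - exact: (rintegrable_measurable (rintegrable_test lg tphi)).
  - exact: (rintegrable_measurable (rintegrableZ _ (rintegrable_sum h2))).
  - by apply: ae_weaken gh => z ->; rewrite -mulr_suml mulN1r mulNr.
rewrite (RintegralZ_T _ (rintegrable_sum h1)) (RintegralZ_T _ (rintegrable_sum h2)).
rewrite (Rintegral_sum_T h1) (Rintegral_sum_T h2); congr (_ * _).
apply: eq_bigr => i _; have [_ _ ->//] := hw i.
by rewrite /= sqrrN expr1n mul1r.
Qed.

(** Moves all k Laplacians onto the test function, so that the intermediate
    functions, each determined up to a null set, disappear. *)
Lemma weak_neg_laplacian_iterE k u v phi : (0 < N)%N -> L1loc u ->
  weak_neg_laplacian_iter k u v -> L1loc v -> test_function phi ->
  \int[mu]_z (v z * phi z) = \int[mu]_z (u z * iter k neg_laplacian phi z).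
Proof.
move=> N0 lu; elim: k v phi => [|k IH] v phi /=.
  move=> vu lv tphi; apply: ae_Rintegral.
  - exact: (rintegrable_measurable (rintegrable_test lu tphi)).
  - exact: (rintegrable_measurable (rintegrable_test lv tphi)).
  - by apply: ae_weaken vu => z ->.
move=> [w hw wv] lv tphi.
have lw : L1loc w by have [h hh _] := wv; have [] := hh (Ordinal N0).
apply: (etrans (esym (weak_neg_laplacianE N0 wv lv tphi))).
apply: (etrans (IH _ _ hw lw (test_function_neg_laplacian tphi))).
by rewrite -iterSr.
Qed.

End test_integrals.

(** * Taylor expansion and finite differences at a point *)

Section pointwise_taylor.
Context {R : realType} {N : nat}.
Implicit Types (f g : 'rV[R]_N -> R) (x y z w : 'rV[R]_N) (U : set 'rV[R]_N).
Notation "'e_ i" := (delta_mx ord0 i : 'rV[R]_N) (at level 8, i at level 2).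

(** The mean value theorem between 0 and t, for t of either sign. *)
Lemma MVT0 (h dh : R -> R) (t : R) :
  (forall s : R, `|s| <= `|t| -> is_derive s 1 h (dh s)) ->
  exists2 c, `|c| <= `|t| & h t - h 0 = dh c * t.
Proof.
move=> hd; have [t0|t0] := leP 0 t.
  have D s : s \in `[0, t] -> is_derive s 1 h (dh s).
    by rewrite in_itv/= => /andP[s0 st]; apply: hd; rewrite !ger0_norm.
  have cont : {within `[0, t], continuous h}.
    by apply: derivable_within_continuous => s /D hs; exact: (@ex_derive _ _ _ _ _ _ _ hs).
  have [c + E] := MVT_segment t0 (fun s hs => D s (subset_itv_oo_cc hs)) cont.
  rewrite in_itv/= => /andP[c0 ct]; exists c; first by rewrite !ger0_norm.
  by rewrite E subr0.
have D s : s \in `[t, 0] -> is_derive s 1 h (dh s).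
  rewrite in_itv/= => /andP[st s0]; apply: hd.
  by rewrite ler0_norm// (ltr0_norm t0) lerN2.
have cont : {within `[t, 0], continuous h}.
  by apply: derivable_within_continuous => s /D hs; exact: (@ex_derive _ _ _ _ _ _ _ hs).
have [c + E] := MVT_segment (ltW t0) (fun s hs => D s (subset_itv_oo_cc hs)) cont.
rewrite in_itv/= => /andP[ct c0]; exists c.
  by rewrite ler0_norm// (ltr0_norm t0) lerN2.
by rewrite -opprB E sub0r mulrN opprK.
Qed.

Let trunc (k : nat) w : 'rV[R]_N := \row_j (if (j < k)%N then w ord0 j else 0).

Let truncS w (i : 'I_N) : trunc i.+1 w = w ord0 i *: 'e_i + trunc i w.
Proof.
apply/rowP => j; rewrite !mxE ltnS leq_eqVlt eqxx /=.
have [->|ji] := eqVneq j i; first by rewrite eqxx ltnn mulr1 addr0.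
have -> : (j == i :> nat) = false by apply/negbTE.
by rewrite /= mulr0 add0r.
Qed.

(** Differentiability from continuous partial derivatives.  The increment from z to
    z + w is split into N increments along the axes, through the points
    z + trunc i w, and the mean value theorem is applied to each of them. *)
Lemma C1_differential g z :
  (\forall y \near z, forall i, derivable g y 'e_i) ->
  (forall i, {for z, continuous (partials [:: i] g)}) ->
  forall e : R, 0 < e -> \forall w \near (0 : 'rV[R]_N),
    `|g (z + w) - g z - \sum_i w ord0 i * partials [:: i] g z|
      <= e * \sum_i `|w ord0 i|.
Proof.
move=> dg cg e e0.
have H : \forall y \near z, (forall i, derivable g y 'e_i) /\
    (forall i, `|partials [:: i] g z - partials [:: i] g y| <= e).
  have H i : \forall y \near z, `|partials [:: i] g z - partials [:: i] g y| <= e.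
    by have /cvgrPdist_le := cg i; apply.
  by apply: filterI; [exact: dg|exact: (filter_forall _ H)].
have /nbhs_ballP[r /= r0 Hr] := H.
apply/nbhs_ballP; exists r => //= w; rewrite mx_norm_ball /ball_ /= sub0r normrN => wr.
have inball (i : 'I_N) (s : R) : `|s| <= `|w ord0 i| ->
    ball z r (s *: 'e_i + (z + trunc i w)).
  move=> sw; rewrite mx_norm_ball /ball_ /=.
  rewrite (_ : z - _ = - (s *: 'e_i + trunc i w)); last first.
    by rewrite addrCA opprD addNKr.
  rewrite normrN; apply: le_lt_trans wr.
  rewrite [leLHS]mx_normrE; apply/bigmax_leP; split=> // -[a j] _ /=.
  rewrite ord1 !mxE eqxx /=.
  have [->|ji] := eqVneq j i.
    by rewrite ltnn mulr1 addr0 (le_trans sw)// coord_le_mx_norm.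
  rewrite mulr0 add0r; case: ifP => _; first exact: coord_le_mx_norm.
  by rewrite normr0.
have step (i : 'I_N) : `|g (z + trunc i.+1 w) - g (z + trunc i w)
     - w ord0 i * partials [:: i] g z| <= e * `|w ord0 i|.
  pose h (s : R) := g (s *: 'e_i + (z + trunc i w)).
  have hd (s : R) : `|s| <= `|w ord0 i| ->
      is_derive s 1 h (partials [:: i] g (s *: 'e_i + (z + trunc i w))).
    move=> sw; apply: is_derive_line_at; apply: derivableP.
    by have [+ _] := Hr _ (inball i s sw); exact.
  have [c cw] := MVT0 hd.
  rewrite /h scale0r add0r truncS addrCA => ->.
  rewrite [X in X - _]mulrC -mulrBr normrM mulrC ler_wpM2r//.
  by rewrite distrC; have [_] := Hr _ (inball i c cw); exact.
have -> : g (z + w) - g z = \sum_(i < N) (g (z + trunc i.+1 w) - g (z + trunc i w)).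
  have := @telescope_sumr _ 0 N (fun k => g (z + trunc k w)) (leq0n N).
  rewrite big_mkord => ->; congr (g _ - g _).
    by congr (_ + _); apply/rowP => j; rewrite mxE ltn_ord.
  by rewrite -[LHS]addr0; congr (_ + _); apply/rowP => j; rewrite !mxE.
rewrite -sumrB; apply: le_trans (ler_norm_sum _ _ _) _.
by rewrite mulr_sumr; apply: ler_sum.
Qed.

End pointwise_taylor.

Section taylor.
Context {R : realType} {N : nat}.
Implicit Types (f g : 'rV[R]_N -> R) (x y z w v : 'rV[R]_N) (U : set 'rV[R]_N).
Notation "'e_ i" := (delta_mx ord0 i : 'rV[R]_N) (at level 8, i at level 2).

Lemma C1_is_derive g z v :
  (\forall y \near z, forall i, derivable g y 'e_i) ->
  (forall i, {for z, continuous (partials [:: i] g)}) ->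
  is_derive z v g (\sum_i v ord0 i * partials [:: i] g z).
Proof.
move=> dg cg; set D := \sum_i _.
have lim : (fun h : R => h^-1 *: ((g \o shift z) (h *: v) - g z)) @ 0^' --> D.
  apply/cvgrPdist_le => e e0.
  pose S := \sum_i `|v ord0 i|.
  have S0 : 0 <= S by apply: sumr_ge0.
  have e'0 : 0 < e / (1 + S) by rewrite divr_gt0// ltr_pwDl.
  have := C1_differential dg cg e'0 => /nbhs_ballP[r /= r0 Hr].
  have v1 : 0 < `|v| + 1 by rewrite ltr_wpDl.
  have hn : \forall h \near (0 : R)^', `|h| < r / (`|v| + 1).
    by apply: dnbhs0_lt; rewrite divr_gt0.
  have h0 : \forall h \near (0 : R)^', h != 0 by exact: nbhs_dnbhs_neq.
  near=> h.
  have hne : h != 0 by near: h.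
  have hpos : 0 < `|h| by rewrite normr_gt0.
  have hv : ball 0 r (h *: v).
    rewrite mx_norm_ball /ball_ /= sub0r normrN normrZ.
    apply: le_lt_trans (_ : `|h| * (`|v| + 1) < r).
      by rewrite ler_wpM2l// lerDl.
    by rewrite -ltr_pdivlMr//; near: h.
  have := Hr _ hv.
  under eq_bigr do rewrite mxE -mulrA.
  under [X in _ <= _ * X]eq_bigr do rewrite mxE normrM.
  rewrite -!mulr_sumr -/D -/S => hb.
  rewrite /= -[D](mulKf hne) -mulrBr normrM normfV ler_pdivrMl//.
  rewrite distrC (addrC _ z) (le_trans hb)// mulrCA ler_pM2l// mulrAC ler_pdivrMr; last first.
    by rewrite ltr_pwDl.
  by rewrite ler_pM2l// lerDr.
constructor; first by apply/cvg_ex; exists D.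
exact: cvg_lim lim.
Unshelve. all: by end_near. Qed.

Lemma C1_lipschitz_at g z :
  (\forall y \near z, forall i, derivable g y 'e_i) ->
  (forall i, {for z, continuous (partials [:: i] g)}) ->
  exists C, \forall w \near (0 : 'rV[R]_N), `|g (z + w) - g z| <= C * enorm w.
Proof.
move=> dg cg.
exists (\sum_(i < N) (1 + `|partials [:: i] g z|)).
apply: filterS (C1_differential dg cg ltr01) => w hw.
rewrite -[g _ - g _](subrK (\sum_i w ord0 i * partials [:: i] g z)).
apply: le_trans (ler_normD _ _) _; rewrite big_split /= mulrDl; apply: lerD.
  apply: le_trans hw _; rewrite mul1r mulr_suml; apply: ler_sum => i _.
  by rewrite mul1r coord_le_enorm.
apply: le_trans (ler_norm_sum _ _ _) _; rewrite mulr_suml; apply: ler_sum => i _.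
by rewrite normrM mulrC ler_wpM2l// coord_le_enorm.
Qed.

(** Only increments based at x enter the Hoelder condition: it is weaker than
    [locally_hoelder] and yet enough to expand at x. *)
Definition hoelder_at (U : set 'rV[R]_N) x (L : nat) (tau : R) g : Prop :=
  cont_diff L U g /\
  forall s : seq 'I_N, size s = L -> exists C,
    \forall y \near (0 : 'rV[R]_N),
      `|partials s g (x + y) - partials s g x| <= C * enorm y `^ tau.

Lemma cont_diff_partial U L g i : cont_diff L.+1 U g -> cont_diff L U (partials [:: i] g).
Proof.
move=> cg s sL z Uz.
have := cg (s ++ [:: i]) _ z Uz; rewrite size_cat addn1 ltnS => /(_ sL).
by rewrite partials_cat.
Qed.

Lemma hoelder_at_partial U x L tau g i :
  hoelder_at U x L.+1 tau g -> hoelder_at U x L tau (partials [:: i] g).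
Proof.
move=> [cg hg]; split; first exact: cont_diff_partial.
move=> s sL; have := hg (s ++ [:: i]); rewrite size_cat addn1 sL => /(_ erefl).
by rewrite partials_cat.
Qed.

Lemma cont_diff1 U L g z : open U -> U z -> cont_diff L.+1 U g ->
  (\forall y \near z, forall i, derivable g y 'e_i) /\
  (forall i, {for z, continuous (partials [:: i] g)}).
Proof.
move=> oU Uz cg; split.
  apply: filterS (open_nbhs_nbhs (conj oU Uz)) => y Uy i.
  by have [_] := cg [::] isT y Uy; apply.
by move=> i; have [] := cg [:: i] isT z Uz.
Qed.

Lemma nbhs_shift0 x (V : set 'rV[R]_N) :
  nbhs x V -> \forall y \near (0 : 'rV[R]_N), V (x + y).
Proof.
move=> /nbhs_ballP[r /= r0 Hr]; apply/nbhs_ballP; exists r => //= y.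
rewrite mx_norm_ball /ball_ /= sub0r => yr; apply: Hr.
by rewrite mx_norm_ball /ball_ /= opprD addNKr.
Qed.

Lemma near_shift0 U x : open U -> U x -> \forall y \near (0 : 'rV[R]_N), U (x + y).
Proof. by move=> oU Ux; exact/nbhs_shift0/open_nbhs_nbhs. Qed.

(** By induction on the order.  With P^i the expansions of the partial derivatives
    of g, Q_(l+1)(y) = sum_i y_i P^i_l(y) / (l+1); the derivative along the segment of
    the difference of g and its expansion is sum_i y_i times the remainder for
    the i-th derivative, and the mean value theorem adds one order.  Homogeneity of the
    terms is all that is needed of them. *)
Lemma taylor_at U x L tau g : open U -> U x -> 0 < tau -> hoelder_at U x L tau g ->
  exists2 P : nat -> 'rV[R]_N -> R,
    (forall l (t : R) y, P l (t *: y) = t ^+ l * P l y) &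
    exists C, \forall y \near (0 : 'rV[R]_N),
      `|g (x + y) - \sum_(l < L.+1) P l y| <= C * enorm y `^ (L%:R + tau).
Proof.
move=> oU Ux tau0; elim: L g => [|L IH] g hg.
  exists (fun l _ => if l is 0 then g x else 0).
    by move=> [|l] t y; rewrite ?expr0 ?mul1r ?mulr0.
  have [_ /(_ [::] erefl)[C hC]] := hg; exists C.
  by apply: filterS hC => y; rewrite big_ord1 add0r.
have IHi i := IH _ (hoelder_at_partial i hg).
have /choice[P hP] : forall i, exists P : nat -> 'rV[R]_N -> R,
   (forall l (t : R) y, P l (t *: y) = t ^+ l * P l y) /\
    exists C, \forall y \near (0 : 'rV[R]_N),
      `|partials [:: i] g (x + y) - \sum_(l < L.+1) P l y| <= C * enorm y `^ (L%:R + tau).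
  by move=> i; have [P h1 h2] := IHi i; exists P.
have Phom i := (hP i).1.
have /choice[C hC] := fun i => (hP i).2.
pose Q (l : nat) y : R := if l is k.+1 then (\sum_i y ord0 i * P i k y) / k.+1%:R else g x.
exists Q.
  move=> [|k] t y /=; first by rewrite expr0 mul1r.
  rewrite mulrA; congr (_ / _); rewrite mulr_sumr; apply: eq_bigr => i _.
  by rewrite mxE Phom exprS; ring.
exists (\sum_i `|C i|).
have [cg _] := hg.
have HU : \forall y \near (0 : 'rV[R]_N), U (x + y) /\
   forall i, `|partials [:: i] g (x + y) - \sum_(l < L.+1) P i l y|
      <= C i * enorm y `^ (L%:R + tau).
  by apply: filterI; [exact: near_shift0|exact: (filter_forall _ hC)].
have /nbhs_ballP[r /= r0 Hr] := HU.
apply/nbhs_ballP; exists r => //= y yr.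
(* the error along the segment from x to x + y, and its derivative *)
pose H (t : R) := g (t *: y + x) - \sum_(l < L.+1) Q l.+1 y * t ^+ l.+1.
pose dH (t : R) := \sum_i y ord0 i * partials [:: i] g (t *: y + x) -
  \sum_(l < L.+1) Q l.+1 y * (l.+1%:R * t ^+ l).
have tball (t : R) : `|t| <= 1 -> ball 0 r (t *: y).
  move: yr; rewrite mx_norm_ball /ball_ /= !sub0r !normrN normrZ => yr t1.
  by apply: le_lt_trans yr; rewrite ler_piMl.
have hd (t : R) : `|t| <= `|1| -> is_derive t 1 H (dH t).
  rewrite normr1 => t1; have [Ut _] := Hr _ (tball t t1).
  have [c1 c2] := cont_diff1 oU Ut cg.
  have d1 : is_derive t 1 (fun t : R => g (t *: y + x))
     (\sum_i y ord0 i * partials [:: i] g (t *: y + x)).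
    by apply: is_derive_line_at; rewrite addrC; exact: C1_is_derive.
  have d2 : is_derive t 1 (fun t : R => \sum_(l < L.+1) Q l.+1 y * t ^+ l.+1)
     (\sum_(l < L.+1) Q l.+1 y * (l.+1%:R * t ^+ l)).
    rewrite (_ : (fun t : R => _) = \sum_(l < L.+1) (fun t : R => Q l.+1 y * t ^+ l.+1)).
      apply: is_derive_sum => l.
      have dX : is_derive t (1 : R) (@GRing.exp R ^~ l.+1) (l.+1%:R * t ^+ l).
        by constructor; [exact: exprn_derivable|rewrite exp_derive /GRing.scale/= mulr1].
      have d := is_deriveZ (Q l.+1 y) dX.
      by apply: (is_derive_eq d); rewrite /GRing.scale.
    by apply/funext => u; rewrite fct_sumE.
  exact: (is_deriveB d1 d2).
have [c + E] := MVT0 hd; rewrite normr1 => c1.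
have -> : g (x + y) - \sum_(l < L.+2) Q l y = H 1 - H 0.
  rewrite /H scale1r scale0r add0r big_ord_recl /= opprD addrA (addrC y).
  rewrite [X in _ - (_ - X)]big1 ?subr0; last by move=> l _; rewrite expr0n mulr0.
  rewrite addrAC; congr (_ - _ - _); apply: eq_bigr => l _.
  by rewrite expr1n mulr1.
rewrite E mulr1 /dH.
have -> : \sum_(l < L.+1) Q l.+1 y * (l.+1%:R * c ^+ l) =
    \sum_i y ord0 i * \sum_(l < L.+1) P i l (c *: y).
  under [RHS]eq_bigr do rewrite mulr_sumr.
  rewrite exchange_big /=; apply: eq_bigr => l _.
  rewrite mulrA divfK ?pnatr_eq0// mulr_suml; apply: eq_bigr => i _.
  by rewrite Phom; ring.
rewrite -sumrB mulr_suml; apply: le_trans (ler_norm_sum _ _ _) _.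
apply: ler_sum => i _; rewrite -mulrBr normrM.
have [_ /(_ i)] := Hr _ (tball c c1); rewrite (addrC x) => hi.
have cy : enorm (c *: y) `^ (L%:R + tau) <= enorm y `^ (L%:R + tau).
  rewrite ge0_ler_powR ?nnegrE ?enorm_ge0 ?addr_ge0 ?(ltW tau0)//.
  by rewrite enormZ ler_piMl ?enorm_ge0.
have yi := coord_le_enorm y i.
apply: (@le_trans _ _ (enorm y * (`|C i| * enorm y `^ (L%:R + tau)))).
  apply: ler_pM => //; apply: le_trans hi _.
  apply: (@le_trans _ _ (`|C i| * enorm (c *: y) `^ (L%:R + tau))).
    by rewrite ler_wpM2r ?powR_ge0// ler_norm.
  by rewrite ler_wpM2l.
rewrite mulrCA ler_wpM2l// -natr1 -addrA (addrC 1) addrA.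
have [y0|y0] := eqVneq (enorm y) 0.
  by rewrite y0 mul0r powR_ge0.
rewrite [in leRHS]powRD; last by rewrite y0 implybT.
by rewrite powRr1 ?enorm_ge0// mulrC.
Qed.

(** The homogeneous terms of degree l <= L in the expansion are killed by
    the moments of the difference, and the remainder is left. *)
Lemma difference_at U x L tau g n (c k : 'I_n -> R) :
  open U -> U x -> 0 < tau -> hoelder_at U x L tau g ->
  (forall l, (l <= L)%N -> \sum_j c j * k j ^+ l = 0) ->
  exists C, \forall y \near (0 : 'rV[R]_N),
    `|\sum_j c j * g (x + k j *: y)| <= C * enorm y `^ (L%:R + tau).
Proof.
move=> oU Ux tau0 hg moment.
have [P Phom [C hC]] := taylor_at oU Ux tau0 hg.
exists (\sum_j `|c j| * `|C| * `|k j| `^ (L%:R + tau)).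
have hk j : \forall y \near (0 : 'rV[R]_N),
    `|g (x + k j *: y) - \sum_(l < L.+1) P l (k j *: y)|
      <= C * enorm (k j *: y) `^ (L%:R + tau).
  have sc : (fun y : 'rV[R]_N => k j *: y) @ (0 : 'rV[R]_N) --> (0 : 'rV[R]_N).
    by rewrite -[X in _ --> X](scaler0 _ (k j)); exact: scaler_continuous.
  exact: sc _ hC.
apply: filterS (filter_forall _ hk) => y hy.
have -> : \sum_j c j * g (x + k j *: y) =
    \sum_j c j * (g (x + k j *: y) - \sum_(l < L.+1) P l (k j *: y)).
  under [RHS]eq_bigr do rewrite mulrBr.
  rewrite sumrB [X in _ - X](_ : _ = 0) ?subr0//.
  under eq_bigr do rewrite mulr_sumr.
  rewrite exchange_big /= big1// => l _.
  under eq_bigr do rewrite Phom mulrA.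
  by rewrite -mulr_suml moment ?mul0r// -ltnS ltn_ord.
apply: le_trans (ler_norm_sum _ _ _) _; rewrite mulr_suml; apply: ler_sum => j _.
rewrite normrM -!mulrA ler_wpM2l//; apply: le_trans (hy j) _.
rewrite enormZ powRM ?enorm_ge0//; apply: ler_wpM2r => //; last exact: ler_norm.
by rewrite mulr_ge0 ?powR_ge0.
Qed.

End taylor.

(** * Hoelder conditions on iterated Laplacians *)

Section hoelder_at_laplacian.
Context {R : realType} {N : nat}.
Implicit Types (f g u : 'rV[R]_N -> R) (x y z w v : 'rV[R]_N) (U : set 'rV[R]_N).
Notation "'e_ i" := (delta_mx ord0 i : 'rV[R]_N) (at level 8, i at level 2).

Lemma cont_diff_neg_laplacianE U L g : open U -> cont_diff L.+2 U g ->
  forall s : seq 'I_N, (size s <= L)%N -> forall z, U z ->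
  partials s (neg_laplacian g) z = - \sum_i partials (s ++ [:: i; i]) g z.
Proof.
move=> oU cg; elim=> [//|i0 s IH] /= sL z Uz.
have Uz' : \forall y \near z, U y by exact: open_nbhs_nbhs (conj oU Uz).
have sL' : (size s <= L)%N by exact: ltnW.
have d i : derivable (partials (s ++ [:: i; i]) g) z 'e_i0.
  have := cg (s ++ [:: i; i]) _ z Uz; rewrite size_cat addn2 !ltnS sL'.
  by move=> /(_ isT)[_ /(_ sL)]; apply.
rewrite (@near_eq_derive _ _ _ _ (- (\sum_i partials (s ++ [:: i; i]) g))); last first.
  by apply: filterS Uz' => y /(IH sL') ->; rewrite [RHS]/(- _) fct_sumE.
rewrite deriveN; last exact: derivable_sum.
by rewrite derive_sum.
Qed.

Lemma cont_diff_neg_laplacian U L g : open U -> cont_diff L.+2 U g ->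
  cont_diff L U (neg_laplacian g).
Proof.
move=> oU cg s sL z Uz; have E := cont_diff_neg_laplacianE oU cg sL.
have Uz' : \forall y \near z, U y by exact: open_nbhs_nbhs (conj oU Uz).
have h i : {for z, continuous (partials (s ++ [:: i; i]) g)} /\
    ((size s < L)%N -> forall j, derivable (partials (s ++ [:: i; i]) g) z 'e_j).
  by have := cg (s ++ [:: i; i]) _ z Uz; rewrite size_cat addn2 !ltnS; apply.
have near_E : \forall y \near z,
    (- (\sum_i partials (s ++ [:: i; i]) g)) y = partials s (neg_laplacian g) y.
  by apply: filterS Uz' => y /E ->; rewrite [LHS]/(- _) fct_sumE.
split=> [|sL' j].
  rewrite /prop_for /continuous_at E//.
  apply: cvg_trans (near_eq_cvg near_E) _.
  rewrite (_ : - (\sum_i _) = fun y => - \sum_i partials (s ++ [:: i; i]) g y); last first.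
    by apply/funext => y; rewrite [LHS]/(- _) fct_sumE.
  apply: cvgN.
  apply: (@cvg_big R _ +%R 0 xpredT _ _ _ _ (fun i y => partials (s ++ [:: i; i]) g y)
    (fun i => partials (s ++ [:: i; i]) g z)).
    exact: add_continuous.
  by move=> i _; have [+ _] := h i.
apply: (@near_eq_derivable R _ _ (- (\sum_i partials (s ++ [:: i; i]) g)) _ z 'e_j near_E).
apply: derivableN; apply: derivable_sum => i.
by have [_ /(_ sL')] := h i; exact.
Qed.

Lemma hoelder_at_neg_laplacian U x L tau g : open U -> U x ->
  hoelder_at U x L.+2 tau g -> hoelder_at U x L tau (neg_laplacian g).
Proof.
move=> oU Ux [cg hg]; split; first exact: cont_diff_neg_laplacian.
move=> s sL.
have /choice[C hC] : forall i, exists C, \forall y \near (0 : 'rV[R]_N),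
   `|partials (s ++ [:: i; i]) g (x + y) - partials (s ++ [:: i; i]) g x|
      <= C * enorm y `^ tau.
  by move=> i; apply: hg; rewrite size_cat sL addn2.
exists (\sum_i C i).
have E := cont_diff_neg_laplacianE oU cg (eq_leq sL).
apply: filterS (filterI (near_shift0 oU Ux) (filter_forall _ hC)) => y [Uy hy].
rewrite !E// -opprD normrN -sumrB mulr_suml.
by apply: le_trans (ler_norm_sum _ _ _) _; apply: ler_sum.
Qed.

Lemma hoelder_at_iter U x K tau g j : open U -> U x -> (2 * j <= K)%N ->
  hoelder_at U x K tau g ->
  hoelder_at U x (K - 2 * j) tau (iter j neg_laplacian g).
Proof.
move=> oU Ux; elim: j => [|j IH] jK hg; first by rewrite muln0 subn0.
rewrite iterS; apply: hoelder_at_neg_laplacian => //.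
rewrite (_ : (K - 2 * j.+1).+2 = (K - 2 * j)%N); last by lia.
by apply: IH => //; lia.
Qed.

(** The exponent 2s + beta of the space is written there as k + tau with 0 < tau <= 1.
    The expansion has to be of order less than 2m, and only n < m is known: if
    k >= 2n + 2, the function is C^(2n+2), and the order 2n + 1 with tau = 1 will do. *)
Lemma hoelder_space_at U x n (sigma beta : R) u : open U -> U x ->
  0 < sigma < 1 -> 0 < beta < 1 ->
  hoelder_space (2 * (n%:R + sigma) + beta) U u ->
  exists (K : nat) (tau : R), [/\ (2 * n <= K)%N, (K <= 2 * n + 1)%N, 0 < tau,
     2 * (n%:R + sigma) < K%:R + tau & hoelder_at U x K tau u].
Proof.
move=> oU Ux /andP[s0 s1] /andP[b0 b1] [k [tau [E /andP[t0 t1] cu hu]]].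
have n2 : (2 * n)%:R = 2 * n%:R :> R by rewrite natrM.
have kl : (2 * n <= k)%N.
  rewrite -ltnS -(ltr_nat R) n2 -natr1; lra.
have [k1|k1] := leqP k (2 * n + 1).
  exists k, tau; split=> //; first lra.
  split=> // s sk; have [C [V Vx hV]] := hu s sk x Ux.
  exists C.
  near=> y; rewrite -[y in enorm y](addKr x) (addrC (- x)).
  by apply: hV; [near: y; exact: nbhs_shift0|exact: nbhs_singleton].
exists (2 * n + 1)%N, 1; split=> //; first by lia.
  by rewrite natrD n2; lra.
have cu1 : cont_diff (2 * n + 1) U u.
  move=> s sk z Uz; have [c1 c2] := cu s (leq_trans sk (ltnW k1)) z Uz.
  by split=> // sk' i; apply: c2; exact: leq_trans sk' (ltnW k1).
split=> // s sk.
have [c1 c2] : (\forall y \near x, forall i, derivable (partials s u) y 'e_i) /\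
  (forall i, {for x, continuous (partials [:: i] (partials s u))}).
  split=> [|i].
    apply: filterS (open_nbhs_nbhs (conj oU Ux)) => y Uy i.
    by have [_] := cu s (leq_trans (eq_leq sk) (ltnW k1)) y Uy; rewrite sk; apply.
  have si : (size (i :: s) <= k)%N by rewrite /= sk.
  by have [] := cu _ si x Ux.
have [C hC] := C1_lipschitz_at c1 c2; exists C.
by apply: filterS hC => y; rewrite powRr1// enorm_ge0.
Unshelve. all: by end_near. Qed.

Lemma smooth_hoelder_at x K u : smooth u -> hoelder_at setT x K 1 u.
Proof.
move=> su; split; first exact: su.
move=> s _; have ss := smooth_partials s su.
have [C hC] : exists C, \forall w \near (0 : 'rV[R]_N),
    `|partials s u (x + w) - partials s u x| <= C * enorm w.
  apply: C1_lipschitz_at => [|i]; last first.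
    by have := smooth_continuous (smooth_partials [:: i] ss); apply.
  by apply: (@filterE _ (nbhs x) _) => y i; have [] := smooth_derivable i y ss.
exists C.
by apply: filterS hC => y; rewrite powRr1// enorm_ge0.
Qed.

End hoelder_at_laplacian.

(** * Absolute convergence of the hypersingular integrals *)

Lemma measurable_linear_combination d (T : measurableType d) (R : realType) n
    (c : 'I_n -> R) (f : 'I_n -> T -> R) :
  (forall j, measurable_fun setT (f j)) ->
  measurable_fun setT (fun y => \sum_j c j * f j y).
Proof.
by move=> mf; apply: measurable_sum => j; apply: measurable_funM.
Qed.

Lemma measurable_normr d (T : measurableType d) (R : realType) (f : T -> R) :
  measurable_fun setT f -> measurable_fun setT (fun y => `|f y|).
Proof. by move=> mf; apply: measurableT_comp. Qed.

Section difference_quotient.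
Context {R : realType} {N : nat}.
Implicit Types (f g u : 'rV[R]_N -> R) (x y z : 'rV[R]_N).
Local Notation mu := (@lebesgue_rV R N).
Local Notation V := (lebesgue_type R N).

Lemma measurable_enorm_power (i : interval R) (q : R) :
  measurable_fun [set: V] (fun y : V =>
    \1_[set y : 'rV[R]_N | enorm y \in i] y * enorm y `^ q : R).
Proof.
apply: measurable_fun_borel; apply: measurable_funM.
  apply: measurable_indic; exact: measurable_enorm_itv.
exact: (measurableT_comp (measurable_powR q) measurable_enorm).
Qed.

Lemma rintegrable_enorm_near (q : R) : 0 < N%:R + q ->
  rintegrable mu (fun y : V => \1_[set y : 'rV[R]_N | enorm y \in `]0, 2[] y * enorm y `^ q).
Proof.
move=> Nq; apply: (ge0_rintegrable (measurable_enorm_power _ _)).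
  by move=> y; rewrite mulr_ge0// powR_ge0.
exact: integrable_enorm_near.
Qed.

Lemma rintegrable_enorm_far (q : R) : N%:R + q < 0 ->
  rintegrable mu (fun y : V => \1_[set y : 'rV[R]_N | enorm y \in `[1, +oo[] y * enorm y `^ q).
Proof.
move=> Nq; apply: (ge0_rintegrable (measurable_enorm_power _ _)).
  by move=> y; rewrite mulr_ge0// powR_ge0.
exact: integrable_enorm_far.
Qed.

Lemma enorm_affine_le x (k d : R) y : 0 < d -> d <= enorm y ->
  enorm (x + k *: y) <= N%:R * (`|x| / d + `|k|) * enorm y.
Proof.
move=> d0 dy; apply: le_trans (enorm_le_mx_norm _) _; rewrite -mulrA ler_wpM2l//.
apply: le_trans (ler_normD _ _) _; rewrite normrZ mulrDl lerD//.
  by rewrite mulrAC ler_pdivlMr// ler_wpM2l.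
by rewrite ler_wpM2l// mx_norm_le_enorm.
Qed.

(** For |y| >= d the substitution z = x + k y compares |y| with 1 + |z|, so that
    the term is dominated by the image of the integrable function
    |g(z)| / (1 + |z|^(N+2t')).  For k = 0 the term is g(x) times a power of |y|. *)
Lemma L1weighted_far g x (k d t t' : R) : (0 < N)%N -> 0 < t' <= t -> 0 < d ->
  L1weighted t' g ->
  exists2 G : V -> R, rintegrable mu G &
    forall y, 0 <= G y /\
      (d <= enorm y -> `|g (x + k *: y)| / enorm y `^ (N%:R + 2 * t) <= G y).
Proof.
move=> N0 /andP[t'0 t't] d0 [lg goo].
have P0 : 0 < N%:R + 2 * t by rewrite ltr_wpDl// mulr_gt0// (lt_le_trans t'0).
have p0 : 0 < N%:R + 2 * t' by rewrite ltr_wpDl// mulr_gt0.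
set P := N%:R + 2 * t in P0 *; set p := N%:R + 2 * t' in p0 goo *.
have [->|k0] := eqVneq k 0.
  have hn : 0 < N%:R + 0 :> R by rewrite addr0 ltr0n.
  have hf : N%:R - P < 0 by rewrite /P; lra.
  exists (fun y => `|g x| * (d `^ (- P) *
     (\1_[set y : 'rV[R]_N | enorm y \in `]0, 2[] y * enorm y `^ 0)
     + \1_[set y : 'rV[R]_N | enorm y \in `[1, +oo[] y * enorm y `^ (- P))).
    apply: rintegrableZ; apply: rintegrableD; last exact: rintegrable_enorm_far.
    by apply: rintegrableZ; exact: rintegrable_enorm_near.
  move=> y; split.
    by rewrite mulr_ge0// addr_ge0// !mulr_ge0// powR_ge0.
  move=> dy; rewrite scale0r addr0 ler_wpM2l// -powRN powRr0 mulr1.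
  have y0 : 0 < enorm y by exact: lt_le_trans dy.
  have [y2|y2] := ltP (enorm y) 2.
    rewrite !indicE mem_set /=; last by rewrite in_itv/= y0.
    rewrite mulr1 -[leLHS]addr0 lerD//.
      by rewrite !powRN lef_pV2 ?posrE ?powR_gt0// ge0_ler_powR// ?nnegrE// ltW.
    by rewrite mulr_ge0// powR_ge0.
  rewrite [X in _ <= _ + X * _]indicE mem_set /=; last by rewrite in_itv/= andbT; lra.
  by rewrite mul1r lerDr mulr_ge0// powR_ge0.
pose h (z : V) : R := `|g z| / (1 + enorm z `^ p).
have w0 z : 0 < 1 + enorm z `^ p :> R by rewrite ltr_pwDl// powR_ge0.
have mh : measurable_fun [set: V] h.
  apply: measurable_funM.
    exact: (measurable_normr (L1loc_measurable lg)).
  apply: measurable_fun_borel.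
  rewrite (_ : (fun _ => _) = (fun z : 'rV[R]_N => (1 + enorm z `^ p) `^ (-1))); last first.
    by apply/funext => z; rewrite powR_inv1// ltW.
  apply: (measurableT_comp (measurable_powR (-1))); apply: measurable_funD => //.
  exact: (measurableT_comp (measurable_powR p) measurable_enorm).
have ih : rintegrable mu h.
  by apply: (ge0_rintegrable mh) => // z; rewrite divr_ge0// ltW.
pose A := N%:R * (`|x| / d + `|k|).
have A0 : 0 <= A by rewrite mulr_ge0// addr_ge0// divr_ge0// ltW.
pose D := d `^ (- (P - p)) * (d `^ (- p) + A `^ p).
exists (fun y => D * h (affine x k y)).
  by apply: rintegrableZ; exact: (integrable_affine x k0 ih).
move=> y; split.
  rewrite mulr_ge0// ?divr_ge0// ?(ltW (w0 _))//.
  by rewrite mulr_ge0// ?addr_ge0// powR_ge0.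
move=> dy; rewrite /h /affine mulrCA ler_wpM2l//.
have y0 : 0 < enorm y by exact: lt_le_trans dy.
rewrite ler_pdivlMr// mulrC ler_pdivrMr ?powR_gt0//.
have -> : enorm y `^ P = enorm y `^ (P - p) * enorm y `^ p.
  by rewrite -powRD ?subrK// (gt_eqF y0) implybT.
have h1 : 1 <= d `^ (- (P - p)) * enorm y `^ (P - p).
  rewrite powRN mulrC ler_pdivlMr ?powR_gt0// mul1r ge0_ler_powR ?nnegrE ?(ltW d0) ?(ltW y0)//.
  by rewrite /P /p; lra.
have h2 : 1 + enorm (x + k *: y) `^ p <= (d `^ (- p) + A `^ p) * enorm y `^ p.
  rewrite mulrDl lerD//.
    rewrite powRN mulrC ler_pdivlMr ?powR_gt0// mul1r.
    by rewrite ge0_ler_powR ?nnegrE ?(ltW d0) ?(ltW y0) ?(ltW p0).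
  rewrite -powRM ?(ltW y0)// ge0_ler_powR ?nnegrE ?enorm_ge0 ?(ltW p0)// ?mulr_ge0 ?enorm_ge0//.
    by rewrite addr_ge0// divr_ge0// ltW.
  exact: enorm_affine_le.
rewrite /D mulrACA; apply: le_trans h2 _.
by rewrite -[leLHS]mul1r ler_wpM2r// mulr_ge0// ?addr_ge0// powR_ge0.
Qed.

Lemma measurable_shifted g x (k : R) : L1loc g ->
  measurable_fun [set: V] (fun y : V => g (x + k *: y)).
Proof.
move=> lg; have [->|k0] := eqVneq k 0.
  by rewrite (_ : (fun _ => _) = cst (g x))//; apply/funext => y; rewrite scale0r addr0.
exact: (measurableT_comp (L1loc_measurable lg) (measurable_lebesgue_affine x k0)).
Qed.

(** The bound near 0 makes the quotient O(|y|^(q-2t-N)), where q > 2t; away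
    from 0 each term of the sum is integrable by [L1weighted_far]. *)
Lemma rintegrable_difference_quotient n (c k : 'I_n -> R) g x (t t' q C : R) :
  (0 < N)%N -> 0 < t' <= t -> 2 * t < q -> L1weighted t' g ->
  (\forall y \near (0 : 'rV[R]_N), `|\sum_j c j * g (x + k j *: y)| <= C * enorm y `^ q) ->
  rintegrable mu (fun y : V => (\sum_j c j * g (x + k j *: y)) / enorm y `^ (N%:R + 2 * t)).
Proof.
move=> N0 tt tq wg /nbhs_ballP[r /= r0 hr].
have t'0 : 0 < t by case/andP: tt => h1 /(lt_le_trans h1).
have P0 : 0 < N%:R + 2 * t by rewrite ltr_wpDl// mulr_gt0.
set P := N%:R + 2 * t in P0 *.
have lg : L1loc g by case: wg.
pose d := Num.min r 1.
have d0 : 0 < d by rewrite lt_min r0 ltr01.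
have mF : measurable_fun [set: V] (fun y : V => \sum_j c j * g (x + k j *: y)).
  exact: (measurable_linear_combination c (fun j => measurable_shifted x (k j) lg)).
have /choice[G hG] : forall j, exists G : V -> R, rintegrable mu G /\
    forall y, 0 <= G y /\ (d <= enorm y -> `|g (x + k j *: y)| / enorm y `^ P <= G y).
  by move=> j; have [G] := L1weighted_far x (k j) N0 tt d0 wg; exists G.
have qP : 0 < N%:R + (q - P) by rewrite /P; lra.
apply: (@rintegrable_le _ _ _ mu _ (fun y : V => `|C| *
   (\1_[set y : 'rV[R]_N | enorm y \in `]0, 2[] y * enorm y `^ (q - P)) +
   \sum_j `|c j| * G j y)).
- apply: (measurable_funM mF).
  apply: measurable_fun_borel; under eq_fun do rewrite -powRN.
  exact: (measurableT_comp (measurable_powR (- P)) measurable_enorm).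
- move=> y.
  have S0 : 0 <= \sum_j `|c j| * G j y.
    by apply: sumr_ge0 => j _; rewrite mulr_ge0//; have [_ /(_ y)[]] := hG j.
  rewrite normrM normfV [X in _ / X <= _]ger0_norm ?powR_ge0//.
  have [yd|dy] := ltP (enorm y) d; last first.
    apply: (@le_trans _ _ (\sum_j `|c j| * G j y)); last first.
      by rewrite lerDr !mulr_ge0// powR_ge0.
    rewrite ler_pdivrMr ?powR_gt0 ?(lt_le_trans d0)//.
    apply: le_trans (ler_norm_sum _ _ _) _; rewrite mulr_suml; apply: ler_sum => j _.
    rewrite normrM -mulrA ler_wpM2l// -ler_pdivrMr ?powR_gt0 ?(lt_le_trans d0)//.
    by have [_ /(_ y)[_]] := hG j; apply.
  (* at y = 0 the denominator is 0, and so is the quotient *)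
  have [y0|y0] := eqVneq y 0.
    have -> : enorm y `^ P = 0 by rewrite y0 enorm0 powR0// (gt_eqF P0).
    by rewrite invr0 mulr0 addr_ge0// !mulr_ge0// powR_ge0.
  have ey0 : 0 < enorm y by rewrite lt_def enorm_ge0 enorm_eq0 y0.
  have /hr hy : ball (0 : 'rV[R]_N) r y.
    rewrite mx_norm_ball /ball_ /= sub0r normrN.
    by apply: le_lt_trans (mx_norm_le_enorm y) _; apply: lt_le_trans yd _; rewrite ge_min lexx.
  rewrite -[leLHS]addr0 lerD//.
  rewrite indicE mem_set /=; last first.
    rewrite in_itv/= ey0 /=; apply: lt_trans yd _.
    by apply: (@le_lt_trans _ _ 1); [rewrite ge_min lexx orbT|rewrite ltr1n].
  rewrite mul1r powRD ?(gt_eqF ey0) ?implybT// powRN mulrA ler_wpM2r ?invr_ge0 ?powR_ge0//.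
  by apply: le_trans hy _; rewrite ler_wpM2r ?powR_ge0// ler_norm.
apply: rintegrableD.
  by apply: rintegrableZ; exact: rintegrable_enorm_near.
by apply: rintegrable_sum => j; apply: rintegrableZ; have [] := hG j.
Qed.

End difference_quotient.

(** * Integration by parts against a power of the norm *)

Section parts_against_power.
Context {R : realType} {N : nat}.
Implicit Types (f g h u : 'rV[R]_N -> R) (x y z : 'rV[R]_N).
Local Notation mu := (@lebesgue_rV R N).
Local Notation V := (lebesgue_type R N).

Lemma sqdist_affine x (k : R) y : k != 0 -> sqdist x k^-1 (affine x k y) = sqnorm y.
Proof.
move=> k0; rewrite /sqdist /affine (addrC x) addrK scalerA mulVf// scale1r//.
Qed.

Lemma annular_sqnormE (a b p : R) :
  (fun y : 'rV[R]_N => annular a b p 0 0 (sqnorm y)) =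
  (fun y => annular a b p 0 0 (sqdist 0 1 y)).
Proof. by apply/funext => y; rewrite /sqdist scale1r subr0. Qed.

Lemma annular_sqnorm_test (a b p : R) : 0 < a -> 0 < b ->
  test_function (fun y : 'rV[R]_N => annular a b p 0 0 (sqnorm y)).
Proof. by move=> a0 b0; rewrite annular_sqnormE; exact: annular_sqdist_test (oner_neq0 R). Qed.

Lemma rintegrable_radial_laplacian (a b p : R) : 0 < a -> 0 < b ->
  rintegrable mu (fun y : V => radial_laplacian N a b p (sqnorm y)) /\
  \int[mu]_y radial_laplacian N a b p (sqnorm y) = 0.
Proof.
move=> a0 b0; set phi := fun y : 'rV[R]_N => annular a b p 0 0 (sqnorm y).
have tphi : test_function phi by exact: annular_sqnorm_test.
have E : (fun y : V => radial_laplacian N a b p (sqnorm y)) =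
    (fun y : V => \sum_(i < N) partials [:: i; i] phi y).
  apply/funext => y; have := neg_laplacian_annular 0 1 b p y a0.
  rewrite -annular_sqnormE /sqdist scale1r subr0 expr1n mul1r => /oppr_inj <- //.
have ti i : rintegrable mu (partials [:: i; i] phi : V -> R).
  exact: rintegrable_test_function (test_function_partials [:: i; i] tphi).
rewrite E; split; first exact: (rintegrable_sum ti).
rewrite (Rintegral_sum_T ti) big1// => i _.
exact: (Rintegral_partial_eq0 i (test_function_partials [:: i] tphi)).
Qed.

(** Each node k of the difference contributes with the test function whose value at
    x + k y is the cut-off power of |y|; its Laplacian is k^-2 times the one in y.
    For k = 0 the claim is that the Laplacian of a test function has integral 0. *)
Lemma parts_radial (a b p : R) x (k : R) g h : 0 < a -> 0 < b -> L1loc g -> L1loc h ->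
  (forall phi, test_function phi ->
    \int[mu]_z (g z * neg_laplacian phi z) = \int[mu]_z (h z * phi z)) ->
  [/\ rintegrable mu (fun y : V => g (x + k *: y) * radial_laplacian N a b p (sqnorm y)),
      rintegrable mu (fun y : V => h (x + k *: y) * annular a b p 0 0 (sqnorm y)) &
      \int[mu]_y (g (x + k *: y) * radial_laplacian N a b p (sqnorm y)) =
      - (k ^+ 2 * \int[mu]_y (h (x + k *: y) * annular a b p 0 0 (sqnorm y)))].
Proof.
move=> a0 b0 lg lh gh.
have [->|k0] := eqVneq k 0.
  have [iL L0] := rintegrable_radial_laplacian p a0 b0.
  have iA := rintegrable_test_function (annular_sqnorm_test p a0 b0).
  have E f (c : V -> R) :
      (fun y : V => f (x + 0 *: y) * c y) = (fun y : V => f x * c y).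
    by apply/funext => y; rewrite scale0r addr0.
  rewrite !E; split; [exact: rintegrableZ|exact: rintegrableZ|].
  by rewrite (RintegralZ_T (g x) iL) L0 mulr0 expr0n mul0r oppr0.
pose psi z := annular a b p 0 0 (sqdist x k^-1 z).
have tpsi : test_function psi by apply: annular_sqdist_test; rewrite ?invr_neq0.
have L z : radial_laplacian N a b p (sqdist x k^-1 z) = - k ^+ 2 * neg_laplacian psi z.
  by rewrite neg_laplacian_annular// mulrNN mulrA -exprMn mulfV// expr1n mul1r.
have i1 := rintegrable_test lg (test_function_neg_laplacian tpsi).
have i2 := rintegrable_test lh tpsi.
have E1 : (fun y : V => g (x + k *: y) * radial_laplacian N a b p (sqnorm y)) =
    (fun y : V => - k ^+ 2 * (g (affine x k y) * neg_laplacian psi (affine x k y))).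
  by apply/funext => y; rewrite mulrCA -L sqdist_affine.
have E2 : (fun y : V => h (x + k *: y) * annular a b p 0 0 (sqnorm y)) =
    (fun y : V => h (affine x k y) * psi (affine x k y)).
  by apply/funext => y; rewrite /psi sqdist_affine.
have j1 := integrable_affine x k0 i1.
have j2 := integrable_affine x k0 i2.
rewrite E1 E2; split; [exact: (rintegrableZ _ j1)|exact: j2|].
rewrite (RintegralZ_T _ j1) mulNr; congr (- (_ * _)).
by rewrite (Rintegral_affine x k0 i1) (Rintegral_affine x k0 i2) gh.
Qed.

Lemma sqnorm_powR y (q : R) : sqnorm y `^ q = enorm y `^ (2 * q).
Proof. by rewrite -sqr_enorm -powR_mulrn ?enorm_ge0// -powRrM. Qed.

Lemma sqnorm_gt0 y : y != 0 -> 0 < sqnorm y.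
Proof.
by move=> y0; rewrite -sqr_enorm exprn_gt0// lt_def enorm_ge0 enorm_eq0 y0.
Qed.

(** The exponent p makes |y|^(2p) = |y|^(-N-2t+2).  After cutting off with a = i+1 and
    b = 1/(i+1), both integrands are the integrable ones multiplied by bounded factors
    that converge to multiples of exp(-1). *)
Lemma parts_against_power n (c k : 'I_n -> R) x g h (t : R) :
  1 < t -> L1loc g -> L1loc h ->
  (forall phi, test_function phi ->
    \int[mu]_z (g z * neg_laplacian phi z) = \int[mu]_z (h z * phi z)) ->
  rintegrable mu (fun y : V =>
    (\sum_j c j * g (x + k j *: y)) / enorm y `^ (N%:R + 2 * t)) ->
  rintegrable mu (fun y : V =>
    (\sum_j c j * k j ^+ 2 * h (x + k j *: y)) / enorm y `^ (N%:R + 2 * (t - 1))) ->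
  2 * t * (N%:R + 2 * t - 2) *
  \int[mu]_y ((\sum_j c j * g (x + k j *: y)) / enorm y `^ (N%:R + 2 * t)) =
  - \int[mu]_y ((\sum_j c j * k j ^+ 2 * h (x + k j *: y)) /
                enorm y `^ (N%:R + 2 * (t - 1))).
Proof.
move=> t1 lg lh gh iF iG.
have P0 : 0 < N%:R + 2 * t by rewrite ltr_wpDl//; lra.
have Q0 : 0 < N%:R + 2 * (t - 1) by rewrite ltr_wpDl//; lra.
set F := fun y : V => _ in iF; set G := fun y : V => _ in iG.
pose p := - (N%:R + 2 * (t - 1)) / 2.
pose a (i : nat) : R := i.+1%:R; pose b (i : nat) : R := i.+1%:R^-1.
have a0 i : 0 < a i by rewrite ltr0n.
have b0 i : 0 < b i by rewrite invr_gt0 ltr0n.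
(* the bounded factors of the two integrands *)
pose pr (i : nat) (y : V) := laplacian_profile N p (a i * sqnorm y - 1) (1 - b i * sqnorm y).
pose qr (i : nat) (y : V) := flat 0 (a i * sqnorm y - 1) * flat 0 (1 - b i * sqnorm y).
have F0 : F 0 = 0 by rewrite /F enorm0 powR0 ?(gt_eqF P0)// invr0 mulr0.
have G0 : G 0 = 0 by rewrite /G enorm0 powR0 ?(gt_eqF Q0)// invr0 mulr0.
have sq0 : sqnorm (0 : 'rV[R]_N) = 0 by rewrite -sqr_enorm enorm0 expr0n.
have EF i y : F y * pr i y =
    \sum_j c j * (g (x + k j *: y) * radial_laplacian N (a i) (b i) p (sqnorm y)).
  have [->|y0] := eqVneq y 0.
    rewrite F0 mul0r big1// => j _.
    rewrite sq0 /radial_laplacian mulr0 mul0r add0r /annular' !annular_eq0 ?invr_gt0//.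
    by rewrite !mulr0 subr0 mulr0 addr0 mulr0 subr0 !mulr0.
  rewrite radial_laplacianE ?sqnorm_gt0// sqnorm_powR.
  have -> : 2 * (p - 1) = - (N%:R + 2 * t) by rewrite /p; field.
  by rewrite powRN /F -[LHS]mulrA mulr_suml; apply: eq_bigr => j _; rewrite /pr !mulrA.
have EG i y : G y * qr i y =
    \sum_j c j * k j ^+ 2 * (h (x + k j *: y) * annular (a i) (b i) p 0 0 (sqnorm y)).
  have [->|y0] := eqVneq y 0.
    rewrite G0 mul0r big1// => j _.
    by rewrite sq0 annular_eq0 ?invr_gt0// !mulr0.
  rewrite /annular sqnorm_powR.
  have -> : 2 * p = - (N%:R + 2 * (t - 1)) by rewrite /p; field.
  by rewrite powRN /G -[LHS]mulrA mulr_suml; apply: eq_bigr => j _; rewrite /qr !mulrA.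
have EF' i : (fun y : V => F y * pr i y) = (fun y : V => \sum_j c j *
    (g (x + k j *: y) * radial_laplacian N (a i) (b i) p (sqnorm y))) := funext (EF i).
have EG' i : (fun y : V => G y * qr i y) = (fun y : V => \sum_j c j * k j ^+ 2 *
    (h (x + k j *: y) * annular (a i) (b i) p 0 0 (sqnorm y))) := funext (EG i).
have parts i j := parts_radial p x (k j) (a0 i) (b0 i) lg lh gh.
have IFG i : \int[mu]_y (F y * pr i y) = - \int[mu]_y (G y * qr i y).
  rewrite EF' EG'.
  rewrite Rintegral_sum_T => [|j]; last by apply: rintegrableZ; have [] := parts i j.
  rewrite Rintegral_sum_T => [|j]; last by apply: rintegrableZ; have [] := parts i j.
  rewrite -sumrN; apply: eq_bigr => j _; have [p1 p2 p3] := parts i j.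
  by rewrite (RintegralZ_T _ p1) (RintegralZ_T _ p2) p3 mulrN mulrA.
have mF i : measurable_fun [set: V] (fun y => F y * pr i y).
  rewrite EF'.
  apply: (@rintegrable_measurable _ _ _ mu); apply: rintegrable_sum => j.
  by apply: rintegrableZ; have [] := parts i j.
have mG i : measurable_fun [set: V] (fun y => G y * qr i y).
  rewrite EG'.
  apply: (@rintegrable_measurable _ _ _ mu); apply: rintegrable_sum => j.
  by apply: rintegrableZ; have [] := parts i j.
have aoo (r : R) : 0 < r -> (fun i => a i * r - 1) @ \oo --> +oo.
  move=> r0; apply/cvgryPge => A; near=> i; rewrite lerBrDr -ler_pdivrMr//.
  by apply: le_trans (_ : i%:R <= _); [near: i; exact: nbhs_infty_ger|rewrite ler_nat].
have b1 (r : R) : (fun i => 1 - b i * r) @ \oo --> (1 : R).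
  rewrite -[X in _ --> X]subr0 -(mul0r r); apply: cvgB; first exact: cvg_cst.
  by apply: cvgMl; exact: cvg_harmonic.
have [K hK] := laplacian_profile_bounded (R := R) N p.
have limF : \int[mu]_y (F y * pr i y) @[i --> \oo] -->
    \int[mu]_y (F y * (2 * p * (N%:R + 2 * p - 2) * expR (- 1))).
  apply: (@dominated_cvg_Rintegral _ _ _ mu _ _ (fun y : V => K * `|F y|)).
  - exact: mF.
  - move=> y; have [->|y0] := eqVneq y 0.
      rewrite F0 mul0r; under eq_fun do rewrite mul0r; exact: cvg_cst.
    apply: cvgZr; apply: laplacian_profile_cvg => //; apply: aoo; exact: sqnorm_gt0.
  - by move=> i y; rewrite normrM mulrC ler_wpM2r//; exact: hK.
  - apply: rintegrableZ; exact: (integrable_norm iF).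
have limG : \int[mu]_y (G y * qr i y) @[i --> \oo] --> \int[mu]_y (G y * expR (- 1)).
  apply: (@dominated_cvg_Rintegral _ _ _ mu _ _ (fun y : V => `|G y|)).
  - exact: mG.
  - move=> y; have [->|y0] := eqVneq y 0.
      rewrite G0 mul0r; under eq_fun do rewrite mul0r; exact: cvg_cst.
    apply: cvgZr.
    have -> : expR (- 1) = 1 * flat 0 1 :> R by rewrite flat_gt0E// expr0 !invr1 !mul1r.
    apply: cvgM.
      by have := @flat_cvgy R 0 _ (aoo _ (sqnorm_gt0 y0)); rewrite eqxx.
    by apply: continuous_cvg; [exact: continuous_flat|exact: b1].
  - move=> i y; rewrite normrM -[leRHS]mulr1 ler_wpM2l//.
    have f1 (z : R) : flat 0 z <= 1 :> R by have := flat_le 0 z; rewrite expr0.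
    by rewrite ger0_norm ?mulr_ge0 ?flat_ge0// mulr_ile1 ?flat_ge0.
  - exact: (integrable_norm iG).
have lim2 : \int[mu]_y (F y * pr i y) @[i --> \oo] --> - \int[mu]_y (G y * expR (- 1)).
  have -> : (fun i => \int[mu]_y (F y * pr i y)) = (fun i => - \int[mu]_y (G y * qr i y)).
    exact/funext.
  exact: cvgN limG.
have := cvg_unique _ limF lim2.
have -> : (fun y : V => F y * (2 * p * (N%:R + 2 * p - 2) * expR (- 1))) =
    (fun y : V => (2 * p * (N%:R + 2 * p - 2) * expR (- 1)) * F y).
  by apply/funext => y; rewrite mulrC.
have -> : (fun y : V => G y * expR (- 1)) = (fun y : V => expR (- 1) * G y).
  by apply/funext => y; rewrite mulrC.
rewrite (RintegralZ_T _ iF) (RintegralZ_T _ iG) -mulrN mulrAC [in RHS]mulrC.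
have e0 : expR (- 1) != 0 :> R by rewrite gt_eqF// expR_gt0.
move=> /(_ _ _)/(mulIf e0) <-.
by congr (_ * _); rewrite /p; field.
Unshelve. all: by end_near. Qed.

End parts_against_power.

(** * Reduction to the second difference *)

Section even_difference.
Context {R : realType} {N : nat}.
Implicit Types (g : 'rV[R]_N -> R) (x y z : 'rV[R]_N).
Local Notation mu := (@lebesgue_rV R N).
Local Notation V := (lebesgue_type R N).

Lemma finite_differenceE m g x y :
  finite_difference m g x y =
  \sum_(j < (2 * m).+1) fd_weight j * g (x + fd_node j *: y).
Proof. by []. Qed.

Lemma finite_difference1E g x y :
  finite_difference 1 g x y = 2 * g x - g (x + y) - g (x - y).
Proof.
rewrite finite_differenceE !big_ord_recl big_ord0 /= !fd_weightE !fd_nodeE /= /bump /=.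
rewrite !add1n bin0 binn bin1 expr0 expr1 mulr0n mulr1n addr0 addNr scale0r addr0.
rewrite (_ : - 1 + 2%:R = 1 :> R) ?scale1r ?scaleN1r; last by ring.
by ring.
Qed.

(** The sum is averaged with its reflection in k, and
    g(x) sum_k a_k k^(2n) = 0 is subtracted. *)
Lemma even_difference m n g x y : (n < m)%N ->
  \sum_(j < (2 * m).+1) fd_weight j * fd_node j ^+ (2 * n) * g (x + fd_node j *: y) =
  - 2^-1 * \sum_(j < (2 * m).+1)
    fd_weight j * fd_node j ^+ (2 * n) * finite_difference 1 g x (fd_node j *: y).
Proof.
move=> nm; set S := LHS.
have S_rev : S = \sum_(j < (2 * m).+1)
    fd_weight j * fd_node j ^+ (2 * n) * g (x - fd_node j *: y).
  rewrite /S (reindex_inj rev_ord_inj) /=; apply: eq_bigr => j _.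
  by rewrite fd_weight_rev fd_node_rev scaleNr exprM sqrrN -exprM.
have S0 : \sum_(j < (2 * m).+1) fd_weight j * fd_node j ^+ (2 * n) = 0 :> R.
  by apply: fd_moment; lia.
transitivity (- 2^-1 * (2 * g x * (\sum_(j < (2 * m).+1) fd_weight j * fd_node j ^+ (2 * n)) - S - S)).
  by rewrite S0; field.
rewrite {2}S_rev /S mulr_sumr -!sumrB; congr (_ * _); apply: eq_bigr => j _.
by rewrite finite_difference1E; ring.
Qed.

(** In the term with node k, the substitution of k y for y gives
    |k|^(N+2 sigma) |k|^(-N) k^(2n) = |k|^(2s), and the weights sum up to twice
    [fd_constant]. *)
Lemma integral_even_difference m n (sigma : R) g x : (n < m)%N -> 0 < sigma ->
  hypersingular_defined 1 sigma g x ->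
  \int[mu]_y ((\sum_(j < (2 * m).+1)
      fd_weight j * fd_node j ^+ (2 * n) * g (x + fd_node j *: y)) /
      enorm y `^ (N%:R + 2 * sigma)) =
  - fd_constant m (n%:R + sigma) * \int[mu]_y hypersingular_integrand 1 sigma g x y.
Proof.
move=> nm s0 iJ; have P0 : 0 < N%:R + 2 * sigma by rewrite ltr_wpDl// mulr_gt0.
set P := N%:R + 2 * sigma in P0 *.
pose J := hypersingular_integrand 1 sigma g x.
pose A (j : 'I_(2 * m).+1) : R := fd_weight j * fd_node j ^+ (2 * n) * `|fd_node j| `^ P.
(* for k = 0 both sides vanish: the difference at 0 and the power of |k| *)
have scaled (k : R) y : finite_difference 1 g x (k *: y) / enorm y `^ P =
    `|k| `^ P * J (k *: y).
  have [->|k0] := eqVneq k 0.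
    rewrite normr0 powR0 ?(gt_eqF P0)// mul0r scale0r finite_difference1E.
    by rewrite subr0 addr0 (_ : 2 * g x - _ - _ = 0) ?mul0r//; ring.
  have kp : 0 < `|k| `^ P by rewrite powR_gt0// normr_gt0.
  rewrite /J /hypersingular_integrand enormZ powRM ?enorm_ge0// -/P invfM.
  by rewrite [RHS]mulrCA; congr (_ * _); rewrite mulVKf// gt_eqF.
have E : (fun y : V => (\sum_(j < (2 * m).+1)
      fd_weight j * fd_node j ^+ (2 * n) * g (x + fd_node j *: y)) / enorm y `^ P) =
    (fun y : V => - 2^-1 * \sum_(j < (2 * m).+1) A j * J (affine 0 (fd_node j) y)).
  apply/funext => y; rewrite even_difference// -mulrA; congr (_ * _).
  rewrite mulr_suml; apply: eq_bigr => j _.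
  by rewrite -mulrA scaled mulrA /affine add0r.
have [iA hA] : (forall j, rintegrable mu (fun y : V => A j * J (affine 0 (fd_node j) y))) /\
    (forall j, \int[mu]_y (A j * J (affine 0 (fd_node j) y)) =
       fd_weight j * `|fd_node j| `^ (2 * (n%:R + sigma)) * \int[mu]_y J y).
  apply: all_and2 => j; have [k0|k0] := eqVneq (fd_node j : R) 0.
    have A0 : A j = 0 by rewrite /A k0 normr0 powR0 ?(gt_eqF P0)// mulr0.
    have -> : (fun y : V => A j * J (affine 0 (fd_node j) y)) = (fun=> 0).
      by apply/funext => y; rewrite A0 mul0r.
    split; first exact: rintegrable0.
    rewrite /Rintegral integral0 k0 normr0 powR0 ?mulr0 ?mul0r// gt_eqF//.
    by rewrite mulr_gt0// ltr_wpDl.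
  have i1 := integrable_affine 0 k0 iJ.
  split; first exact: (rintegrableZ (A j) i1).
  rewrite (RintegralZ_T (A j) i1) (Rintegral_affine 0 k0 iJ) mulrA; congr (_ * _).
  rewrite /A -[fd_weight j * _ * _]mulrA -[LHS]mulrA; congr (_ * _); rewrite -mulrA.
  have kp : 0 < `|fd_node j : R| by rewrite normr_gt0.
  have -> : fd_node j ^+ (2 * n) = `|fd_node j| `^ (2 * n%:R) :> R.
    by rewrite -natrM powR_mulrn// exprM -real_normK ?num_real// -exprM.
  rewrite exprVn -powR_mulrn// -powRN.
  by rewrite -!powRD ?(gt_eqF kp) ?implybT//; congr (_ `^ _); rewrite /P; ring.
rewrite E (RintegralZ_T _ (rintegrable_sum iA)) (Rintegral_sum_T iA).
under eq_bigr do rewrite hA.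
rewrite -mulr_suml fd_weight_powR; last by rewrite gt_eqF// ltr_wpDl.
by rewrite mulrA; congr (_ * _); field.
Qed.

End even_difference.

(** * The identity for iterated Laplacians *)

Lemma telescope_eq (T : Type) n (a : nat -> T) :
  (forall j, (j < n)%N -> a j = a j.+1) -> a 0%N = a n.
Proof.
by elim: n => // n IH h; rewrite (IH (fun j jn => h j (ltnW jn))) (h n (ltnSn n)).
Qed.

Section core.
Context {R : realType} {N : nat}.
Implicit Types (g u : 'rV[R]_N -> R) (x y z : 'rV[R]_N).
Local Notation mu := (@lebesgue_rV R N).
Local Notation V := (lebesgue_type R N).

(** Near x the function w is the classical iterated Laplacian of u, to which
    [difference_at] applies. *)
Lemma near_difference U x K (tau : R) j u w n (c k : 'I_n -> R) :
  open U -> U x -> 0 < tau -> (2 * j <= K)%N -> hoelder_at U x K tau u ->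
  (forall y, U y -> w y = iter j neg_laplacian u y) ->
  (forall l, (l <= K - 2 * j)%N -> \sum_i c i * k i ^+ l = 0) ->
  exists C, \forall y \near (0 : 'rV[R]_N),
    `|\sum_i c i * w (x + k i *: y)| <= C * enorm y `^ ((K - 2 * j)%:R + tau).
Proof.
move=> oU Ux tau0 jK hu wU moment.
have [C hC] := difference_at oU Ux tau0 (hoelder_at_iter oU Ux jK hu) moment.
exists C; have Uk i : \forall y \near (0 : 'rV[R]_N), U (x + k i *: y).
  have sc : (fun y : 'rV[R]_N => k i *: y) @ (0 : 'rV[R]_N) --> (0 : 'rV[R]_N).
    by rewrite -[X in _ --> X](scaler0 _ (k i)); exact: scaler_continuous.
  exact: sc _ (near_shift0 oU Ux).
apply: filterS (filterI hC (filter_forall _ Uk)) => y [h Uy].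
by apply: le_trans h; rewrite (eq_bigr (fun i => c i * iter j neg_laplacian u (x + k i *: y)))// => i _; rewrite wU.
Qed.

(** The chain of the integrals I_j = int F j.  The integrability of F j rests on
    2j + (K - 2j) <= 2n + 1 < 2m, which makes the moments vanish up to the order
    of the expansion of v j. *)
Lemma hypersingular_iter m n (sigma tau : R) K U u (v : nat -> 'rV[R]_N -> R) x :
  (0 < N)%N -> (n < m)%N -> 0 < sigma < 1 ->
  open U -> U x -> 0 < tau ->
  (2 * n <= K)%N -> (K <= 2 * n + 1)%N -> 2 * (n%:R + sigma) < K%:R + tau ->
  hoelder_at U x K tau u ->
  (forall j, (j <= n)%N -> forall y, U y -> v j y = iter j neg_laplacian u y) ->
  (forall j, (j <= n)%N -> exists2 t, 0 < t <= (n - j)%:R + sigma & L1weighted t (v j)) ->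
  (forall j, (j < n)%N -> forall phi, test_function phi ->
    \int[mu]_z (v j z * neg_laplacian phi z) = \int[mu]_z (v j.+1 z * phi z)) ->
  [/\ hypersingular_defined m (n%:R + sigma) (v 0%N) x,
      hypersingular_defined 1 sigma (v n) x &
      hypersingular m (n%:R + sigma) (v 0%N) x = frac_laplacian sigma (v n) x].
Proof.
move=> N0 nm hsigma oU Ux tau0 nK Kn Ktau hu vU wv parts.
have /andP[s0 s1] := hsigma.
pose t j : R := (n - j)%:R + sigma.
have t0 j : 0 < t j by rewrite ltr_wpDl.
pose F j (y : V) := (\sum_(i < (2 * m).+1) fd_weight i * fd_node i ^+ (2 * j) *
   v j (x + fd_node i *: y)) / enorm y `^ (N%:R + 2 * t j).
have qt j : (j <= n)%N -> 2 * t j < (K - 2 * j)%:R + tau.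
  move=> jn; rewrite /t natrB// [(K - _)%:R]natrB; last by lia.
  by rewrite natrM; lra.
have iF j : (j <= n)%N -> rintegrable mu (F j).
  move=> jn; have [t' ht' wt'] := wv j jn.
  have moment l : (l <= K - 2 * j)%N ->
      \sum_(i < (2 * m).+1) fd_weight i * fd_node i ^+ (2 * j) * fd_node i ^+ l = 0 :> R.
    move=> lK; under eq_bigr do rewrite -mulrA -exprD.
    by apply: fd_moment; lia.
  have jK : (2 * j <= K)%N by lia.
  have [C hC] := near_difference oU Ux tau0 jK hu (vU j jn) moment.
  exact: (rintegrable_difference_quotient N0 ht' (qt j jn) wt' hC).
have iJ : hypersingular_defined 1 sigma (v n) x.
  have [t' ht' wt'] := wv n (leqnn n).
  have moment l : (l <= K - 2 * n)%N ->
      \sum_(i < (2 * 1).+1) fd_weight i * fd_node i ^+ l = 0 :> R.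
    by move=> lK; apply: fd_moment; lia.
  have [C hC] := near_difference oU Ux tau0 nK hu (vU n (leqnn n)) moment.
  have := qt n (leqnn n); rewrite /t subnn add0r in ht' * => qs.
  exact: (rintegrable_difference_quotient N0 ht' qs wt' hC).
have F0E y : F 0%N y = hypersingular_integrand m (n%:R + sigma) (v 0%N) x y.
  rewrite /F /hypersingular_integrand /t subn0; congr (_ / _).
  by rewrite finite_differenceE; apply: eq_bigr => i _; rewrite muln0 expr0 mulr1.
have I0 : hypersingular_defined m (n%:R + sigma) (v 0%N) x.
  have := iF 0%N (leq0n n); congr (integrable _ _ _).
  by apply/funext => y /=; rewrite F0E.
split; [exact: I0|exact: iJ|].
(* by the recurrence of the gamma factors, this is the recurrence of the integrals *)
have step j : (j < n)%N ->
    gamma_ratio N (t j) * \int[mu]_y F j y = gamma_ratio N (t j.+1) * \int[mu]_y F j.+1 y.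
  move=> jn; have tj : t j = (n - j.+1).+1%:R + sigma by rewrite /t subnSK.
  have tj1 : t j - 1 = t j.+1 by rewrite tj /t -natr1; ring.
  have E : F j.+1 = fun y : V => (\sum_(i < (2 * m).+1)
      fd_weight i * fd_node i ^+ (2 * j) * fd_node i ^+ 2 * v j.+1 (x + fd_node i *: y)) /
      enorm y `^ (N%:R + 2 * (t j - 1)).
    apply/funext => y; rewrite /F tj1; congr (_ / _); apply: eq_bigr => i _.
    rewrite -[fd_weight i * _ * _ ^+ 2]mulrA -exprD.
    by rewrite (_ : 2 * j + 2 = 2 * j.+1)%N//; lia.
  have t1 : 1 < t j by rewrite tj -natr1; have : 0 <= (n - j.+1)%:R :> R; [|lra].
  have [[_ _ [lg _]] [_ _ [lh _]]] := (wv j (ltnW jn), wv j.+1 jn).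
  have iG := iF j.+1 jn; rewrite E in iG *.
  have := parts_against_power t1 lg lh (parts j jn) (iF j (ltnW jn)) iG.
  move=> /(congr1 (fun r => - r * gamma_ratio N (t j.+1))); rewrite opprK => H.
  rewrite [RHS]mulrC -H {1}tj (gamma_ratioS (N := N) (n - j.+1) hsigma N0) -tj.
  by rewrite -/(t j.+1) -/(F j) !mulNr; congr (- _); rewrite mulrAC.
have tn : t n = sigma by rewrite /t subnn add0r.
have t00 : t 0%N = n%:R + sigma by rewrite /t subn0.
have Fn : F n = fun y : V => (\sum_(i < (2 * m).+1) fd_weight i * fd_node i ^+ (2 * n) *
    v n (x + fd_node i *: y)) / enorm y `^ (N%:R + 2 * sigma).
  by rewrite /F tn.
have H := telescope_eq (a := fun j => gamma_ratio N (t j) * \int[mu]_y F j y) step.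
rewrite /= Fn (integral_even_difference nm s0 iJ) tn t00 in H.
rewrite /frac_laplacian /hypersingular !normalizationE fd_constant1.
have -> : \int[mu]_y hypersingular_integrand m (n%:R + sigma) (v 0%N) x y =
    \int[mu]_y F 0%N y by apply: eq_Rintegral => y _; rewrite F0E.
have S0 := fd_constant_neq0 nm hsigma.
apply: (mulIf S0); rewrite mulrAC.
transitivity (gamma_ratio N (n%:R + sigma) * \int[mu]_y F 0%N y / 2); first by field.
by rewrite H; field.
Qed.

End core.

(** * Functions equal almost everywhere *)

Lemma ae_forall_ord d (T : measurableType d) (R : realType)
    (mu : {measure set T -> \bar R}) n (P : 'I_n -> T -> Prop) :
  (forall i, {ae mu, forall y, P i y}) -> {ae mu, forall y, forall i, P i y}.
Proof. exact: filter_forall. Qed.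

Section transfer.
Context {R : realType} {N : nat}.
Implicit Types (f g u v : 'rV[R]_N -> R) (x y z : 'rV[R]_N).
Local Notation mu := (@lebesgue_rV R N).
Local Notation V := (lebesgue_type R N).

Lemma ae_affine x (k : R) (P : 'rV[R]_N -> Prop) : k != 0 ->
  {ae mu, forall z, P z} -> {ae mu, forall y, P (x + k *: y)}.
Proof.
move=> k0 [A [mA A0 PA]]; exists ((affine x k : V -> V) @^-1` A); split.
- by rewrite -[X in measurable X]setTI; exact: (measurable_lebesgue_affine x k0).
- by rewrite lebesgue_rV_preimage_affine// A0 mule0.
- by move=> y hy; apply: PA.
Qed.

(** The node k = 0 of the difference sees the value at x itself, which
    the almost everywhere equality does not control. *)
Lemma hypersingular_ae m (s : R) u v x : L1loc u -> L1loc v ->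
  {ae mu, forall z, v z = u z} -> v x = u x ->
  hypersingular_defined m s v x ->
  hypersingular_defined m s u x /\ hypersingular m s u x = hypersingular m s v x.
Proof.
move=> lu lv vu vux dv.
have mf f : L1loc f -> measurable_fun [set: V] (hypersingular_integrand m s f x : V -> R).
  move=> lf; apply: measurable_funM.
    exact: (measurable_linear_combination (@fd_weight R m)
      (fun j => measurable_shifted x (fd_node j) lf)).
  apply: measurable_fun_borel; under eq_fun do rewrite -powRN.
  exact: (measurableT_comp (measurable_powR _) measurable_enorm).
have E : {ae mu, forall y, hypersingular_integrand m s u x y = hypersingular_integrand m s v x y}.
  have h (j : 'I_(2 * m).+1) : {ae mu, forall y, v (x + fd_node j *: y) = u (x + fd_node j *: y)}.
    have [k0|k0] := eqVneq (fd_node j : R) 0; last exact: (ae_affine x k0 vu).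
    by apply: (ae_weaken _ vu) => y _; rewrite k0 scale0r addr0.
  apply: (ae_weaken _ (ae_forall_ord h)) => y hy.
  by congr (_ / _); rewrite !finite_differenceE; apply: eq_bigr => j _; rewrite hy.
split; first exact: (ae_rintegrable (mf u lu) E dv).
by congr (_ * _); exact: (ae_Rintegral (mf v lv) (mf u lu) E).
Qed.

Lemma test_function_iter j f : test_function f -> test_function (iter j neg_laplacian f).
Proof. by move=> tf; elim: j => //= j; exact: test_function_neg_laplacian. Qed.

Lemma test_function_L1weighted (t : R) f : test_function f -> L1weighted t f.
Proof.
move=> tf; have cf := smooth_continuous (test_function_smooth tf).
have w1 y : 1 <= 1 + enorm y `^ (N%:R + 2 * t) :> R by rewrite lerDl powR_ge0.
split; first exact: L1loc_continuous.
have mf := continuous_measurable_V cf.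
have /integrableP[_] := rintegrable_test_function tf.
apply: le_lt_trans; apply: ge0_le_integral_rV.
- by move=> y; rewrite lee_fin divr_ge0// (le_trans ler01).
- apply/measurable_EFinP; apply: (measurable_funM (measurable_normr mf)).
  apply: measurable_fun_borel.
  rewrite (_ : (fun _ => _) =
      (fun z : 'rV[R]_N => (1 + enorm z `^ (N%:R + 2 * t)) `^ (-1))); last first.
    by apply/funext => z; rewrite powR_inv1// (le_trans ler01).
  apply: (measurableT_comp (measurable_powR (-1))); apply: measurable_funD => //.
  exact: (measurableT_comp (measurable_powR _) measurable_enorm).
- exact/measurable_EFinP/(measurable_normr mf).
- by move=> y; rewrite lee_fin ler_pdivrMr ?(lt_le_trans ltr01)// ler_peMr.
Qed.

End transfer.

Theorem theorem1p2 (R : realType) (N m n : nat) (sigma beta s : R)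
    (hN : (0 < N)%N) (hnm : (n < m)%N)
    (hsigma : 0 < sigma < 1) (hbeta : 0 < beta < 1) (hs : s = n%:R + sigma) :
  (forall (U : set 'rV[R]_N) (u : 'rV[R]_N -> R) (v : nat -> 'rV[R]_N -> R),
      open U ->
      hoelder_space (2 * s + beta) U u ->
      sobolev_loc (2 * n)%N u ->
      (forall i, (i <= n)%N -> neg_laplacian_iter_in U i u (v i)) ->
      L1weighted sigma (v n) ->
      (forall i, (i < n)%N ->
         L1weighted (s - i%:R - 1 / 2) (v i) /\
         exists2 g, weak_gradient (v i) g &
                    L1weighted (s - i%:R - 1) (fun x => enorm (g x))) ->
      forall x, U x ->
        [/\ hypersingular_defined m s u x,
            hypersingular_defined 1 sigma (v n) x &
            hypersingular m s u x = frac_laplacian sigma (v n) x]) /\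
  (forall u : 'rV[R]_N -> R, test_function u ->
      forall x,
        [/\ hypersingular_defined m s u x,
            hypersingular_defined 1 sigma (iter n neg_laplacian u) x &
            hypersingular m s u x =
              frac_laplacian sigma (iter n neg_laplacian u) x]).
Proof.
have /andP[s0 s1] := hsigma; rewrite {}hs; split.
  move=> U u v oU hu su vu wn wi x Ux.
  have [K [tau [nK Kn tau0 Ktau hat]]] := hoelder_space_at oU Ux hsigma hbeta hu.
  have lu : L1loc u by have [g []] := su [::] isT.
  have wv j : (j <= n)%N -> exists2 t, 0 < t <= (n - j)%:R + sigma & L1weighted t (v j).
    rewrite leq_eqVlt => /predU1P[->|jn].
      by exists sigma => //; rewrite s0 lerDr ler0n.
    have [wj _] := wi j jn; exists (n%:R + sigma - j%:R - 1 / 2) => //.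
    have : 1 <= (n - j)%:R :> R by rewrite ler1n subn_gt0.
    by rewrite natrB ?(ltnW jn)// => h; apply/andP; split; lra.
  have lv j : (j <= n)%N -> L1loc (v j) by move=> /wv[t _ []].
  have parts j : (j < n)%N -> forall phi, test_function phi ->
      \int[@lebesgue_rV R N]_z (v j z * neg_laplacian phi z) =
      \int[@lebesgue_rV R N]_z (v j.+1 z * phi z).
    move=> jn phi tphi.
    have [[vj _] [vj1 _]] := (vu j (ltnW jn), vu j.+1 jn).
    rewrite (weak_neg_laplacian_iterE hN lu vj (lv j (ltnW jn)) (test_function_neg_laplacian tphi)).
    by rewrite (weak_neg_laplacian_iterE hN lu vj1 (lv j.+1 jn) tphi) iterSr.
  have vU j : (j <= n)%N -> forall y, U y -> v j y = iter j neg_laplacian u y.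
    by move=> /vu[].
  have [d0 dn E] := hypersingular_iter hN hnm hsigma oU Ux tau0 nK Kn Ktau hat vU wv parts.
  have [v0 _] := vu 0%N isT.
  have [du Eu] := hypersingular_ae lu (lv 0%N isT) v0 (vU 0%N isT x Ux) d0.
  by split; [exact: du|exact: dn|rewrite Eu E].
move=> u tu x; have su := test_function_smooth tu.
have Kn : (2 * n <= 2 * n + 1)%N by rewrite leq_addr.
have Ktau : 2 * (n%:R + sigma) < (2 * n + 1)%:R + 1 by rewrite natrD natrM; lra.
have wv j : (j <= n)%N ->
    exists2 t, 0 < t <= (n - j)%:R + sigma & L1weighted t (iter j neg_laplacian u).
  move=> _; exists sigma; first by rewrite s0 lerDr ler0n.
  exact/test_function_L1weighted/test_function_iter.
have parts j : (j < n)%N -> forall phi, test_function phi ->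
    \int[@lebesgue_rV R N]_z (iter j neg_laplacian u z * neg_laplacian phi z) =
    \int[@lebesgue_rV R N]_z (iter j.+1 neg_laplacian u z * phi z).
  move=> _ phi tphi; apply: (Rintegral_neg_laplacian_sym _ tphi).
  exact: test_function_smooth (test_function_iter j tu).
exact: (hypersingular_iter (v := fun j => iter j neg_laplacian u) hN hnm hsigma openT I
  ltr01 Kn (leqnn _) Ktau (smooth_hoelder_at x _ su) (fun j _ y _ => erefl) wv parts).
Qed.
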